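(* Let $\Sigma$ be a smooth rational polyhedral fan in $N_{\mathbb R}$ such that $|\Sigma|$ is a tropical linear space. Then $R^*(\Sigma)$ (equivalently, the integral Chow ring $A^*(X_\Sigma)$ of the associated smooth toric variety $X_\Sigma$) is a Poincaré duality ring (of dimension $\dim\Sigma$).
   Context: $N$ is a lattice with dual $M$ and pairing $\langle\cdot,\cdot\rangle$. A rational polyhedral fan is smooth if each cone is the positive hull of lattice vectors extendable to a basis of $N$; $u_\rho$ denotes the primitive generator of a ray $\rho\in\Sigma(1)$. $R^*(\Sigma)=\mathbb Z[x_\rho:\rho\in\Sigma(1)]/(\mathcal I_\Sigma+\mathcal J_\Sigma)$ with $\deg x_\rho=1$, where $\mathcal I_\Sigma$ is generated by $\prod_{\rho\in K}x_\rho$ for subsets $K\subseteq\Sigma(1)$ not spanning a cone of $\Sigma$, and $\mathcal J_\Sigma$ by $\sum_\rho\langle m,u_\rho\rangle x_\rho$, $m\in M$; it is isomorphic to $A^*(X_\Sigma)$ via $x_\rho\mapsto[D_\rho]$. A tropical linear space is a conical rational polyhedral set isomorphic (via a map extending to an integral linear isomorphism of linear spans) to $L_{\mathrm M}=\widetilde L_{\mathrm M}/\mathbb R\mathbf 1$ for a loop-free matroid ${\mathrm M}$ on $E$, where $\widetilde L_{\mathrm M}\subseteq\mathbb R^E$ is the set of $w$ such that for every circuit $C$ of ${\mathrm M}$ the minimum of $w_e$ over $e\in C$ is attained at least twice. A commutative $\mathbb N$-graded ring $R^*$ is a Poincaré duality ring of dimension $d$ if it is finitely generated as a $\mathbb Z$-module,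 $R^d\cong\mathbb Z$, $R^k=0$ for $k>d$, and for every $k$ multiplication induces an isomorphism $R^k\cong\Hom(R^{d-k},\mathbb Z)$ after identifying $R^d\cong\mathbb Z$. *)

(* Defs.v *)
From HB Require Import structures.
From mathcomp Require Import all_boot all_order all_algebra.
From Stdlib Require Import Reals.
Set Implicit Arguments. Unset Strict Implicit. Unset Printing Implicit Defensive.
Import GRing.Theory Num.Theory.
Local Open Scope ring_scope.

Definition intR (z : int) : R :=
  match z with Posz k => INR k | Negz k => Ropp (INR k.+1) end.

Definition rvec (n : nat) := 'I_n -> R.

Definition is_int_vec n (x : rvec n) : Prop :=
  exists z : 'I_n -> int, forall j, x j = intR (z j).

Definition in_span n (S : rvec n -> Prop) (x : rvec n) : Prop :=
  exists (k : nat) (c : 'I_k -> R) (v : 'I_k -> rvec n),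
    (forall i, S (v i)) /\
    forall j, x j = \big[Rplus/R0]_(i < k) Rmult (c i) (v i j).

(* Smooth fans, encoded by the primitive ray generators u_i (i : 'I_r) *)
(* and the set of subsets S of rays such that pos(u_i, i in S) is a    *)
(* cone of the fan (a smooth cone is simplicial, faces = subsets).     *)
Definition cone_of n r (u : 'I_r -> 'rV[int]_n) (S : {set 'I_r}) (x : rvec n) : Prop :=
  exists lam : 'I_r -> R,
    [/\ forall i, Rle R0 (lam i),
        forall i, i \notin S -> lam i = R0
      & forall j, x j = \big[Rplus/R0]_(i < r) Rmult (lam i) (intR (u i 0 j))].

Definition is_smooth_fan n r (u : 'I_r -> 'rV[int]_n) (cones : {set {set 'I_r}}) : Prop :=
  [/\ set0 \in cones,
      forall i, [set i] \in cones,
      forall S T : {set 'I_r}, S \in cones -> T \subset S -> T \in cones,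
      forall S T : {set 'I_r}, S \in cones -> T \in cones ->
        forall x, (cone_of u S x /\ cone_of u T x) <-> cone_of u (S :&: T) x
    &
      forall S : {set 'I_r}, S \in cones ->
        exists B : 'M[int]_n, B \in unitmx /\
          exists g : 'I_r -> 'I_n, {in S &, injective g} /\
            forall i, i \in S -> row (g i) B = u i ].

Definition fan_support n r (u : 'I_r -> 'rV[int]_n) (cones : {set {set 'I_r}})
  (x : rvec n) : Prop := exists2 S, S \in cones & cone_of u S x.

Definition fan_dim r (cones : {set {set 'I_r}}) : nat := \max_(S in cones) #|S|.

Definition is_loopfree_matroid m (C : {set {set 'I_m}}) : Prop :=
  [/\ set0 \notin C,
      forall C1 C2 : {set 'I_m}, C1 \in C -> C2 \in C -> C1 \subset C2 -> C1 = C2,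
      forall (C1 C2 : {set 'I_m}) e, C1 \in C -> C2 \in C -> C1 != C2 -> e \in C1 :&: C2 ->
        exists2 C3, C3 \in C & C3 \subset (C1 :|: C2) :\ e
    & (* loop-free: no circuit of size one *) forall e, [set e] \notin C ].

Definition Ltilde m (C : {set {set 'I_m}}) (w : rvec m) : Prop :=
  forall Cc : {set 'I_m}, Cc \in C -> exists e1 e2,
    [/\ e1 \in Cc, e2 \in Cc, e1 != e2, w e1 = w e2 &
        forall e, e \in Cc -> Rle (w e1) (w e)].

Definition eq_mod1 m (w w' : rvec m) : Prop :=
  exists c : R, forall e, w e = Rplus (w' e) c.

Definition int_mod1 m (w : rvec m) : Prop :=
  exists z : 'I_m -> int, eq_mod1 w (fun e => intR (z e)).

Definition Rlinear n m (f : rvec n -> rvec m) : Prop :=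
  (forall x y e, f (fun j => Rplus (x j) (y j)) e = Rplus (f x e) (f y e)) /\
  (forall c x e, f (fun j => Rmult c (x j)) e = Rmult c (f x e)).

(* T is a tropical linear space: there are a loop-free matroid M on E = 'I_m
   and an integral linear isomorphism  phi : span T -> span L_M  (L_M =
   \tilde L_M / R1 in R^E / R1) with phi(T) = L_M.  phi is represented by a
   linear map f : R^n -> R^E composed with the projection R^E -> R^E/R1. *)
Definition is_tropical_linear_space n (T : rvec n -> Prop) : Prop :=
  exists (m : nat) (C : {set {set 'I_m}}) (f : rvec n -> rvec m),
    [/\ is_loopfree_matroid C, Rlinear f &
     [/\
        forall x, in_span T x -> in_span (Ltilde C) (f x),
        forall x y, in_span T x -> in_span T y -> eq_mod1 (f x) (f y) ->
          forall j, x j = y j,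
        forall w, in_span (Ltilde C) w -> exists2 x, in_span T x & eq_mod1 (f x) w,
        forall x, in_span T x -> (is_int_vec x <-> int_mod1 (f x))
      & (forall x, T x -> Ltilde C (f x)) /\
        (forall w, Ltilde C w -> exists2 x, T x & eq_mod1 (f x) w) ] ].

Fixpoint mpoly (r : nat) : comNzRingType :=
  match r with
  | 0 => int
  | r'.+1 => {poly mpoly r'}
  end.

Fixpoint mvar (r : nat) : 'I_r -> mpoly r :=
  match r return 'I_r -> mpoly r with
  | 0 => fun _ => 0
  | r'.+1 => fun i => match unlift ord0 i with
                      | None => ('X : {poly mpoly r'})
                      | Some j => ((mvar j)%:P : {poly mpoly r'})
                      end
  end.

Definition homog r (k : nat) (p : mpoly r) : Prop :=
  exists c : k.-tuple 'I_r -> int,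
    p = \sum_(t : k.-tuple 'I_r) (\prod_(i <- t) mvar i) *~ c t.

Definition pairing n (m v : 'rV[int]_n) : int := \sum_(j < n) m 0 j * v 0 j.

Definition spans_cone n r (u : 'I_r -> 'rV[int]_n) (cones : {set {set 'I_r}})
  (K : {set 'I_r}) : Prop :=
  exists2 S, S \in cones & forall x, cone_of u K x <-> cone_of u S x.

Definition chow_ideal n r (u : 'I_r -> 'rV[int]_n) (cones : {set {set 'I_r}})
  (p : mpoly r) : Prop :=
  exists (a : {set 'I_r} -> mpoly r) (s : seq ('rV[int]_n * mpoly r)),
    (forall K, a K != 0 -> ~ spans_cone u cones K) /\
    p = \sum_(K : {set 'I_r}) a K * \prod_(i in K) mvar i
        + \sum_(mb <- s) mb.2 * \sum_(i < r) mvar i *~ pairing mb.1 (u i).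

(* R^* = P / Id (with P = mpoly r, Id an ideal, R^k = image of the degree-k
   part P_k, i.e. P_k / (P_k ∩ Id)) is a Poincare duality ring of dimension d. *)
Definition poincare_duality r (Id : mpoly r -> Prop) (d : nat) : Prop :=
  [/\
      exists (k : nat) (g : 'I_k -> mpoly r),
        forall p, exists c : 'I_k -> int, Id (p - \sum_(i < k) g i *~ c i),
      forall k : nat, leq d.+1 k -> forall p, homog k p -> Id p
    &
      exists deg : mpoly r -> int,
      [/\ forall p q, homog d p -> homog d q -> deg (p + q) = deg p + deg q,
          forall z : int, exists2 p, homog d p & deg p = z,
          forall p, homog d p -> (deg p = 0 <-> Id p),
          forall (k : nat) p, leq k d -> homog k p ->
            (forall q, homog (d - k) q -> deg (p * q) = 0) -> Id p
        &
          forall (k : nat) (phi : mpoly r -> int), leq k d ->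
            (forall q q', homog (d - k) q -> homog (d - k) q' ->
               phi (q + q') = phi q + phi q') ->
            (forall q, homog (d - k) q -> Id q -> phi q = 0) ->
            exists2 p, homog k p &
              forall q, homog (d - k) q -> phi q = deg (p * q) ] ].

(* Main.v *)
(* Only the lattice points T of the support matter. Call a smooth fan on T good if
   its Chow ring and those of all its star fans satisfy Poincare duality, witnessed
   by a Casimir element of the degree pairing. Goodness passes to the blowup of a
   two-dimensional cone, whose Chow ring is a quadratic extension, and from a
   refinement back to the coarser fan, by a push-forward built from balanced weights.
   Iterated blowups of one fan on T refine any other, so goodness depends only on T.
   For T the tropical linear space of a matroid with element g in a circuit, T is the
   tropical modification of that of the deletion by g along that of the contraction:
   the graph of phi (the maximum over circuits U through g of the minimum over U - g)
   together with the half-lines above the locus where phi bends. Modification does not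
   change the Chow ring, which reduces everything to free matroids, that is, to
   projective spaces. *)
Require Import Defs.
From HB Require Import structures.
From Stdlib Require Import Reals Classical ClassicalChoice.
From Stdlib Require Import FunctionalExtensionality PropExtensionality.
From mathcomp Require Import all_boot all_order all_algebra.
From mathcomp Require Import Rstruct.
From mathcomp Require Import zify ring lra.
Set Implicit Arguments. Unset Strict Implicit. Unset Printing Implicit Defensive.
Import Order.TTheory GRing.Theory Num.Theory.
Local Open Scope ring_scope.

(** * Polynomials and Chow ideals *)

(** The common refinement of two fans is a tower of blowups over only one of them, so blowing down
    never reaches the other. Hence the push-forward along an arbitrary refinement, which makes the
    coarse ring a retract of the fine one. This is also why duality is carried by a Casimir element:
    it moves along ring isomorphisms and along additive maps with a projection formula, over the
    integers and without choosing bases. All stars enter the induction because a blowup brings in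
    the ring of the star of its centre, and the new ray of a modification brings in the ring of the
    contraction. The delicate point of a modification is integrality: multiplying by -phi must turn
    the degree of the deletion into the degree of the contraction with factor exactly 1. The factor
    is forced by one local relation among the rays at a bending cone, on which phi sums to -1. It
    comes from the local matroid there: the indicators of its parallel classes add up to the
    all-ones vector, raising one class leaves phi fixed, and adding the all-ones vector raises phi
    by 1. *)

Fixpoint meval r (A : comNzRingType) : ('I_r -> A) -> {rmorphism mpoly r -> A} :=
  match r return ('I_r -> A) -> {rmorphism mpoly r -> A} with
  | 0 => fun _ => ( *~%R (1 : A) : {rmorphism int -> A})
  | r'.+1 => fun x =>
     let f := meval (fun j => x (lift ord0 j)) in
     (horner_morph (fun a => mulrC (x ord0) (f a)) : {rmorphism {poly mpoly r'} -> A})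
  end.

Lemma mvar0 r : mvar (@ord0 r) = 'X :> {poly mpoly r}.
Proof. by rewrite /= unlift_none. Qed.

Lemma mvarS r (j : 'I_r) : mvar (lift ord0 j) = (mvar j)%:P :> {poly mpoly r}.
Proof. by rewrite /= liftK. Qed.

Lemma meval_var r (A : comNzRingType) (x : 'I_r -> A) i : meval x (mvar i) = x i.
Proof.
elim: r x i => [|r IH] x i; first by case: i.
case: (unliftP ord0 i) => [j|] ->.
  rewrite [mvar _]mvarS; exact: etrans (horner_morphC _ _) (IH _ _).
by rewrite [mvar _]mvar0; exact: horner_morphX.
Qed.

(* mvar i * _ spans the augmentation ideal, so this is induction on monomials. *)
Lemma mpoly_mon_ind r (P : mpoly r -> Prop) :
  (forall p q, P p -> P q -> P (p - q)) -> P 1 ->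
  (forall i p, P p -> P (mvar i * p)) -> forall p, P p.
Proof.
elim: r P => [|r IH] P PB P1 PX p.
  have P0 : P 0 by rewrite -(subrr 1); apply: PB.
  have PN q : P q -> P (- q) by rewrite -(sub0r q); exact: PB.
  have PD q s : P q -> P s -> P (q + s).
    by move=> Pq Ps; rewrite -(opprK s); apply: PB => //; apply: PN.
  have Pn n : P (n%:Z : int).
    elim: n => [|n IH] //; rewrite -addn1 PoszD; exact: PD.
  by case: p => n; [apply: Pn | rewrite NegzE; apply/PN/Pn].
have P0 : P 0 by rewrite -(subrr 1); apply: PB.
have PN q : P q -> P (- q) by rewrite -(sub0r q); exact: PB.
have PD q s : P q -> P s -> P (q + s).
  by move=> Pq Ps; rewrite -(opprK s); apply: PB => //; apply: PN.
have PC c : P (c%:P : {poly mpoly r}).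
  elim/IH: c => [c d Pc Pd||i c Pc].
  - by rewrite polyCB; apply: PB.
  - by rewrite polyC1.
  by rewrite polyCM -mvarS; apply: PX.
elim/poly_ind: p => [|p c Pp]; first exact: P0.
by apply: PD => //; rewrite mulrC -mvar0; apply: PX.
Qed.

Lemma meval_ext r (A : comNzRingType) (f g : {rmorphism mpoly r -> A}) :
  (forall i, f (mvar i) = g (mvar i)) -> forall p, f p = g p.
Proof.
move=> E; elim/mpoly_mon_ind => [p q fp fq||i p fp]; first by rewrite !rmorphB fp fq.
  by rewrite !rmorph1.
by rewrite !rmorphM fp E.
Qed.

Lemma finset_ind (T : finType) (P : {set T} -> Prop) :
  P set0 -> (forall x (A : {set T}), x \notin A -> P A -> P (x |: A)) -> forall A, P A.
Proof.
move=> P0 PU A; have [k] := ubnP #|A|; elim: k A => // k IH A Ak.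
have [->//|[x xA]] := set_0Vmem A.
rewrite -(setD1K xA); apply: PU; first by rewrite !inE eqxx.
by apply: IH; move: Ak; rewrite (cardsD1 x) xA.
Qed.

Section Ideal.
Variables r n : nat.
Implicit Types (D : {set {set 'I_r}}) (u : 'I_r -> 'rV[int]_n) (f : 'I_r -> int).
Implicit Types (p q a : mpoly r) (K s t : {set 'I_r}).

Definition pl f : mpoly r := \sum_i mvar i *~ f i.
Definition xs K : mpoly r := \prod_(i in K) mvar i.

(** Each generator carries an arbitrary coefficient, so closure under products is a lemma and
    membership comes with induction. D may be any set of faces, so that stars and subfans share one
    polynomial ring. *)
Inductive cid D u : mpoly r -> Prop :=
| cid_face a K : K \notin D -> cid D u (a * xs K)
| cid_lin a m : cid D u (a * pl (fun i => pairing m (u i)))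
| cid_add p q : cid D u p -> cid D u q -> cid D u (p + q).

(* The closed star: same vertices and same linear forms as the whole fan;
   its Chow ring is that of the star fan. *)
Definition star D s := [set K | K :|: s \in D].

Definition dclosed D := forall s t, s \in D -> t \subset s -> t \in D.

Lemma cidM D u a p : cid D u p -> cid D u (a * p).
Proof.
elim=> [b K KD|b m|p1 p2 _ I1 _ I2]; last by rewrite mulrDr; apply: cid_add.
  by rewrite mulrA; apply: cid_face.
by rewrite mulrA; apply: cid_lin.
Qed.

Lemma cid0 D u : cid D u 0.
Proof. by rewrite -(mul0r (pl (fun i => pairing 0 (u i)))); apply: cid_lin. Qed.

Lemma cidN D u p : cid D u p -> cid D u (- p).
Proof. by rewrite -mulN1r; apply: cidM. Qed.

Lemma cidB D u p q : cid D u p -> cid D u q -> cid D u (p - q).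
Proof. by move=> Ip Iq; apply/cid_add/cidN. Qed.

Lemma cidMz D u p z : cid D u p -> cid D u (p *~ z).
Proof. by move=> Ip; rewrite -mulrzl; apply: cidM. Qed.

Lemma cid_sum D u (I : Type) (l : seq I) (P : pred I) (F : I -> mpoly r) :
  (forall i, P i -> cid D u (F i)) -> cid D u (\sum_(i <- l | P i) F i).
Proof. by move=> IF; apply: big_ind => //; [apply: cid0 | apply: cid_add]. Qed.

Definition ceq D u p q := cid D u (p - q).

Lemma ceq_refl D u p : ceq D u p p.
Proof. by rewrite /ceq subrr; apply: cid0. Qed.

Lemma ceq_sym D u p q : ceq D u p q -> ceq D u q p.
Proof. by rewrite /ceq => /cidN; rewrite opprB. Qed.

Lemma ceq_trans D u q p a : ceq D u p q -> ceq D u q a -> ceq D u p a.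
Proof. by rewrite /ceq => h1 h2; have := cid_add h1 h2; rewrite addrA subrK. Qed.

Lemma ceqD D u p p' q q' : ceq D u p p' -> ceq D u q q' -> ceq D u (p + q) (p' + q').
Proof. by rewrite /ceq => h1 h2; rewrite opprD addrACA; apply: cid_add. Qed.

Lemma ceqM D u a p q : ceq D u p q -> ceq D u (a * p) (a * q).
Proof. by rewrite /ceq -mulrBr; apply: cidM. Qed.

Lemma ceqMr D u a p q : ceq D u p q -> ceq D u (p * a) (q * a).
Proof. by rewrite ![_ * a]mulrC; apply: ceqM. Qed.

Lemma ceq0 D u p : cid D u p -> ceq D u p 0.
Proof. by rewrite /ceq subr0. Qed.

Lemma ceq_cid D u p q : ceq D u p q -> cid D u q -> cid D u p.
Proof. by move=> h Iq; rewrite -(subrK q p); apply: cid_add. Qed.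

Lemma pl_is_additive f g : pl (fun i => f i - g i) = pl f - pl g.
Proof. by rewrite /pl -sumrB; apply: eq_bigr => i _; rewrite mulrzBr. Qed.

Lemma pl_eq f g : f =1 g -> pl f = pl g.
Proof. by move=> E; apply: eq_bigr => i _; rewrite E. Qed.

Lemma xs0 : xs set0 = 1.
Proof. by rewrite /xs big_set0. Qed.

Lemma xs1 i : xs [set i] = mvar i.
Proof. by rewrite /xs big_set1. Qed.

Lemma xsU1 i K : i \notin K -> xs (i |: K) = mvar i * xs K.
Proof. by move=> iK; rewrite /xs big_setU1. Qed.

Lemma xsU K s : [disjoint K & s] -> xs (K :|: s) = xs K * xs s.
Proof.
move=> dKs; rewrite /xs (big_setID K) /= setUK setDUl setDv set0U.
by have -> : s :\: K = s by apply/setDidPl; rewrite disjoint_sym.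
Qed.

Lemma xsD K s : s \subset K -> xs K = xs s * xs (K :\: s).
Proof. by move=> sK; rewrite {1}/xs (big_setID s) /= (setIidPr sK). Qed.

Lemma cid_notin D u K a : K \notin D -> cid D u (xs K * a).
Proof. by rewrite mulrC; apply: cid_face. Qed.

End Ideal.

Lemma cid_rmorph r n r' n' (D : {set {set 'I_r}}) (u : 'I_r -> 'rV[int]_n)
    (D' : {set {set 'I_r'}}) (u' : 'I_r' -> 'rV[int]_n')
    (h : {rmorphism mpoly r -> mpoly r'}) :
  (forall K, K \notin D -> cid D' u' (h (xs K))) ->
  (forall m, cid D' u' (h (pl (fun i => pairing m (u i))))) ->
  forall p, cid D u p -> cid D' u' (h p).
Proof.
move=> hK hm p; elim=> [a K KD|a m|p1 p2 _ I1 _ I2].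
- by rewrite rmorphM; apply/cidM/hK.
- by rewrite rmorphM; apply/cidM/hm.
by rewrite rmorphD; apply: cid_add.
Qed.

Lemma rmorph_pl r (A : comNzRingType) (h : {rmorphism mpoly r -> A}) f :
  h (pl f) = \sum_i h (mvar i) *~ f i.
Proof. by rewrite rmorph_sum; apply: eq_bigr => i _; rewrite rmorphMz. Qed.

Lemma rmorph_xs r (A : comNzRingType) (h : {rmorphism mpoly r -> A}) K :
  h (xs K) = \prod_(i in K) h (mvar i).
Proof. by rewrite rmorph_prod. Qed.

Section Pairing.
Variable n : nat.
Implicit Types m v w : 'rV[int]_n.

Lemma pairingC m v : pairing m v = pairing v m.
Proof. by apply: eq_bigr => i _; rewrite mulrC. Qed.

Lemma pairingBr m v w : pairing m (v - w) = pairing m v - pairing m w.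
Proof. by rewrite /pairing -sumrB; apply: eq_bigr => i _; rewrite !mxE mulrBr. Qed.

Lemma pairing0r m : pairing m 0 = 0.
Proof. by rewrite -(subrr 0) pairingBr subrr. Qed.

Lemma pairingNr m v : pairing m (- v) = - pairing m v.
Proof. by rewrite -(sub0r v) pairingBr pairing0r sub0r. Qed.

Lemma pairingDr m v w : pairing m (v + w) = pairing m v + pairing m w.
Proof. by rewrite -{1}(opprK w) pairingBr pairingNr opprK. Qed.

Lemma pairing_sumr (I : Type) (l : seq I) (P : pred I) (F : I -> 'rV[int]_n) m :
  pairing m (\sum_(i <- l | P i) F i) = \sum_(i <- l | P i) pairing m (F i).
Proof. exact: (big_morph (pairing m) (pairingDr m) (pairing0r m)). Qed.

Lemma pairingMnr m v k : pairing m (v *+ k) = pairing m v *+ k.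
Proof. by elim: k => [|k IH]; rewrite ?mulr0n ?pairing0r// !mulrS pairingDr IH. Qed.

Lemma pairingMzr m v z : pairing m (v *~ z) = pairing m v *~ z.
Proof. by case: z => k; rewrite ?NegzE ?mulrNz ?pairingNr -pmulrn pairingMnr pmulrn. Qed.

Lemma pairingBl m v w : pairing (m - v) w = pairing m w - pairing v w.
Proof. by rewrite !(pairingC _ w) pairingBr. Qed.

Lemma pairing0l m : pairing 0 m = 0.
Proof. by rewrite pairingC pairing0r. Qed.

Lemma pairingDl m v w : pairing (m + v) w = pairing m w + pairing v w.
Proof. by rewrite !(pairingC _ w) pairingDr. Qed.

Lemma pairingMzl m v z : pairing (m *~ z) v = pairing m v *~ z.
Proof. by rewrite !(pairingC _ v) pairingMzr. Qed.

Lemma pairing_suml (I : Type) (l : seq I) (P : pred I) (F : I -> 'rV[int]_n) m :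
  pairing (\sum_(i <- l | P i) F i) m = \sum_(i <- l | P i) pairing (F i) m.
Proof. by rewrite pairingC pairing_sumr; apply: eq_bigr => i _; rewrite pairingC. Qed.

Lemma pairing_delta i v : pairing (delta_mx 0 i) v = v 0 i.
Proof.
rewrite /pairing (bigD1 i) //= big1 ?addr0 => [|j ji]; rewrite mxE ?eqxx ?mul1r//.
by rewrite (negPf ji) mul0r.
Qed.

End Pairing.

(** The rays of a cone are part of a lattice basis, expressed by their dual functionals, the only
    form in which this is used. *)
Definition unimodular r n (D : {set {set 'I_r}}) (u : 'I_r -> 'rV[int]_n) :=
  forall s k, s \in D -> k \in s ->
    exists m, pairing m (u k) = 1 /\ forall l, l \in s -> l != k -> pairing m (u l) = 0.

(** * Squarefree face monomials span the Chow ring of a star *)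

Section Span.
Variables (r n : nat) (D : {set {set 'I_r}}) (u : 'I_r -> 'rV[int]_n).
Hypotheses (dD : dclosed D) (uD : unimodular D u).
Implicit Types (s t K : {set 'I_r}) (p q : mpoly r) (f : 'I_r -> int).

Lemma unimodular_interp s f : s \in D ->
  exists m, forall i, i \in s -> pairing m (u i) = f i.
Proof.
move=> sD.
have /fin_all_exists [m mP] (k : 'I_r) : exists m, k \in s ->
    pairing m (u k) = 1 /\ forall l, l \in s -> l != k -> pairing m (u l) = 0.
  case: (boolP (k \in s)) => ks; last by exists 0.
  by have [m mP] := uD sD ks; exists m.
exists (\sum_(k in s) m k *~ f k) => i is_.
rewrite pairing_suml (bigD1 i) //= big1 => [|k /andP[ks ki]].
  by rewrite pairingMzl (mP i is_).1 addr0 intz.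
by rewrite pairingMzl (mP k ks).2 ?mul0rz// eq_sym.
Qed.

Lemma cid_sub (D' : {set {set 'I_r}}) p : (forall K, K \in D' -> K \in D) -> cid D u p -> cid D' u p.
Proof.
move=> sDD; elim=> [a K KD|a m|p1 p2 _ I1 _ I2]; [|exact: cid_lin|exact: cid_add].
by apply: cid_face; apply: contra KD; apply: sDD.
Qed.

Lemma cid_star s p : cid D u p -> cid (star D s) u p.
Proof. by apply: cid_sub => K; rewrite inE => KD; apply: dD KD _; apply: subsetUl. Qed.

(** Multiplication by a face is the Gysin map between stars: if L is outside the smaller star,
    [K :|: L] is outside the larger one, and [xs K * xs L] is a multiple of its monomial. *)
Lemma cid_star_xs s K p : cid (star D (K :|: s)) u p -> cid (star D s) u (xs K * p).
Proof.
elim=> [a L LD|a m|p1 p2 _ I1 _ I2].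
- rewrite mulrCA; apply: cidM.
  have KLD : K :|: L \notin star D s by move: LD; rewrite !inE setUA (setUC L).
  have -> : xs K * xs L = xs (L :&: K) * xs (K :|: L) :> mpoly r.
    rewrite (xsD (subsetUl K L)) setDUl setDv set0U (xsD (subsetIl L K)).
    by rewrite setDIr setDv set0U; ring.
  by rewrite mulrC; apply: cid_notin.
- by rewrite mulrA; apply: cid_lin.
by rewrite mulrDr; apply: cid_add.
Qed.

(* Replacing f by f - m, which vanishes on the cone, moves pl f * xs K into
   squarefree position. *)
Lemma ceq_pl_xs s K f m : (forall i, i \in K :|: s -> pairing m (u i) = f i) ->
  ceq (star D s) u (pl f * xs K)
    (\sum_(v | v \notin K :|: s) xs (v |: K) *~ (f v - pairing m (u v))).
Proof.
move=> mf; set g := fun i => f i - pairing m (u i).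
apply: (@ceq_trans _ _ _ _ (pl g * xs K)).
  rewrite /ceq pl_is_additive -mulrBl opprB addrCA subrr addr0 mulrC; exact: cid_lin.
rewrite /pl mulr_suml (bigID (fun v => v \in K :|: s)) /= big1 ?add0r => [|v vKs].
  rewrite (_ : \sum_(v | _) _ = \sum_(v | v \notin K :|: s) xs (v |: K) *~ g v).
    exact: ceq_refl.
  by apply: eq_bigr => v; rewrite inE negb_or => /andP[vK _]; rewrite xsU1// mulrzAl.
by rewrite /g mf// subrr mulr0z mul0r.
Qed.

(** [Q] records the sizes of the faces that occur: [fun=> True] gives generation of the whole ring,
    [fun l => l = k] the part of degree k. *)
Definition span s (Q : nat -> Prop) p := exists c : {set 'I_r} -> int,
  (forall K, c K != 0 -> [/\ [disjoint K & s], K :|: s \in D & Q #|K| ]) /\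
  ceq (star D s) u p (\sum_K xs K *~ c K).

Lemma spanB s Q p q : span s Q p -> span s Q q -> span s Q (p - q).
Proof.
move=> [c [cP cE]] [c' [c'P c'E]]; exists (fun K => c K - c' K); split.
  move=> K cK; case: (eqVneq (c K) 0) => [c0|/cP//]; apply: c'P.
  by move: cK; rewrite c0 sub0r oppr_eq0.
rewrite (eq_bigr (fun K => xs K *~ c K - xs K *~ c' K)) => [|K _]; last by rewrite mulrzBr.
rewrite sumrB /ceq; set A := \sum_K _; set B := \sum_K _.
have -> : p - q - (A - B) = (p - A) - (q - B) by ring.
exact: cidB.
Qed.

Lemma span_ceq s Q p q : ceq (star D s) u p q -> span s Q q -> span s Q p.
Proof. by move=> pq [c [cP cE]]; exists c; split => //; apply: ceq_trans pq cE. Qed.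

Lemma span0 s Q : span s Q 0.
Proof.
exists (fun=> 0); split => [K|]; first by rewrite eqxx.
by rewrite big1//; apply: ceq_refl.
Qed.

Lemma spanD s Q p q : span s Q p -> span s Q q -> span s Q (p + q).
Proof.
move=> sp sq; rewrite -(opprK q); apply: spanB => //.
by rewrite -(sub0r q); apply: spanB => //; apply: span0.
Qed.

Lemma spanMz s Q p z : span s Q p -> span s Q (p *~ z).
Proof.
move=> [c [cP cE]]; exists (fun K => c K * z); split => [K cK|].
  by apply: cP; apply: contraNneq cK => ->; rewrite mul0r.
rewrite (eq_bigr (fun K => xs K *~ c K *~ z)) => [|K _]; last by rewrite mulrzA.
by rewrite -mulrz_suml /ceq -mulrzBl; apply: cidMz.
Qed.

Lemma span_sum s Q (I : Type) (l : seq I) (P : pred I) (F : I -> mpoly r) :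
  (forall i, P i -> span s Q (F i)) -> span s Q (\sum_(i <- l | P i) F i).
Proof. by move=> IF; apply: big_ind => //; [apply: span0 | apply: spanD]. Qed.

Lemma span_xs s (Q : nat -> Prop) K : [disjoint K & s] -> Q #|K| -> span s Q (xs K).
Proof.
move=> dK QK; case: (boolP (K :|: s \in D)) => KD; last first.
  apply: (span_ceq (q := 0)); last exact: span0.
  by apply: ceq0; rewrite -(mulr1 (xs K)); apply: cid_notin; rewrite inE.
exists (fun L => (L == K)%:Z); split => [L|].
  by case: (eqVneq L K) => // ->.
rewrite (bigD1 K)//= eqxx big1 => [|L /negPf ->]; last by rewrite mulr0z.
by rewrite addr0 mulr1z; apply: ceq_refl.
Qed.

(** Multiplying a face by one of its own variables creates a square. A linear form equal to the
    indicator of i on [K :|: s] trades [mvar i] for variables off [K :|: s], so monomials stay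
    squarefree and grow by one. *)
Lemma span_mvar s (Q Q' : nat -> Prop) i p : (forall k, Q k -> Q' k.+1) ->
  span s Q p -> span s Q' (mvar i * p).
Proof.
move=> QQ' [c [cP cE]].
apply: (span_ceq (q := mvar i * \sum_K xs K *~ c K)); first exact: ceqM.
rewrite mulr_sumr; apply: span_sum => K _; rewrite mulrzAr.
case: (eqVneq (c K) 0) => [->|/cP [dK KD QK]]; first by rewrite mulr0z; apply: span0.
apply: spanMz; have [m mP] := unimodular_interp (fun j => (i == j)%:Z) KD.
have -> : mvar i = pl (fun j => (i == j)%:Z).
  rewrite /pl (bigD1 i)//= eqxx big1 ?addr0// => j ji.
  by rewrite eq_sym (negPf ji) mulr0z.
apply: span_ceq (ceq_pl_xs mP) _; apply: span_sum => v; rewrite inE negb_or => /andP[vK vs].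
apply: spanMz; apply: span_xs; last by rewrite cardsU1 vK; apply: QQ'.
by rewrite -setI_eq0 setIUl setU_eq0 !setI_eq0 dK disjoints1 vs.
Qed.

Lemma spanT s p : s \in D -> span s (fun=> True) p.
Proof.
move=> sD; elim/mpoly_mon_ind: p => [p q|| i p]; first exact: spanB.
  by rewrite -(xs0 r); apply: span_xs => //; rewrite disjoints_subset sub0set.
exact: span_mvar.
Qed.

(** Identities between additive maps on the ring of a star are reduced to face monomials. N is a
    predicate closed under subtraction, so the quotient H / N is never formed. *)
Lemma star_functional (H : zmodType) (N : H -> Prop) (F : mpoly r -> H) s :
  s \in D -> N 0 -> (forall x y, N x -> N y -> N (x - y)) ->
  (forall p q, F (p + q) = F p + F q) ->
  (forall p, cid (star D s) u p -> N (F p)) ->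
  (forall K, [disjoint K & s] -> K :|: s \in D -> N (F (xs K))) ->
  forall p, N (F p).
Proof.
move=> sD N0 NB FD Fc Fx p.
have F0 : F 0 = 0 by apply: (addrI (F 0)); rewrite -FD !addr0.
have FN q : F (- q) = - F q by apply: (addrI (F q)); rewrite -FD !subrr F0.
have NN x : N x -> N (- x) by rewrite -(sub0r x); apply: NB.
have ND x y : N x -> N y -> N (x + y).
  by move=> Nx Ny; rewrite -(opprK y); apply: NB => //; apply: NN.
have [c [cP cE]] := spanT p sD.
have -> : F p = F (\sum_K xs K *~ c K) + F (p - \sum_K xs K *~ c K).
  by rewrite -FD addrC subrK.
apply: (ND _ _); last exact: Fc.
rewrite (big_morph F FD F0); apply: big_ind; [exact: N0 | exact: ND |] => K _.
case: (eqVneq (c K) 0) => [->|/cP [dK KD _]]; first by rewrite mulr0z F0.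
have NX := Fx K dK KD.
have NXn k : N (F (xs K *+ k)).
  by elim: k => [|k IH]; rewrite ?mulr0n ?F0// mulrS FD; apply: ND.
by case: (c K) => k; rewrite ?NegzE ?mulrNz ?FN -pmulrn; [|apply: NN]; apply: NXn.
Qed.
End Span.

(** * Presentation of star functionals by balanced weights *)

Section EqMod.
Variables (H : zmodType) (N : H -> Prop).
Hypotheses (N0 : N 0) (NB : forall x y, N x -> N y -> N (x - y)).

Definition eqN x y := N (x - y).

Lemma eqN_refl x : eqN x x.
Proof. by rewrite /eqN subrr. Qed.

Lemma eqN_sym x y : eqN x y -> eqN y x.
Proof. by rewrite /eqN => Nxy; rewrite -opprB -sub0r; apply: NB. Qed.

Lemma eqND x x' y y' : eqN x x' -> eqN y y' -> eqN (x + y) (x' + y').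
Proof.
move=> Nx /eqN_sym Ny; rewrite /eqN opprD addrACA -[y - y']opprB; exact: NB.
Qed.

Lemma eqN_trans y x z : eqN x y -> eqN y z -> eqN x z.
Proof. by move=> h1 h2; have := eqND h1 h2; rewrite /eqN [y + z]addrC opprD addrACA subrr addr0. Qed.

Lemma eqNN x y : eqN x y -> eqN (- x) (- y).
Proof. by move/eqN_sym; rewrite /eqN opprK addrC. Qed.

Lemma eqNMz x y z : eqN x y -> eqN (x *~ z) (y *~ z).
Proof.
move=> xy; have h k : eqN (x *+ k) (y *+ k).
  elim: k => [|k IH]; first exact: eqN_refl.
  by rewrite !mulrS; apply: eqND.
by case: z => k; rewrite ?NegzE ?mulrNz -!pmulrn; [|apply: eqNN]; apply: h.
Qed.

Lemma eqN_sum (I : Type) (l : seq I) (P : pred I) (F G : I -> H) :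
  (forall i, P i -> eqN (F i) (G i)) ->
  eqN (\sum_(i <- l | P i) F i) (\sum_(i <- l | P i) G i).
Proof.
move=> FG; apply: (big_ind2 eqN) => //; first exact: eqN_refl.
by move=> *; apply: eqND.
Qed.
End EqMod.

(* Evaluates a polynomial at operators X that commute only up to an error
   measured by N; the variables are applied in a fixed order. *)
Fixpoint act (H : zmodType) (G : Type) (ev : G -> H) r :
    ('I_r -> G -> G) -> mpoly r -> G -> H :=
  match r return ('I_r -> G -> G) -> mpoly r -> G -> H with
  | 0 => fun _ (p : int) g => ev g *~ p
  | r'.+1 => fun X (p : {poly mpoly r'}) g =>
      \sum_(k < size p) act ev (fun j => X (lift ord0 j)) p`_k (iter k (X ord0) g)
  end.

Section Act.
Variables (H : zmodType) (N : H -> Prop).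
Hypotheses (N0 : N 0) (NB : forall x y, N x -> N y -> N (x - y)).
Variables (G : Type) (ev : G -> H) (R : G -> G -> Prop) (P : G -> Prop).
Hypotheses (Rrefl : forall g, R g g) (Rtrans : forall g h k, R g h -> R h k -> R g k).
Hypothesis evR : forall g h, R g h -> eqN N (ev g) (ev h).

Lemma act_add r X (p q : mpoly r) g : act ev X (p + q) g = act ev X p g + act ev X q g.
Proof.
elim: r X p q g => [|r IH] X p q g; first exact: mulrzDr.
have A0 h k : act ev (fun j => X (lift ord0 j)) 0 (iter k (X ord0) h) = 0.
  by apply: (addrI (act ev (fun j => X (lift ord0 j)) 0 (iter k (X ord0) h))); rewrite -IH !addr0.
(* Padding with zero coefficients lets polynomials of different sizes be summed over one range. *)
have E (s : {poly mpoly r}) m : (size s <= m)%N -> act ev X (s : mpoly r.+1) g =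
    \sum_(k < m) act ev (fun j => X (lift ord0 j)) s`_k (iter k (X ord0) g).
  move=> sm; rewrite /= (big_ord_widen m (fun k => act ev _ s`_k (iter k (X ord0) g)) sm).
  rewrite big_mkcond; apply: eq_bigr => k _.
  by case: ltnP => // sk; rewrite nth_default.
pose m := maxn (size (p : {poly mpoly r})) (size (q : {poly mpoly r})).
rewrite (E p m) ?leq_maxl// (E q m) ?leq_maxr// (E (p + q) m) ?size_polyD//.
by rewrite -big_split; apply: eq_bigr => k _; rewrite coefD IH.
Qed.

Lemma act_R r (X : 'I_r -> G -> G) p g h : (forall i g h, R g h -> R (X i g) (X i h)) ->
  R g h -> eqN N (act ev X p g) (act ev X p h).
Proof.
elim: r X p g h => [|r IH] X p g h XR gh; first by apply: (eqNMz) => //; apply: evR.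
apply: eqN_sum => // k _; apply: IH => [i|]; first exact: XR.
by elim: (k : nat) => //= j; apply: XR.
Qed.

Lemma act1 r (X : 'I_r -> G -> G) g : act ev X 1 g = ev g.
Proof.
elim: r X g => [|r IH] X g; first exact: mulr1z.
by rewrite /= size_poly1 big_ord1 coefC eqxx IH.
Qed.

Lemma act_mvar r (X : 'I_r -> G -> G) i p g :
  (forall i g h, R g h -> R (X i g) (X i h)) -> (forall i g, P g -> P (X i g)) ->
  (forall i j g, P g -> R (X i (X j g)) (X j (X i g))) -> P g ->
  eqN N (act ev X (mvar i * p) g) (act ev X p (X i g)).
Proof.
elim: r X i p g => [|r IH] X i p g XR XP XC Pg; first by case: i.
have A0 h k : act ev (fun j => X (lift ord0 j)) 0 (iter k (X ord0) h) = 0.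
  apply: (addrI (act ev (fun j => X (lift ord0 j)) 0 (iter k (X ord0) h))).
  by rewrite -act_add !addr0.
have E (s : {poly mpoly r}) m h : (size s <= m)%N -> act ev X (s : mpoly r.+1) h =
    \sum_(k < m) act ev (fun j => X (lift ord0 j)) s`_k (iter k (X ord0) h).
  move=> sm; rewrite /= (big_ord_widen m (fun k => act ev _ s`_k (iter k (X ord0) h)) sm).
  rewrite big_mkcond; apply: eq_bigr => k _.
  by case: ltnP => // sk; rewrite nth_default.
have Pk k : P (iter k (X ord0) g) by elim: k => //= k; apply: XP.
case: (unliftP ord0 i) => [j|] -> {i}; last first.
  rewrite mvar0 (E p (size (p : {poly mpoly r})))//.
  rewrite (E _ (size (p : {poly mpoly r})).+1); last first.
    by rewrite (leq_trans (size_polyMleq _ _))// size_polyX.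
  rewrite big_ord_recl coefXM A0 add0r.
  under eq_bigr => k _ do rewrite coefXM lift0 iterSr /=.
  exact: eqN_refl.
rewrite mvarS (E p (size (p : {poly mpoly r})))//.
rewrite (E _ (size (p : {poly mpoly r}))); last first.
  rewrite (leq_trans (size_polyMleq _ _))//.
  by case: (size _) (size_polyC_leq1 (mvar j)) => [|[|]]// _; rewrite leq_pred.
apply: eqN_sum => // k _; rewrite coefCM.
apply: (eqN_trans N0 NB).
  apply: IH => // [i h h'|i h|i i' h]; [exact: XR|exact: XP|exact: XC].
apply: act_R => [i h h'|]; first exact: XR.
elim: (k : nat) => [|l IHl]; first exact: Rrefl.
exact: Rtrans (XC _ _ _ (Pk l)) (XR _ _ _ IHl).
Qed.
End Act.

Section Weights.
Variables (r n : nat) (D : {set {set 'I_r}}) (u : 'I_r -> 'rV[int]_n).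
Hypotheses (dD : dclosed D) (uD : unimodular D u).
Variables (H : zmodType) (N : H -> Prop) (s0 : {set 'I_r}).
Hypotheses (N0 : N 0) (NB : forall x y, N x -> N y -> N (x - y)) (s0D : s0 \in D).
Implicit Types (w : {set 'I_r} -> H) (f : 'I_r -> int) (s t : {set 'I_r}).
Local Notation "x ~~N y" := (eqN N x y) (at level 70).

(* Minkowski weights on the star of s0 with values in H / N. *)
Definition balanced w := (forall s, s \notin D -> w s = 0) /\
  forall t m, t \in D -> s0 \subset t -> (forall i, i \in t -> pairing m (u i) = 0) ->
    N (\sum_(v | v \notin t) w (v |: t) *~ pairing m (u v)).

Definition eqw w w' := forall s, s0 \subset s -> w s ~~N w' s.

(** The variable of k acts on balanced weights like the cap product with the divisor of k, computed
    on each cone after subtracting a linear form that agrees with the divisor there. These operators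
    preserve balancing and commute modulo N, so every polynomial acts on w, and W reads off the
    resulting weight at [s0]. *)
Lemma balanced_hom w : balanced w -> exists W : mpoly r -> H,
  [/\ forall p q, W (p + q) = W p + W q,
      forall p, cid (star D s0) u p -> N (W p)
    & forall K : {set 'I_r}, [disjoint K & s0] -> W (xs K) ~~N w (K :|: s0)].
Proof.
have etr y x z : x ~~N y -> y ~~N z -> x ~~N z by exact: (@eqN_trans _ _ N0 NB y x z).
have erefl x : x ~~N x by exact: (eqN_refl N0).
have esym x y : x ~~N y -> y ~~N x by exact: (eqN_sym N0 NB).
have esum (I : Type) (l : seq I) (P : pred I) (F G : I -> H) :
  (forall i, P i -> F i ~~N G i) ->
  (\sum_(i <- l | P i) F i) ~~N (\sum_(i <- l | P i) G i) by exact: (eqN_sum N0 NB).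
have subsU s v : s0 \subset s -> s0 \subset v |: s.
  by move=> ss; apply: subset_trans ss (subsetUr _ _).
have /fin_all_exists [mu muP] (sk : {set 'I_r} * 'I_r) : exists m,
    sk.1 \in D -> forall i, i \in sk.1 -> pairing m (u i) = (sk.2 == i)%:Z.
  case: sk => s k /=; case: (boolP (s \in D)) => sD; last by exists 0.
  by have [m mP] := unimodular_interp uD (fun i => (k == i)%:Z) sD; exists m.
pose X k w s := if s \in D then
  \sum_(v | v \notin s) w (v |: s) *~ ((k == v)%:Z - pairing (mu (s, k)) (u v)) else 0.
(* Any interpolating form m may replace the chosen one: the two differ by a form vanishing on s,
   which balancing kills. *)
have XE k w' s m : balanced w' -> s0 \subset s ->
    (s \in D -> forall i, i \in s -> pairing m (u i) = (k == i)%:Z) ->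
    X k w' s ~~N \sum_(v | v \notin s) w' (v |: s) *~ ((k == v)%:Z - pairing m (u v)).
  move=> [w0 wB] ss mP; rewrite /X; case: ifP => sD; last first.
    rewrite big1 // => v _; rewrite w0 ?mul0rz//.
    by apply/negP => vsD; rewrite (dD vsD) ?subsetUr in sD.
  rewrite /eqN -sumrB (eq_bigr (fun v => w' (v |: s) *~ pairing (m - mu (s, k)) (u v))).
    by apply: wB => // i is_; rewrite pairingBl mP// (muP (s, k))// subrr.
  by move=> v _; rewrite -mulrzBr pairingBl; congr (_ *~ _); ring.
(* the coefficient of the operator at a facet v |: t of the star of t *)
have XU k w' t g v mv : balanced w' -> s0 \subset t -> t \in D -> v \notin t ->
    (forall i, i \in t -> pairing g (u i) = (k == i)%:Z) ->
    (v |: t \in D -> pairing mv (u v) = 1 /\ forall i, i \in t -> pairing mv (u i) = 0) ->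
    X k w' (v |: t) ~~N \sum_(x | x \notin v |: t) w' (x |: (v |: t)) *~
      (((k == x)%:Z - pairing g (u x)) - ((k == v)%:Z - pairing g (u v)) * pairing mv (u x)).
  move=> wB ss tD vt gP mvP; set Fv := _ - pairing g (u v).
  apply: (etr _ _ _ (XE k w' (v |: t) (g + mv *~ Fv) wB (subsU _ v ss) _)).
    move=> vtD i; have [mv1 mv0] := mvP vtD.
    rewrite !inE pairingDl pairingMzl => /orP[/eqP ->|it].
      by rewrite mv1 intz /Fv addrC subrK.
    by rewrite mv0// mul0rz addr0 gP.
  apply: (esum) => x _; rewrite pairingDl pairingMzl -mulrzl intz opprD addrA; exact: erefl.
have mvE t : t \in D -> exists mv : 'I_r -> 'rV[int]_n, forall v, v \notin t ->
    v |: t \in D -> pairing (mv v) (u v) = 1 /\ forall i, i \in t -> pairing (mv v) (u i) = 0.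
  move=> tD; have /fin_all_exists // (v : 'I_r) : exists m, v \notin t ->
    v |: t \in D -> pairing m (u v) = 1 /\ forall i, i \in t -> pairing m (u i) = 0.
  case: (boolP (v |: t \in D)) => vtD; last by exists 0.
  have [|m [m1 m0]] := uD vtD (_ : v \in v |: t); first by rewrite setU11.
  exists m => vt _; split => // i it; apply: m0; first by rewrite inE it orbT.
  by apply: contraNneq vt => <-.
have gE t k : t \in D -> exists g, forall i, i \in t -> pairing g (u i) = (k == i)%:Z.
  by move=> tD; apply: (unimodular_interp uD (fun i => (k == i)%:Z) tD).
have exch t (F : 'I_r -> 'I_r -> H) :
    \sum_(v | v \notin t) \sum_(x | x \notin v |: t) F v x =
    \sum_(v | v \notin t) \sum_(x | x \notin v |: t) F x v.
  rewrite (exchange_big_dep (fun x => x \notin t)) /=; last first.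
    by move=> v x vt; rewrite !inE negb_or => /andP[].
  apply: eq_bigr => x xt; apply: eq_bigl => v; rewrite !inE !negb_or xt andbT.
  by rewrite eq_sym andbC.
have swapU (x v : 'I_r) t : x |: (v |: t) = v |: (x |: t) by rewrite setUCA.
have shift t m a c w' : balanced w' -> t \in D -> s0 \subset t ->
    (forall i, i \in t -> pairing m (u i) = 0) ->
    \sum_(x | x \notin t) w' (x |: t) *~ a x ~~N
    \sum_(x | x \notin t) w' (x |: t) *~ (a x + pairing m (u x) * c).
  move=> wB tD ts mP; under [X in _ ~~N X]eq_bigr => x _ do rewrite mulrzDr mulrzA.
  rewrite big_split /= -mulrz_suml -[X in X ~~N _]addr0; apply: eqND => //; apply: (esym).
  have [_ wb] := wB; have wb0 : \sum_(x | x \notin t) w' (x |: t) *~ pairing m (u x) ~~N 0.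
    by rewrite /eqN subr0; apply: wb.
  by have := eqNMz N0 NB c wb0; rewrite mul0rz.
have XP k w' : balanced w' -> balanced (X k w').
  move=> wB; split => [s sD|t m tD ss mP]; first by rewrite /X (negPf sD).
  have [mv mvP] := mvE t tD; have [g gP] := gE t k tD.
  pose F x := (k == x)%:Z - pairing g (u x).
  pose M x := pairing m (u x).
  (* The coefficient is antisymmetric in v and x while the face [x |: (v |: t)] is symmetric, so the
     double sum cancels. *)
  suff : \sum_(v | v \notin t) X k w' (v |: t) *~ M v ~~N
      \sum_(v | v \notin t) \sum_(x | x \notin v |: t)
         w' (x |: (v |: t)) *~ (F x * M v - F v * M x).
    under [X in _ ~~N X]eq_bigr => v _ do
      (under eq_bigr => x _ do rewrite mulrzBr); rewrite /eqN.
    under [X in _ - X]eq_bigr => v _ do rewrite sumrB.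
    rewrite sumrB [X in _ - (_ - X)]exch.
    under [X in _ - (_ - X)]eq_bigr => v _ do (under eq_bigr => x _ do rewrite swapU).
    by rewrite subrr subr0.
  apply: (esum) => v vt; have [vtD|vtD] := boolP (v |: t \in D); last first.
    rewrite /X (negPf vtD) mul0rz big1 => [|x _]; first exact: erefl.
    by rewrite wB.1 ?mul0rz//; apply: contra vtD => /dD; apply; apply: subsetUr.
  apply: (etr _ _ _ (eqNMz N0 NB (M v) (XU k w' t g v (mv v) wB ss tD vt gP (mvP v vt)))).
  have [mv1 mv0] := mvP v vt vtD.
  rewrite mulrz_suml; under eq_bigr => x _ do rewrite -mulrzA.
  apply: (etr _ _ _ (shift (v |: t) (m - mv v *~ M v) _ (- F v) w' wB vtD (subsU _ v ss) _)).
    move=> i; rewrite !inE pairingBl pairingMzl => /orP[/eqP ->|it].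
      by rewrite mv1 intz subrr.
    by rewrite mv0// mP// mul0rz subrr.
  apply: (esum) => x _; rewrite pairingBl pairingMzl -mulrzl /F /M.
  set a := _ *~ _; set b := _ *~ _; suff -> : a = b by exact: erefl.
  by congr (_ *~ _); rewrite -mulrzl !intz; ring.
have XC k l w' : balanced w' -> eqw (X k (X l w')) (X l (X k w')).
  move=> wB s ss; have [sD|sD] := boolP (s \in D); last by rewrite /X (negPf sD); exact: erefl.
  have [mv mvP] := mvE s sD; have [f fP] := gE s k sD; have [g gP] := gE s l sD.
  (* Exchanging v and x turns the term [F v * G x] into that of the other composition; the remaining
     term is symmetric in F and G. *)
  have key k' l' (f' g' : 'rV[int]_n) : (forall i, i \in s -> pairing f' (u i) = (k' == i)%:Z) ->
      (forall i, i \in s -> pairing g' (u i) = (l' == i)%:Z) ->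
      let F := fun x => (k' == x)%:Z - pairing f' (u x) in
      let G := fun x => (l' == x)%:Z - pairing g' (u x) in
      X k' (X l' w') s ~~N \sum_(v | v \notin s) \sum_(x | x \notin v |: s)
        w' (x |: (v |: s)) *~ (F v * G x - F v * G v * pairing (mv v) (u x)).
    move=> fP' gP' F' G'; apply: (etr _ _ _ (XE k' _ s f' (XP l' w' wB) ss (fun _ => fP'))).
    apply: (esum) => v vs; have [vsD|vsD] := boolP (v |: s \in D); last first.
      rewrite /X (negPf vsD) mul0rz big1 => [|x _]; first exact: erefl.
      by rewrite wB.1 ?mul0rz//; apply: contra vsD => /dD; apply; apply: subsetUr.
    apply: (etr _ _ _ (eqNMz N0 NB _ (XU l' w' s g' v (mv v) wB ss sD vs gP' (mvP v vs)))).
    rewrite mulrz_suml; apply: (esum) => x _; rewrite -mulrzA.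
    set a := _ *~ _; set b := _ *~ _; suff -> : a = b by exact: erefl.
    by congr (_ *~ _); rewrite /F' /G'; ring.
  apply: (etr _ _ _ (key k l f g fP gP)).
  apply: (etr _ _ _ _ (esym _ _ (key l k g f gP fP))).
  under eq_bigr => v _ do (under eq_bigr => x _ do rewrite mulrzBr).
  under [X in _ ~~N X]eq_bigr => v _ do (under eq_bigr => x _ do rewrite mulrzBr).
  under eq_bigr => v _ do rewrite sumrB.
  under [X in _ ~~N X]eq_bigr => v _ do rewrite sumrB.
  rewrite !sumrB exch; set a := _ - _; set b := _ - _; suff -> : a = b by exact: erefl.
  rewrite /a /b; congr (_ - _); apply: eq_bigr => v _; apply: eq_bigr => x _.
    by rewrite swapU mulrC.
  by rewrite [(_ - pairing f _) * _]mulrC.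
have XR k w1 w2 : eqw w1 w2 -> eqw (X k w1) (X k w2).
  move=> ww s ss; rewrite /X; case: ifP => _; last exact: erefl.
  by apply: (esum) => v _; apply: (eqNMz) => //; apply: ww; apply: subsU.
pose ev w' : H := w' s0.
have evR w1 w2 : eqw w1 w2 -> ev w1 ~~N ev w2 by apply.
have Rrefl w' : eqw w' w' by move=> s _; exact: erefl.
have Rtr w1 w2 w3 : eqw w1 w2 -> eqw w2 w3 -> eqw w1 w3.
  by move=> h1 h2 s ss; apply: etr (h1 s ss) (h2 s ss).
pose W w' p := act ev X p w'.
have WD w' p q : W w' (p + q) = W w' p + W w' q by apply: act_add.
have WX w' i p : balanced w' -> W w' (mvar i * p) ~~N W (X i w') p.
  move=> wB; apply: (act_mvar N0 NB Rrefl Rtr evR (P := balanced)).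
  - exact: XR.
  - exact: XP.
  - exact: XC.
  - exact: wB.
have W1 w' : W w' 1 = w' s0 by apply: act1.
have W0 w' : W w' 0 = 0 by apply: (addrI (W w' 0)); rewrite -WD !addr0.
have WN w' p : W w' (- p) = - W w' p by apply: (addrI (W w' p)); rewrite -WD !subrr W0.
have WMz w' p z : W w' (p *~ z) = W w' p *~ z.
  have h k : W w' (p *+ k) = W w' p *+ k by elim: k => [|k IH]; rewrite ?W0// !mulrS WD IH.
  by case: z => k; rewrite ?NegzE ?mulrNz ?WN -!pmulrn h.
have Wideal p : (forall w', balanced w' -> N (W w' p)) ->
    forall a w', balanced w' -> N (W w' (a * p)).
  move=> Np; elim/mpoly_mon_ind => [a b IHa IHb||i a IH] w' wB.
  - by rewrite mulrBl WD WN; apply: NB; [apply: IHa | apply: IHb].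
  - by rewrite mul1r; apply: Np.
  have := eqN_trans N0 NB (WX _ i (a * p) wB) (_ : eqN N _ 0); rewrite mulrA /eqN !subr0.
  by apply; apply: IH; apply: XP.
have Wxs (K : {set 'I_r}) w' : balanced w' -> [disjoint K & s0] -> W w' (xs K) ~~N w' (K :|: s0).
  elim/finset_ind: K w' => [|v K vK IH] w' wB.
    by rewrite xs0 W1 set0U => _; exact: erefl.
  rewrite -setI_eq0 setIUl setU_eq0 !setI_eq0 disjoints1 => /andP[vs dK].
  rewrite xsU1//; apply: (etr _ _ _ (WX _ _ _ wB)); apply: (etr _ _ _ (IH _ (XP v w' wB) dK)).
  (* Since v lies off [K :|: s0], the zero form already interpolates its divisor there, and only the
     facet through v survives. *)
  apply: (etr _ _ _ (XE v w' (K :|: s0) 0 wB (subsetUr _ _) _)).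
    move=> _ i iKs; rewrite pairing0l; case: eqP => // vi; move: iKs.
    by rewrite -vi inE (negPf vK) (negPf vs).
  rewrite (bigD1 v) ?inE ?negb_or ?vK ?vs//= eqxx pairing0l subr0 mulr1z setUA big1 ?addr0.
    exact: erefl.
  by move=> x /andP[_ xv]; rewrite eq_sym (negPf xv) pairing0l subr0 mulr0z.
move=> wB; exists (W w); split=> [p q|p|K dK]; [exact: WD | | exact: Wxs].
elim=> [a K KD|a m|p1 p2 _ I1 _ I2]; last by rewrite WD -(opprK (W w p2)); apply: NB => //;
  rewrite -sub0r; apply: NB.
  rewrite (xsD (subsetDl K s0)) mulrCA mulrC; apply: Wideal => // w' w'B.
  have dK : [disjoint K :\: s0 & s0] by rewrite -setI_eq0 setDE -setIA [~: _ :&: _]setIC setICr setI0.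
  have E : K :\: s0 :|: s0 = K :|: s0.
    by apply/setP => i; rewrite !inE; case: (i \in s0); rewrite ?orbT.
  move: KD; rewrite inE => KD; have [w0 _] := w'B.
  by have := Wxs _ _ w'B dK; rewrite E w0// /eqN subr0.
apply: Wideal => // w' w'B; rewrite /pl (big_morph (W w') (WD w') (W0 w')).
have WXs i : W w' (mvar i *~ pairing m (u i)) ~~N X i w' s0 *~ pairing m (u i).
  by rewrite WMz; apply: (eqNMz) => //; have := WX w' i 1 w'B; rewrite mulr1 W1.
have /(etr _ _ _ (esum _ _ _ _ _ (fun i _ => WXs i))) : 
    \sum_i X i w' s0 *~ pairing m (u i) ~~N 0; last by rewrite /eqN subr0.
rewrite /eqN subr0 /X s0D; under eq_bigr => i _ do rewrite mulrz_suml.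
rewrite exchange_big /=.
(* Collected by rays, the value of the linear form is the balancing sum at [s0] for m minus its
   interpolation on [s0]. *)
have /(w'B.2 s0 _ s0D (subxx _)) : forall k, k \in s0 ->
    pairing (m - \sum_i mu (s0, i) *~ pairing m (u i)) (u k) = 0.
  move=> k ks; rewrite pairingBl pairing_suml (bigD1 k)//= big1 => [|i ik].
    by rewrite pairingMzl (muP (s0, k))// eqxx addr0 intz subrr.
  by rewrite pairingMzl (muP (s0, i))//= (negPf ik) mul0rz.
congr (N _); apply: eq_bigr => v _; rewrite pairingBl pairing_suml.
under [RHS]eq_bigr => i _ do rewrite -mulrzA.
rewrite -mulrz_sumr; congr (_ *~ _).
under [RHS]eq_bigr => i _ do rewrite mulrBl.
rewrite sumrB; congr (_ - _); last first.
  by apply: eq_bigr => i _; rewrite pairingMzl -mulrzl mulrC intz.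
rewrite (bigD1 v)//= eqxx mul1r big1 ?addr0// => i iv.
by rewrite (negPf iv) mul0r.
Qed.
End Weights.

(** * Smooth fans on a set of lattice points *)

Section Combinations.
Variables (r n : nat) (u : 'I_r -> 'rV[int]_n).
Implicit Types (c : 'I_r -> nat) (z : 'I_r -> int).

Definition supp c : {set 'I_r} := [set i | c i != 0%N].
Definition comb c := \sum_i u i *+ c i.
Definition combz z := \sum_i u i *~ z i.

Lemma combzD z z' : combz (fun i => z i + z' i) = combz z + combz z'.
Proof. by rewrite /combz -big_split; apply: eq_bigr => i _; rewrite mulrzDr. Qed.

Lemma combzN z : combz (fun i => - z i) = - combz z.
Proof. by rewrite /combz -sumrN; apply: eq_bigr => i _; rewrite mulrNz. Qed.

Lemma combzM z k : combz (fun i => z i * k) = combz z *~ k.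
Proof. by rewrite /combz mulrz_suml; apply: eq_bigr => i _; rewrite mulrzA. Qed.

Lemma combz_eq z z' : z =1 z' -> combz z = combz z'.
Proof. by move=> E; apply: eq_bigr => i _; rewrite E. Qed.

Lemma combzE c : comb c = combz (fun i => (c i)%:Z).
Proof. by apply: eq_bigr => i _; rewrite pmulrn. Qed.

Lemma combz_delta j : combz (fun i => (i == j)%:Z) = u j.
Proof.
rewrite /combz (bigD1 j)//= eqxx big1 ?addr0// => i /negPf ->.
by rewrite mulr0z.
Qed.

Lemma pairing_combz m z : pairing m (combz z) = \sum_i pairing m (u i) * z i.
Proof.
rewrite pairing_sumr; apply: eq_bigr => i _.
by rewrite pairingMzr -mulrzl intz mulrC.
Qed.

Lemma combz_abs z : (forall i, 0 <= z i) -> combz z = comb (fun i => `|z i|%N).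
Proof. by move=> z0; rewrite combzE; apply: combz_eq => i; rewrite gez0_abs. Qed.

End Combinations.

(* A smooth fan, described through its lattice points: T is the set of lattice
   points of the support, and every point of T is a unique combination with
   natural coefficients of the rays of a cone. A vertex v with [set v] \notin D is
   a ghost. *)
Record fan n (T : 'rV[int]_n -> Prop) r (D : {set {set 'I_r}}) (u : 'I_r -> 'rV[int]_n)
  : Prop := Fan {
  fan_dc : dclosed D;
  fan_uni : unimodular D u;
  fan_in : forall c, supp c \in D -> T (comb u c);
  fan_ex : forall x, T x -> exists2 c, supp c \in D & comb u c = x;
  fan_inj : forall c c', supp c \in D -> supp c' \in D -> comb u c = comb u c' -> c =1 c'
}.

Section FanLocal.
Variables (n : nat) (T : 'rV[int]_n -> Prop) (r : nat) (D : {set {set 'I_r}}).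
Variable (u : 'I_r -> 'rV[int]_n).
Hypothesis F : fan T D u.
Implicit Types (c : 'I_r -> nat) (z : 'I_r -> int) (s t : {set 'I_r}).

Definition bary t := combz u (fun i => (i \in t)%:Z).
(** Coordinates of the star of t as a fan with lineality: entries on t may be negative, since a
    large multiple of [bary t] moves the point into an actual cone ([local_comb]). *)
Definition local t z := (forall i, i \notin t -> 0 <= z i) /\ [set i | z i != 0] :|: t \in D.

Lemma local_comb t z : local t z -> forall N : nat, (forall i, - z i <= N%:Z) ->
  exists c, [/\ supp c \in D, (forall i, (c i)%:Z = z i + N%:Z * (i \in t)%:Z) &
     combz u z + bary t *~ N%:Z = comb u c].
Proof.
move=> [z0 zD] N zN.
have p0 i : 0 <= z i + N%:Z * (i \in t)%:Z.
  case: (boolP (i \in t)) => [_|/z0]; last by rewrite mulr0 addr0.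
  by rewrite mulr1 -lerBlDl sub0r.
exists (fun i => absz (z i + N%:Z * (i \in t)%:Z)); split.
- apply: (fan_dc F zD); apply/subsetP => i; rewrite !inE absz_eq0.
  by case: (i \in t); rewrite ?orbT// mulr0 addr0 orbF.
- by move=> i; rewrite gez0_abs.
rewrite -combz_abs// combzD; congr (_ + _).
by rewrite /bary -combzM; apply: combz_eq => i; rewrite mulrC.
Qed.

Lemma bound_exists z : exists N : nat, forall i, - z i <= N%:Z.
Proof.
exists (\sum_i `|z i|)%N => i; rewrite (bigD1 i)//=.
have : - z i <= (`|z i|%N : int) by rewrite abszE -normrN ler_norm.
move=> h; apply: le_trans h _; lia.
Qed.

Lemma fan_local_inj t z z' : local t z -> local t z' -> combz u z = combz u z' -> z =1 z'.
Proof.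
move=> lz lz' E i; have [N zN] := bound_exists z; have [N' zN'] := bound_exists z'.
have [|c [cD cE cz]] := local_comb lz (N := N + N').
  by move=> j; apply: le_trans (zN j) _; lia.
have [|c' [cD' cE' cz']] := local_comb lz' (N := N + N').
  by move=> j; apply: le_trans (zN' j) _; lia.
have /(_ i) cc : c =1 c' by apply: (fan_inj F) => //; rewrite -cz -cz' E.
by have := cE i; rewrite cc cE' => /addIr.
Qed.

Lemma pigeonhole (A : finType) (f : nat -> A) : exists a, forall M, exists2 N, (M <= N)%N & f N = a.
Proof.
apply: NNPP => H.
have {}H a : exists M, forall N, (M <= N)%N -> f N <> a.
  apply: NNPP => Ha; apply: H; exists a => M; apply: NNPP => HM; apply: Ha.
  by exists M => N MN fa; apply: HM; exists N.
have /fin_all_exists [M MP] a := H a.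
pose S := (\sum_a M a)%N; have MS a : (M a <= S)%N by rewrite /S (bigD1 a)//= leq_addr.
exact: (MP _ S (MS _) erefl).
Qed.

(* The cones around t cover a direction y as soon as y + N * bary t stays in T. *)
Lemma fan_local_ex t y N0 : t \in D -> (forall N, (N0 <= N)%N -> T (y + bary t *~ N%:Z)) ->
  exists2 z, local t z & combz u z = y.
Proof.
move=> tD Ty.
have cE (N : nat) : exists c, (N0 <= N)%N -> supp c \in D /\ comb u c = y + bary t *~ N%:Z.
  case: (leqP N0 N) => [N0N|_]; last by exists (fun=> 0%N).
  by have [c cD cE] := fan_ex F (Ty N N0N); exists c.
have [c cP] : exists c : nat -> 'I_r -> nat, forall N, (N0 <= N)%N ->
    supp (c N) \in D /\ comb u (c N) = y + bary t *~ N%:Z.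
  exact: ClassicalChoice.choice cE.
have [s sP] := pigeonhole (fun N => supp (c N)).
have [N1 N01 sN1] := sP N0.
have [sD1 cN1] := cP N1 N01; rewrite sN1 in sD1.
have /fin_all_exists [m mP] (v : 'I_r) : exists m, v \in s ->
    forall l, l \in s -> pairing m (u l) = (v == l)%:Z.
  have [m mP] := unimodular_interp (fan_uni F) (fun l => (v == l)%:Z) sD1.
  by exists m.
have mc v N : (N0 <= N)%N -> supp (c N) = s -> v \in s ->
    pairing (m v) y + pairing (m v) (bary t) * N%:Z = (c N v)%:Z.
  move=> N0N sN vs; have [_ E] := cP N N0N.
  have := congr1 (pairing (m v)) E; rewrite pairingDr pairingMzr -[_ *~ N%:Z]mulrzr intz => <-.
  rewrite combzE pairing_combz (bigD1 v)//= mP// eqxx mul1r.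
  rewrite big1 ?addr0// => l lv; case: (boolP (l \in s)) => [ls|];
    first by rewrite mP// eq_sym (negPf lv) mul0r.
  by rewrite -sN inE negbK => /eqP ->; rewrite mulr0.
(* A coordinate that is affine in N and nonnegative for unbounded N has nonnegative slope. *)
have mb v : v \in s -> 0 <= pairing (m v) (bary t).
  move=> vs; rewrite leNgt; apply/negP => b0.
  have [N NN sN] := sP (N0 + (absz (pairing (m v) y)).+1)%N.
  have N0N : (N0 <= N)%N by lia.
  have := mc v N N0N sN vs; nia.
have [N2 N12 sN2] := sP N1.+1.
have N02 : (N0 <= N2)%N by lia.
have [_ cN2] := cP N2 N02.
have cc v : (c N1 v <= c N2 v)%N.
  case: (boolP (v \in s)) => vs.
    by have := mc v N1 N01 sN1 vs; have := mc v N2 N02 sN2 vs; have := mb v vs; nia.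
  by move: (vs); rewrite -sN1 inE negbK => /eqP ->.
(* Two of these points differ by a positive multiple of [bary t], and their coordinates on s
   increase, so uniqueness of coordinates puts t inside s. *)
have ts : t \subset s.
  have E : (fun i => (c N2 i - c N1 i)%N) =1 (fun i => (N2 - N1) * (i \in t))%N.
    apply: (fan_inj F).
    - apply: (fan_dc F sD1); apply/subsetP => i; rewrite -sN2 !inE; lia.
    - apply: (fan_dc F tD); apply/subsetP => i; rewrite !inE; case: (i \in t) => //; lia.
    rewrite !combzE (combz_eq _ (z' := fun i => (c N2 i)%:Z + - (c N1 i)%:Z)); last first.
      by move=> i; have := cc i; lia.
    rewrite combzD combzN -!combzE cN1 cN2.
    rewrite [RHS]combzE [RHS](combz_eq _ (z' := fun i => (i \in t)%:Z * (N2 - N1)%N%:Z)); last by move=> i; lia.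
    rewrite combzM -/(bary t) opprD addrACA subrr add0r -mulrzBr; congr (_ *~ _); lia.
  apply/subsetP => i it; have := E i; rewrite it -sN2 inE; lia.
exists (fun i => (c N1 i)%:Z - N1%:Z * (i \in t)%:Z); last first.
  rewrite combzD combzN -combzE cN1 (combz_eq _ (z' := fun i => (i \in t)%:Z * N1%:Z)).
    by rewrite combzM addrK.
  by move=> i; rewrite mulrC.
split=> [i it|]; first by rewrite (negPf it) mulr0 subr0.
apply: (fan_dc F sD1); apply/subsetP => i; rewrite inE => /orP[|/(subsetP ts)//].
rewrite inE => h; case: (boolP (i \in t)) => [/(subsetP ts)//|it].
by move: h; rewrite (negPf it) mulr0 subr0 -sN1 inE; lia.
Qed.

End FanLocal.

(* The functional F has a Casimir element: every p is recovered from the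
   values F (p * a) on finitely many a. Together with graded components, this is
   the perfectness of the pairing F (p * q) over int, written with dual bases. *)
Definition dualizing r n (D : {set {set 'I_r}}) (u : 'I_r -> 'rV[int]_n) (F : mpoly r -> int) :=
  exists ks : seq (mpoly r * mpoly r),
    forall p, ceq D u p (\sum_(ab <- ks) ab.2 *~ F (p * ab.1)).

Definition is_degree r n (D : {set {set 'I_r}}) (u : 'I_r -> 'rV[int]_n) d (deg : mpoly r -> int) :=
  [/\ forall p q, deg (p + q) = deg p + deg q,
      forall p, cid D u p -> deg p = 0
    & forall s, s \in D -> deg (xs s) = (#|s| == d)%:Z].

Definition has_dim r (D : {set {set 'I_r}}) d :=
  (forall s, s \in D -> (#|s| <= d)%N) /\ (forall s, s \in D -> exists2 t, t \in D & #|t| = d).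

(* Poincare duality, hereditarily for all star fans. *)
Definition HPD r n (D : {set {set 'I_r}}) (u : 'I_r -> 'rV[int]_n) d :=
  has_dim D d /\ exists2 deg, is_degree D u d deg &
    forall s, s \in D -> dualizing (star D s) u (fun p => deg (xs s * p)).

Section Additive.
Variables (r : nat) (H : zmodType) (F : mpoly r -> H).
Hypothesis FD : forall p q, F (p + q) = F p + F q.

Lemma additive0 : F 0 = 0.
Proof. by apply: (addrI (F 0)); rewrite -FD !addr0. Qed.

Lemma additiveN p : F (- p) = - F p.
Proof. by apply: (addrI (F p)); rewrite -FD !subrr additive0. Qed.

Lemma additiveB p q : F (p - q) = F p - F q.
Proof. by rewrite FD additiveN. Qed.

Lemma additiveMz p z : F (p *~ z) = F p *~ z.
Proof.
have h k : F (p *+ k) = F p *+ k by elim: k => [|k IH]; rewrite ?additive0// !mulrS FD IH.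
by case: z => k; rewrite ?NegzE ?mulrNz ?additiveN -!pmulrn h.
Qed.

Lemma additive_sum (I : Type) (l : seq I) (P : pred I) (G : I -> mpoly r) :
  F (\sum_(i <- l | P i) G i) = \sum_(i <- l | P i) F (G i).
Proof. exact: (big_morph F FD additive0). Qed.
End Additive.

Lemma star0 r (D : {set {set 'I_r}}) : star D set0 = D.
Proof. by apply/setP => s; rewrite inE setU0. Qed.

Lemma cid_star_deg r n (D : {set {set 'I_r}}) (u : 'I_r -> 'rV[int]_n) d deg s p :
  dclosed D -> is_degree D u d deg -> cid (star D s) u p -> deg (xs s * p) = 0.
Proof.
move=> dD [_ dK _] Ip; apply: dK; rewrite -[D]star0; apply: cid_star_xs => //.
by rewrite setU0.
Qed.

Lemma dualizing_transfer r n r' n' (D : {set {set 'I_r}}) (u : 'I_r -> 'rV[int]_n)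
    (D' : {set {set 'I_r'}}) (u' : 'I_r' -> 'rV[int]_n') F F'
    (th : {rmorphism mpoly r' -> mpoly r}) (io : {rmorphism mpoly r -> mpoly r'}) :
  (forall p, cid D u p -> cid D' u' (io p)) ->
  (forall p, ceq D' u' p (io (th p))) -> (forall p, th (io p) = p) ->
  (forall p, F' p = F (th p)) -> dualizing D u F -> dualizing D' u' F'.
Proof.
move=> ioP E thio FF [ks kP]; exists [seq (io ab.1, io ab.2) | ab <- ks] => p.
apply: ceq_trans (E p) _; rewrite big_map /=.
have := ioP _ (kP (th p)); rewrite rmorphB rmorph_sum /ceq; congr (cid _ _ (_ - _)).
by apply: eq_bigr => ab _; rewrite rmorphMz FF rmorphM thio.
Qed.

(** * Descent along refinements *)

Section Refinement.
Variables (n : nat) (T : 'rV[int]_n -> Prop).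
Variables (r : nat) (D : {set {set 'I_r}}) (u : 'I_r -> 'rV[int]_n).
Variables (r' : nat) (D' : {set {set 'I_r'}}) (u' : 'I_r' -> 'rV[int]_n).
Hypotheses (F : fan T D u) (F' : fan T D' u').
(* c v: coordinates of the ray v of the finer fan in the cone of the coarser
   fan that carries it; zero for ghosts. *)
Variable c : 'I_r' -> 'I_r -> nat.
Hypothesis cE : forall v, [set v] \in D' -> u' v = comb u (c v).

(** The smallest coarse cone containing the cone of t. Cones with [#|carrier t| = #|t|] are
    full-dimensional in it, and only these survive the push-forward. *)
Definition carrier (t : {set 'I_r'}) : {set 'I_r} := \bigcup_(v in t) supp (c v).
Hypothesis carrier_in : forall t, t \in D' -> carrier t \in D.

Implicit Types (t : {set 'I_r'}) (s : {set 'I_r}).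

Definition push (z : 'I_r' -> int) (i : 'I_r) : int := \sum_v (c v i)%:Z * z v.

Lemma carrierP t i : reflect (exists2 v, v \in t & c v i != 0%N) (i \in carrier t).
Proof.
apply: (iffP bigcupP) => [[v vt]|[v vt cv]]; first by rewrite inE; exists v.
by exists v => //; rewrite inE.
Qed.

Lemma carrierS t t' : t \subset t' -> carrier t \subset carrier t'.
Proof. by move=> tt; apply/subsetP => i /carrierP [v vt cv]; apply/carrierP; exists v => //;
  apply: (subsetP tt). Qed.

Lemma c_out t v i : v \in t -> i \notin carrier t -> c v i = 0%N.
Proof. by move=> vt; apply: contraNeq => cv; apply/carrierP; exists v. Qed.

Lemma set1_in t v : t \in D' -> v \in t -> [set v] \in D'.
Proof. by move=> tD vt; apply: (fan_dc F' tD); rewrite sub1set. Qed.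

Lemma u'E m t v : t \in D' -> v \in t ->
  pairing m (u' v) = \sum_i (c v i)%:Z * pairing m (u i).
Proof.
move=> tD vt; rewrite cE; last exact: set1_in tD vt.
by rewrite combzE pairing_combz; apply: eq_bigr => i _; rewrite mulrC.
Qed.

Lemma push_comb t z : t \in D' -> (forall v, v \notin t -> z v = 0) ->
  combz u' z = combz u (push z).
Proof.
move=> tD z0; rewrite /combz /push; under [RHS]eq_bigr => i _ do rewrite mulrz_sumr.
rewrite exchange_big; apply: eq_bigr => v _; case: (boolP (v \in t)) => vt.
  rewrite cE; last exact: set1_in tD vt.
  by rewrite combzE /combz mulrz_suml; apply: eq_bigr => i _; rewrite -mulrzA.
by rewrite z0// mulr0z big1// => i _; rewrite mulr0 mulr0z.
Qed.

Lemma push_local t z : t \in D' -> local D' t z -> local D (carrier t) (push z).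
Proof.
move=> tD [z0 zD]; have sub : [set i | push z i != 0] \subset carrier ([set v | z v != 0] :|: t).
  apply/subsetP => i; rewrite inE; apply: contraNT => ni.
  rewrite /push big1// => v _; case: (eqVneq (z v) 0) => [->|zv]; first by rewrite mulr0.
  by rewrite (c_out _ ni) ?mul0r// inE inE zv.
split=> [i it|].
  apply: sumr_ge0 => v _; case: (boolP (v \in t)) => vt; first by rewrite (c_out vt it) mul0r.
  by rewrite mulr_ge0// z0.
apply: (fan_dc F (carrier_in zD)); rewrite subUset sub; exact: carrierS (subsetUr _ _).
Qed.

(** The matrix of coordinates of the rays of t has a one-sided inverse, made of the dual functionals
    of t. *)
Lemma card_carrier t : t \in D' -> (#|t| <= #|carrier t|)%N.
Proof.
move=> tD.
have /fin_all_exists [m mP] (v : 'I_r') : exists m, v \in t ->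
    forall l, l \in t -> pairing m (u' l) = (v == l)%:Z.
  by have [m mP] := unimodular_interp (fan_uni F') (fun l => (v == l)%:Z) tD; exists m.
pose A : 'M[int]_(#|t|, #|carrier t|) := \matrix_(a, b) (c (enum_val a) (enum_val b))%:Z.
pose B : 'M[int]_(#|carrier t|, #|t|) := \matrix_(b, a) pairing (m (enum_val a)) (u (enum_val b)).
apply: (mulmx1_min (A := A) (B := B)); apply/matrixP => a a'; rewrite !mxE.
rewrite (eq_bigr (fun b => (c (enum_val a) (enum_val b))%:Z * pairing (m (enum_val a')) (u (enum_val
  b)))); last first.
  by move=> b _; rewrite !mxE.
rewrite -(big_enum_val (fun j => (c (enum_val a) j)%:Z * pairing (m (enum_val a')) (u j))) /=.
transitivity (pairing (m (enum_val a')) (u' (enum_val a))).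
  rewrite (u'E _ tD) ?enum_valP// [RHS](bigID (fun j => j \in carrier t))/= [X in _ + X]big1 ?addr0// => i it.
  by rewrite (c_out _ it) ?enum_valP ?mul0r.
by rewrite mP ?enum_valP// (inj_eq enum_val_inj) eq_sym; case: eqP.
Qed.

Lemma bary_carrier t N : t \in D' -> bary u' t *~ N%:Z = comb u (fun i => (\sum_(v in t) c v i) * N)%N.
Proof.
move=> tD; rewrite /bary (push_comb (t := t)) => [|//|v /negPf ->//].
rewrite -combzM combzE; apply: combz_eq => i; rewrite /push PoszM; congr (_ * _).
rewrite (big_morph Posz PoszD (erefl 0%:Z)) [RHS]big_mkcond; apply: eq_bigr => v _.
by case: (v \in t); rewrite ?mulr1 ?mulr0.
Qed.

(* A direction y that stays in the carrier cone of t is covered by a cone t' of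
   the finer fan with the same bound on its carrier. *)
Lemma cover t (s : {set 'I_r}) (z : 'I_r -> int) :
  t \in D' -> s \in D -> carrier t \subset s ->
  (forall i, i \notin s -> z i = 0) -> (forall i, i \notin carrier t -> 0 <= z i) ->
  exists z', [/\ local D' t z', combz u' z' = combz u z,
     push z' =1 z & carrier ([set v | z' v != 0] :|: t) \subset s].
Proof.
move=> tD sD ts zs z0; have [N0 zN0] := bound_exists z.
have [z' lz' E] : exists2 z', local D' t z' & combz u' z' = combz u z.
  apply: (fan_local_ex F' (N0 := N0.+1)) => // N N0N; rewrite (bary_carrier _ tD).
  have cN i : 0 <= z i + ((\sum_(v in t) c v i) * N)%N%:Z.
    have [it|/z0 h] := boolP (i \in carrier t); last by rewrite addr_ge0.
    have [v vt cv] := carrierP _ _ it; have := zN0 i; rewrite (bigD1 v)//=.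
    set k := (_ * N)%N; suff : (N <= k)%N by lia.
    by rewrite leq_pmull// ltn_addr// lt0n.
  rewrite combzE -combzD combz_abs//; apply: (fan_in F); apply: (fan_dc F sD).
  apply/subsetP => i; rewrite inE; apply: contraNT => is_.
  rewrite zs// big1 ?mul0n// => v vt; apply: (c_out vt).
  by apply: contra is_; apply: (subsetP ts).
have pz : push z' =1 z.
  apply: (fan_local_inj F (t := carrier t)); first exact: push_local.
    split=> //; apply: (fan_dc F sD); rewrite subUset ts andbT; apply/subsetP => i.
    by rewrite inE; apply: contraNT => /zs ->.
  rewrite -E; case: lz' => z'0 z'D; rewrite (push_comb z'D)// => v.
  by rewrite !inE negb_or negbK => /andP[/eqP].
exists z'; split=> //; apply/subsetP => i /carrierP [v]; rewrite !inE => vt cv.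
apply: contraT => is_; have : push z' i = 0 by rewrite pz zs.
have it : i \notin carrier t by apply: contra is_; apply: (subsetP ts).
have vt' : v \notin t by apply: contra cv => vt'; rewrite (c_out vt' it).
rewrite (negPf vt') orbF in vt; case: lz' => z'0 _.
have := z'0 v vt'; rewrite le_eqVlt eq_sym (negPf vt) /= => zv.
rewrite /push (bigD1 v)//= => S0; rewrite -(ltxx (0 : int)) -[X in _ < X]S0.
apply: ltr_wpDr; last by rewrite pmulr_lgt0// ltz_nat lt0n.
apply: sumr_ge0 => x _; have [xt|xt] := boolP (x \in t); first by rewrite (c_out xt it) mul0r.
by rewrite mulr_ge0// z'0.
Qed.

(** By dimension, a cone through t inside its carrier has no further ray. So t generates the whole
    lattice spanned by the carrier and not just a sublattice of finite index. *)
Lemma span_carrier t z : t \in D' -> #|carrier t| = #|t| ->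
  (forall i, i \notin carrier t -> z i = 0) ->
  exists2 z' : 'I_r' -> int, (forall v, v \notin t -> z' v = 0) & combz u' z' = combz u z.
Proof.
move=> tD ct z0.
have [i|z' [lz E _ cs]] := cover tD (carrier_in tD) (subxx _) z0; first by move/z0 ->.
exists z' => // v vt; case: lz => _ lD.
have := leq_trans (card_carrier lD) (subset_leq_card cs); rewrite ct => h.
apply: contraTeq h => zv; rewrite -ltnNge; apply: proper_card; apply/properP; split.
  exact: subsetUr.
by exists v => //; rewrite !inE zv.
Qed.

Lemma span_carrier1 t j : t \in D' -> #|carrier t| = #|t| -> j \in carrier t ->
  exists2 z : 'I_r' -> int, (forall v, v \notin t -> z v = 0) & combz u' z = u j.
Proof.
move=> tD ct jt; rewrite -combz_delta; apply: span_carrier => // i.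
by case: eqP => // ->; rewrite jt.
Qed.

Lemma local_delta t v : v |: t \in D' -> local D' t (fun i => (i == v)%:Z).
Proof.
move=> vD; split=> [i _|]; first by case: eqP.
congr (_ \in D'): vD; apply/setP => i; rewrite !inE; by case: eqP.
Qed.

Lemma local_shift t z z' : t \in D' -> local D' t z -> (forall v, v \notin t -> z' v = 0) ->
  local D' t (fun i => z i + z' i).
Proof.
move=> tD [z0 zD] z'0; split=> [i it|]; first by rewrite z'0// addr0 z0.
apply: (fan_dc F' zD); apply/subsetP => i; rewrite !inE.
by case: (boolP (i \in t)); rewrite ?orbT// !orbF => /z'0 ->; rewrite addr0.
Qed.

Lemma vanish_carrier t m : t \in D' -> #|carrier t| = #|t| ->
  (forall v, v \in t -> pairing m (u' v) = 0) -> forall j, j \in carrier t -> pairing m (u j) = 0.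
Proof.
move=> tD ct mt j jt; have [z z0 <-] := span_carrier1 tD ct jt.
rewrite pairing_combz big1// => v _; have [vt|/z0 ->] := boolP (v \in t); last by rewrite mulr0.
by rewrite mt ?mul0r.
Qed.

(* Codimension-one faces of the carrier: one cone of the finer fan on each side. *)
Lemma facet_exists t j : t \in D' -> #|carrier t| = #|t| -> j \notin carrier t ->
  j |: carrier t \in D -> exists v, [/\ v \notin t, v |: t \in D' & carrier (v |: t) = j |: carrier t].
Proof.
move=> tD ct jt jD.
have [||z [lz E pz cs]] := cover tD jD (subsetUr _ _) (z := fun i => (i == j)%:Z) => //.
  by move=> i; rewrite !inE negb_or => /andP[/negPf ->].
have [v vt zv] : exists2 v, v \notin t & z v != 0.
  apply: NNPP => h; have := pz j; rewrite eqxx /push big1// => v _.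
  have [vt|vt] := boolP (v \in t); first by rewrite (c_out vt jt) mul0r.
  by have [->|zv] := eqVneq (z v) 0; [rewrite mulr0 | case: h; exists v].
have vD : v |: t \in D'.
  by case: lz => _ /(fan_dc F'); apply; rewrite setSU// sub1set inE.
exists v; split => //; apply/eqP; rewrite eqEcard; apply/andP; split.
  by apply: subset_trans cs; apply: carrierS; rewrite setSU// sub1set inE.
by have := card_carrier vD; rewrite !cardsU1 vt jt ct.
Qed.

(** The rays of [v |: t] generate [u j] and t contributes nothing to the coordinate j, so [c v j]
    divides 1. *)
Lemma facet_coord t j v : t \in D' -> #|carrier t| = #|t| -> j \notin carrier t ->
  v \notin t -> v |: t \in D' -> carrier (v |: t) = j |: carrier t -> c v j = 1%N.
Proof.
move=> tD ct jt vt vD cv.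
have cvt : #|carrier (v |: t)| = #|v |: t| by rewrite cv !cardsU1 vt jt ct.
have [|z z0 E] := span_carrier1 vD cvt (_ : j \in _); first by rewrite cv setU11.
have [m mP] := unimodular_interp (fan_uni F) (fun l => (l == j)%:Z) (carrier_in vD).
have := congr1 (pairing m) E; rewrite mP ?eqxx ?cv ?setU11// pairing_combz.
rewrite (bigD1 v)//= big1 => [|x xv].
  rewrite addr0 (u'E _ vD) ?setU11// (bigD1 j)//= big1 => [|l lj].
    rewrite mP ?cv ?setU11// eqxx mulr1 addr0; move: (z v) (c v j) => w k kw.
    by have [w0|w0] := leP w 0; nia.
  have [lc|lc] := boolP (l \in carrier (v |: t)); first by rewrite mP// (negPf lj) mulr0.
  by rewrite (c_out (setU11 v t) lc) mul0r.
have [xt|xt] := boolP (x \in t); last by rewrite z0 ?mulr0// !inE negb_or xv.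
rewrite (u'E _ tD)// big1 ?mul0r// => l _.
have [lt|lt] := boolP (l \in carrier t); last by rewrite (c_out xt lt) mul0r.
rewrite mP ?cv ?inE ?lt ?orbT//; case: eqP lt jt => [-> ->//|]; by rewrite mulr0.
Qed.

(** Both rays have coordinate 1 along j, so they differ by a vector in the lattice span of t;
    uniqueness of local coordinates at t identifies them. *)
Lemma facet_unique t j v w : t \in D' -> #|carrier t| = #|t| -> j \notin carrier t ->
  v \notin t -> v |: t \in D' -> carrier (v |: t) = j |: carrier t ->
  w \notin t -> w |: t \in D' -> carrier (w |: t) = j |: carrier t -> v = w.
Proof.
move=> tD ct jt vt vD cv wt wD cw.
have cvj := facet_coord tD ct jt vt vD cv; have cwj := facet_coord tD ct jt wt wD cw.
have z0 i : i \notin carrier t -> (c v i)%:Z - (c w i)%:Z = 0.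
  move=> it; have [->|ij] := eqVneq i j; first by rewrite cvj cwj.
  rewrite (c_out (setU11 v t)) ?cv ?inE ?negb_or ?ij//.
  by rewrite (c_out (setU11 w t)) ?cw ?inE ?negb_or ?ij.
have [z' z'0 E] := span_carrier tD ct z0.
have /(_ v) : (fun i => (i == v)%:Z) =1 (fun i => (i == w)%:Z + z' i).
  apply: (fan_local_inj F' (t := t)); [exact: local_delta| |].
    by apply: local_shift => //; apply: local_delta.
  rewrite [RHS]combzD E !combz_delta (cE (set1_in vD (setU11 _ _))) (cE (set1_in wD (setU11 _ _))).
  by rewrite combzD combzN -!combzE addrC subrK.
by rewrite eqxx z'0// addr0; case: eqP.
Qed.

(** Modulo the span of t the carrier is a line. Its fan has exactly two rays, on opposite sides, and
    both generate the lattice of the line, so they are negatives of each other. *)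
Lemma ridge_opposite t : t \in D' -> #|carrier t| = #|t|.+1 ->
  forall v, v \notin t -> v |: t \in D' -> carrier (v |: t) = carrier t ->
  exists v', [/\ v' != v, v' \notin t, v' |: t \in D' /\ carrier (v' |: t) = carrier t,
    (forall m, (forall x, x \in t -> pairing m (u' x) = 0) -> pairing m (u' v') = - pairing m (u' v))
    & forall w, w \notin t -> w |: t \in D' -> carrier (w |: t) = carrier t -> w = v \/ w = v'].
Proof.
move=> tD ct.
have card_ok v : v \notin t -> carrier (v |: t) = carrier t -> #|carrier (v |: t)| = #|v |: t|.
  by move=> vt ->; rewrite ct cardsU1 vt.
have multiple v z : v \notin t -> v |: t \in D' -> carrier (v |: t) = carrier t ->
    (forall i, i \notin carrier t -> z i = 0) ->
    exists q, exists2 z', (forall x, x \notin t -> z' x = 0) &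
      combz u z = u' v *~ q + combz u' z'.
  move=> vt vD cv z0.
  have [|z' z'0 <-] := span_carrier (z := z) vD (card_ok _ vt cv); first by rewrite cv.
  exists (z' v), (fun x => if x \in t then z' x else 0) => [x /negPf ->//|].
  rewrite -(combz_delta u' v) -combzM -combzD; apply: combz_eq => x.
  have [->|xv] := eqVneq x v; first by rewrite (negPf vt) mul1r addr0.
  by rewrite mul0r add0r; case: ifP => // xt; rewrite z'0// !inE xt (negPf xv).
have u'c v : v \notin t -> v |: t \in D' -> u' v = combz u (fun i => (c v i)%:Z).
  by move=> vt vD; rewrite cE ?combzE//; apply: (set1_in vD); rewrite setU11.
have c0 v i : carrier (v |: t) = carrier t -> i \notin carrier t -> (c v i)%:Z = 0.
  by move=> cv it; rewrite (c_out (setU11 v t)) ?cv.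
have local_mul v q : v |: t \in D' -> 0 <= q -> local D' t (fun i => (i == v)%:Z * q).
  move=> vD q0; split=> [i _|]; first by rewrite mulr_ge0//; case: eqP.
  apply: (fan_dc F' vD); apply/subsetP => i; rewrite !inE.
  by case: (i == v); rewrite ?orbT//= mul0r eqxx.
have uniq v w q p z' : v \notin t -> v |: t \in D' -> w |: t \in D' -> 0 < q -> 0 <= p ->
    (forall x, x \notin t -> z' x = 0) ->
    u' v *~ q = u' w *~ p + combz u' z' -> v = w /\ q = p.
  move=> vt vD wD q0 p0 z'0 E.
  have /(_ v) : (fun i => (i == v)%:Z * q) =1 (fun i => (i == w)%:Z * p + z' i).
    apply: (fan_local_inj F' (t := t)); [by apply: local_mul => //; apply: ltW| |].
      by apply: local_shift => //; apply: local_mul.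
    by rewrite [RHS]combzD !combzM !combz_delta.
  by rewrite eqxx z'0// addr0 mul1r; case: eqP => [->|_ h]; [rewrite mul1r | move: q0; rewrite h mul0r].
move=> v vt vD cv.
(* The direction opposite to [u' v] is covered by some cone at t, which supplies [v']. *)
have z0 i : i \notin carrier t -> - (c v i)%:Z = 0 by move=> it; rewrite c0// oppr0.
have [i it|z [lz E pz cs]] := cover tD (carrier_in tD) (subxx _) z0; first by rewrite z0.
have [v' v't zv'] : exists2 v', v' \notin t & z v' != 0.
  apply: NNPP => h.
  have zt x : x \notin t -> z x = 0 by move=> xt; apply/eqP/negP => /negP zx; apply: h; exists x.
  have [] := uniq v v 1 0 (fun x => - z x) vt vD vD _ _ _ _ => // [x /zt ->|]; first by rewrite oppr0.
  by rewrite combzN E combzN opprK mulr0z add0r mulr1z -u'c.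
have v'D : v' |: t \in D'.
  by case: lz => _ /(fan_dc F'); apply; rewrite setSU// sub1set inE.
have cv' : carrier (v' |: t) = carrier t.
  apply/eqP; rewrite eqEsubset; apply/andP; split; last exact: carrierS (subsetUr _ _).
  by apply: subset_trans cs; apply: carrierS; rewrite setSU// sub1set inE.
have [p [z2 z20 E2]] := multiple v _ vt vD cv (fun i => c0 v' i cv').
rewrite -u'c// in E2.
have zx x : x \notin v' |: t -> z x = 0.
  have [_ lD] := lz; have := leq_trans (card_carrier lD) (subset_leq_card cs).
  rewrite ct => h xt; apply: contraTeq h => zx; rewrite -ltnNge.
  have -> : (#|t|.+1 = #|v' |: t|)%N by rewrite cardsU1 v't.
  apply: proper_card; apply/properP; split; first by rewrite setSU// sub1set inE.
  by exists x => //; rewrite !inE zx.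
have zv'0 : 0 < z v' by case: lz => /(_ v' v't); rewrite le_eqVlt eq_sym (negPf zv').
have zE m : (forall x, x \in t -> pairing m (u' x) = 0) ->
    - pairing m (u' v) = pairing m (u' v') * z v'.
  move=> mt; rewrite -pairingNr (u'c v)// -combzN -E pairing_combz (bigD1 v')//= big1 ?addr0//.
  move=> x xv'; have [xt|xt] := boolP (x \in t); first by rewrite mt ?mul0r.
  by rewrite zx ?mulr0// !inE negb_or xv'.
have pE m : (forall x, x \in t -> pairing m (u' x) = 0) ->
    pairing m (u' v') = pairing m (u' v) * p.
  move=> mt; rewrite {1}E2 pairingDr pairingMzr pairing_combz big1 ?addr0 => [|x _].
    by rewrite -mulrzr intz.
  by have [xt|xt] := boolP (x \in t); [rewrite mt ?mul0r|rewrite z20 ?mulr0].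
have [m mP] := unimodular_interp (fan_uni F') (fun l => (l == v)%:Z) vD.
have mt x : x \in t -> pairing m (u' x) = 0.
  by move=> xt; rewrite mP ?inE ?xt ?orbT//; case: eqP xt vt => // -> ->.
have mv : pairing m (u' v) = 1 by rewrite mP ?setU11// eqxx.
have := zE m mt; rewrite pE// mv mul1r => pz1.
have {pz1} p1 : p = -1 by nia.
exists v'; split => //.
- by apply/eqP => vv; have := pE m mt; rewrite vv mv p1.
- by move=> m' m't; rewrite pE// p1 mulrN1.
move=> w wt wD cw.
have [q [z3 z30 E3]] := multiple v _ vt vD cv (fun i => c0 w i cw).
rewrite -u'c// in E3; have [q0|q0] := leP 0 q.
  by left; have [] := uniq w v 1 q z3.
right; have [] // := uniq w v' 1 (- q) (fun x => z2 x * q + z3 x) => //.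
- by rewrite oppr_ge0 ltW.
- by move=> x xt; rewrite z20// z30// mul0r addr0.
rewrite combzD combzM mulr1z E3 addrA; congr (_ + _).
by rewrite E2 p1 mulrN1z mulrNz mulrzDl mulNrz opprD opprK subrK.
Qed.
End Refinement.

Lemma subset_card_succ (I : finType) (A B : {set I}) : A \subset B -> #|B| = #|A|.+1 ->
  exists2 j, j \notin A & B = j |: A.
Proof.
move=> AB cB; have /eqP/cards1P [j jE] : #|B :\: A| = 1%N by rewrite cardsDS// cB subSnn.
have jBA : j \in B :\: A by rewrite jE set11.
exists j; first by move: jBA; rewrite inE => /andP[].
by rewrite -[B](setID _ A) jE (setIidPr AB) setUC.
Qed.

Section Descent.
Variables (n : nat) (T : 'rV[int]_n -> Prop).
Variables (r : nat) (D : {set {set 'I_r}}) (u : 'I_r -> 'rV[int]_n).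
Variables (r' : nat) (D' : {set {set 'I_r'}}) (u' : 'I_r' -> 'rV[int]_n).
Hypotheses (F : fan T D u) (F' : fan T D' u').
Variable c : 'I_r' -> 'I_r -> nat.
Hypothesis cE : forall v, [set v] \in D' -> u' v = comb u (c v).
Hypothesis carrier_in : forall t, t \in D' -> carrier c t \in D.
Implicit Types (t : {set 'I_r'}) (s : {set 'I_r}).
Local Notation carrier := (carrier c).

(** Full-dimensional facets at t correspond one to one to coarse facets at [carrier t]. As h
    vanishes on the carrier and the new coordinate is 1, the inner sum is [h j]. *)
Lemma push_sum (H : zmodType) (G : {set 'I_r} -> H) (h : 'I_r -> int) t :
  t \in D' -> #|carrier t| = #|t| -> (forall l, l \in carrier t -> h l = 0) ->
  \sum_(v | [&& v \notin t, v |: t \in D' & #|carrier (v |: t)| == #|v |: t|])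
     G (carrier (v |: t)) *~ (\sum_l (c v l)%:Z * h l) =
  \sum_(j | (j \notin carrier t) && (j |: carrier t \in D)) G (j |: carrier t) *~ h j.
Proof.
move=> tD ct h0; set s := carrier t.
pose good v := [&& v \notin t, v |: t \in D' & #|carrier (v |: t)| == #|v |: t|].
have good_j v : good v -> exists2 j, j \notin s & carrier (v |: t) = j |: s.
  case/and3P => vt vD /eqP cv; apply: subset_card_succ; first exact: (carrierS c (subsetUr _ _)).
  by rewrite cv cardsU1 vt /s ct.
rewrite (eq_bigr (fun j => \sum_(v | good v && (carrier (v |: t) == j |: s))
    G (carrier (v |: t)) *~ (\sum_l (c v l)%:Z * h l))) => [|j /andP[js jD]].
  rewrite [RHS](exchange_big_dep good) /=; last by move=> j v _ /andP[].
  apply: eq_bigr => v gv0; have gv : good v := gv0; have [j js jE] := good_j v gv.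
  rewrite [RHS](big_pred1 j)// => k; rewrite gv jE /=; apply/andP/eqP => [[/andP[ks _] /eqP E]|->].
    have : k \in j |: s by rewrite E setU11.
    by rewrite !inE (negPf ks) orbF => /eqP.
  by rewrite js -jE eqxx; case/and3P: gv => _ vD _; rewrite (carrier_in vD).
have [v [vt vD cv]] := facet_exists F F' cE carrier_in tD ct js jD.
have gv : good v by rewrite /good vt vD cv !cardsU1 js vt /s ct eqxx.
rewrite (big_pred1 v) => [|w]; last first.
  apply/andP/eqP => [[/and3P[wt wD _] /eqP cw]|->]; last by rewrite gv cv.
  exact: (facet_unique F F' cE carrier_in tD ct js wt wD cw vt vD cv).
rewrite cv; congr (_ *~ _); rewrite (bigD1 j)//= big1 ?addr0 => [|l lj].
  by rewrite (facet_coord F F' cE carrier_in tD ct js vt vD cv) mul1r.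
have [ls|ls] := boolP (l \in s); first by rewrite h0 ?mulr0.
by rewrite (c_out (setU11 v t)) ?mul0r// cv !inE negb_or lj.
Qed.

Lemma push_vanish (m : 'rV[int]_n) t v : t \in D' -> v |: t \in D' ->
  pairing m (u' v) = \sum_l (c v l)%:Z * pairing m (u l).
Proof. by move=> tD vD; rewrite (u'E F' cE _ vD) ?setU11. Qed.

(** A lift is grown ray by ray with [facet_exists]; relations at a coarse cone are then checked at
    its lift. *)
Lemma lift_cone s : s \in D -> exists t, [/\ t \in D', carrier t = s & #|t| = #|s|].
Proof.
elim/finset_ind: s => [|j s js IH] sD.
  (* The zero combination is a point of T, so [D'] has some face and therefore the empty one. *)
  have s0 : supp (fun _ : 'I_r => 0%N) \in D.
    by congr (_ \in D): sD; apply/setP => i; rewrite !inE.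
  have [c' cD _] := fan_ex F' (fan_in F s0).
  exists set0; split; rewrite ?cards0//; first by apply: (fan_dc F' cD); apply: sub0set.
  by apply/setP => i; rewrite inE; apply/negP => /carrierP [v]; rewrite inE.
have [|t [tD ct cs]] := IH; first by apply: (fan_dc F sD); apply: subsetUr.
have ct' : #|carrier t| = #|t| by rewrite ct cs.
have := facet_exists F F' cE carrier_in tD ct' (j := j); rewrite ct => /(_ js sD) [v [vt vD cv]].
by exists (v |: t); rewrite vD cv !cardsU1 js vt cs.
Qed.

Lemma star_relation (s0 s : {set 'I_r}) f m : s \in D -> s0 \subset s ->
  (forall i, i \in s -> pairing m (u i) = f i) ->
  ceq (star D s0) u (pl f * xs (s :\: s0))
   (\sum_(j | (j \notin s) && (j |: s \in D)) xs ((j |: s) :\: s0) *~ (f j - pairing m (u j))).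
Proof.
move=> sD s0s mf; have E : s :\: s0 :|: s0 = s by apply/setP => i; rewrite !inE;
  case: (boolP (i \in s0)) => [/(subsetP s0s) ->|_]; rewrite ?orbT ?orbF.
have := @ceq_pl_xs _ _ D u s0 (s :\: s0) f m; rewrite E => /(_ mf).
move=> h; apply: ceq_trans h _.
rewrite (bigID (fun j => j |: s \in D)) /= -[X in ceq _ _ _ X]addr0; apply: ceqD.
  rewrite (eq_bigr (fun j => xs ((j |: s) :\: s0) *~ (f j - pairing m (u j)))); first exact: ceq_refl.
  move=> j /andP[js _]; congr (xs _ *~ _).
  by rewrite setDUl; congr (_ :|: _); apply/esym/setDidPl; rewrite disjoints1; apply: contra js;
    apply: (subsetP s0s).
apply: ceq0; apply: cid_sum => j /andP[js jD]; apply: cidMz.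
rewrite -[xs _]mulr1; apply: cid_notin; rewrite inE -setUA E; exact: jD.
Qed.

(* Push-forward from the star of s' to the star of the cone s carrying it. *)
Lemma push_forward (s' : {set 'I_r'}) : s' \in D' -> #|carrier s'| = #|s'| ->
  exists W : mpoly r' -> mpoly r,
  [/\ forall p q, W (p + q) = W p + W q,
      forall p, cid (star D' s') u' p -> cid (star D (carrier s')) u (W p),
      forall K : {set 'I_r'}, [disjoint K & s'] -> K :|: s' \in D' ->
        ceq (star D (carrier s')) u (W (xs K))
          (if #|carrier (K :|: s')| == #|K :|: s'| then xs (carrier (K :|: s') :\: carrier s') else 0)
    & forall p q, ceq (star D (carrier s')) u
        (W (meval (fun i => pl (fun v => (c v i)%:Z)) p * q)) (p * W q)].
Proof.
move=> s'D cs'; set s := carrier s'.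
have sD : s \in D by apply: carrier_in.
pose G (k : {set 'I_r}) := xs (k :\: s).
(* A cone is pushed to its carrier if the dimensions agree and to zero otherwise; balancing of this
   weight, with values in the coarse ring, is what makes it a map. *)
pose w (K : {set 'I_r'}) := if (K \in D') && (#|carrier K| == #|K|) then G (carrier K) else 0.
pose N (p : mpoly r) := cid (star D s) u p.
have N0 : N 0 by apply: cid0.
have NB p q : N p -> N q -> N (p - q) by apply: cidB.
have w_sum t (a : 'I_r' -> int) : \sum_(v | v \notin t) w (v |: t) *~ a v =
    \sum_(v | [&& v \notin t, v |: t \in D' & #|carrier (v |: t)| == #|v |: t|])
       G (carrier (v |: t)) *~ a v.
  rewrite (bigID (fun v => (v |: t \in D') && (#|carrier (v |: t)| == #|v |: t|))) /=.
  rewrite [X in _ + X]big1 ?addr0 => [|v /andP[_ /negPf h]]; last by rewrite /w h mul0rz.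
  by apply: eq_bigr => v /andP[_ h]; rewrite /w h.
have card_lt t : t \in D' -> #|carrier t| != #|t| -> (#|t| < #|carrier t|)%N.
  by move=> tD; rewrite ltn_neqAle eq_sym => ->; apply: (card_carrier F' cE).
have same_carrier t v : t \in D' -> #|carrier t| != #|t| -> v \notin t -> v |: t \in D' ->
    #|carrier (v |: t)| = #|v |: t| -> carrier (v |: t) = carrier t /\ #|carrier t| = #|t|.+1.
  move=> tD ct vt vD cv; have lt := card_lt t tD ct.
  have sub : carrier t \subset carrier (v |: t) := carrierS c (subsetUr _ _).
  have := subset_leq_card sub; rewrite cv cardsU1 vt add1n => le.
  split; last by apply/eqP; rewrite eqn_leq le.
  by apply/esym/eqP; rewrite eqEcard sub cv cardsU1 vt.
have wB : balanced D' u' N s' w.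
  split=> [t tD|t m tD s't mt]; first by rewrite /w (negPf tD).
  rewrite w_sum; have [/eqP ct|ct] := boolP (#|carrier t| == #|t|).
    have m0 := vanish_carrier F F' cE carrier_in tD ct mt.
    rewrite (eq_bigr (fun v => G (carrier (v |: t)) *~ (\sum_l (c v l)%:Z * pairing m (u l)))).
      rewrite push_sum//.
      have := star_relation (s0 := s) (f := fun=> 0) (m := m) (carrier_in tD) (carrierS c s't) m0.
      have -> : pl (fun=> 0) = 0 :> mpoly r by rewrite /pl big1// => i _; rewrite mulr0z.
      rewrite mul0r /ceq sub0r => /cidN; rewrite opprK.
      rewrite (eq_bigr (fun j => - (G (j |: carrier t) *~ pairing m (u j)))) => [|j _].
        by rewrite sumrN => /cidN; rewrite opprK.
      by rewrite sub0r mulrNz.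
    by move=> v /and3P[_ vD _]; rewrite -(push_vanish m tD vD).
  (* The carrier of t is too large by at least one dimension: either no facet contributes, or
     exactly two opposite ones do, and they cancel. *)
  have [[v /and3P[vt vD /eqP cv]]|none] := classic (exists v, [&& v \notin t, v |: t \in D' & #|carrier
    (v |: t)| == #|v |: t|]); last first.
    by rewrite big1 // => v gv; case: none; exists v.
  have [cvt ct1] := same_carrier t v tD ct vt vD cv.
  have [v' [v'v v't [v'D cv't] mv' only]] := ridge_opposite F F' cE carrier_in tD ct1 vt vD cvt.
  rewrite (bigD1 v) ?vt ?vD ?cv ?eqxx//= (bigD1 v') /=; last first.
    by rewrite v't v'D v'v cv't ct1 cardsU1 v't eqxx.
  rewrite big1 ?addr0 => [|x /andP[/andP[/and3P[xt xD /eqP cx] xv] xv']]; last first.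
    have [cxt _] := same_carrier t x tD ct xt xD cx.
    by have [/eqP|/eqP] := only x xt xD cxt; rewrite (negPf xv, negPf xv').
  by rewrite cvt cv't mv'// mulrNz subrr.
have [W [WD WN WX]] := balanced_hom (fan_dc F') (fan_uni F') N0 NB s'D wB.
exists W; split=> // [K dK KD|].
  by have := WX K dK; rewrite /w KD /=; case: ifP.
have WX' (K : {set 'I_r'}) : [disjoint K & s'] -> ceq (star D s) u (W (xs K)) (w (K :|: s')) by exact: WX.
(* Projection formula for one variable, checked on face monomials. If the carrier of t is too large,
   both sides vanish, because the interpolated form is zero along every contributing facet. *)
have step i q : N (W (meval (fun i => pl (fun v => (c v i)%:Z)) (mvar i) * q) - mvar i * W q).
  pose f v := (c v i)%:Z; rewrite meval_var -/f; move: q.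
  apply: (@star_functional _ _ _ _ (fan_uni F') _ N (fun q => W (pl f * q) - mvar i * W q) s' s'D N0 NB).
  - by move=> p q; rewrite mulrDr !WD mulrDr opprD addrACA.
  - by move=> p Ip; apply: NB; [apply/WN/cidM | apply/cidM/WN].
  move=> K dK KD; set t := K :|: s'.
  have [m mP] := unimodular_interp (fan_uni F) (fun j => (j == i)%:Z) (carrier_in KD).
  have mE v : v \in t -> pairing m (u' v) = f v.
    move=> vt; rewrite (u'E F' cE m KD vt) (bigD1 i)//= big1 ?addr0 => [|j ji].
      have [it|it] := boolP (i \in carrier t); first by rewrite mP// eqxx mulr1.
      by rewrite /f (c_out vt it) mul0r.
    have [jt|jt] := boolP (j \in carrier t); first by rewrite mP// (negPf ji) mulr0.
    by rewrite (c_out vt jt) mul0r.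
  have key : N (\sum_(v | v \notin t) w (v |: t) *~ (f v - pairing m (u' v)) - mvar i * w t).
    rewrite w_sum (eq_bigr (fun v => G (carrier (v |: t)) *~
        (\sum_l (c v l)%:Z * ((l == i)%:Z - pairing m (u l))))) => [|v /and3P[vt vD _]]; last first.
      congr (_ *~ _); rewrite (push_vanish m KD vD) /f.
      under [RHS]eq_bigr => l _ do rewrite mulrBr; rewrite sumrB; congr (_ - _).
      by rewrite (bigD1 i)//= eqxx mulr1 big1 ?addr0// => l /negPf ->; rewrite mulr0.
    have h0 l : l \in carrier t -> (l == i)%:Z - pairing m (u l) = 0.
      by move=> lt; rewrite mP// subrr.
    have [/eqP ct|ct] := boolP (#|carrier t| == #|t|).
      rewrite push_sum// /w KD ct eqxx /=.
      have := star_relation (s0 := s) (f := fun j => (j == i)%:Z) (m :=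
        m) (carrier_in KD) (carrierS c (subsetUr _ _)) mP.
      have -> : pl (fun j => (j == i)%:Z) = mvar i.
        rewrite /pl (bigD1 i)//= eqxx big1 ?addr0// => j /negPf ->.
        by rewrite mulr0z.
      by move/ceq_sym.
    rewrite /w (negPf ct) andbF mulr0 subr0 big1// => v /and3P[vt vD /eqP cv].
    have [cvt _] := same_carrier t v KD ct vt vD cv.
    rewrite big1 ?mulr0z// => l _; have [lt|lt] := boolP (l \in carrier t); first by rewrite h0 ?mulr0.
    by rewrite (c_out (setU11 v t)) ?mul0r// cvt.
  have rel : N (W (pl f * xs K) - \sum_(v | v \notin t) w (v |: t) *~ (f v - pairing m (u' v))).
    have := WN _ (ceq_pl_xs D' mE); rewrite (additiveB WD) => h.
    apply: ceq_trans h _; rewrite (additive_sum WD) /ceq -sumrB; apply: cid_sum => v vt.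
    rewrite (additiveMz WD) -mulrzBl; apply: cidMz; rewrite setUA; apply: WX'.
    by move: vt; rewrite inE negb_or => /andP[_ vs]; rewrite -setI_eq0 setIUl setU_eq0 !setI_eq0 dK
      disjoints1 vs.
  apply: (ceq_trans rel); apply: (ceq_trans key); apply: ceqM; apply: ceq_sym; exact: WX'.
elim/mpoly_mon_ind => [p1 p2 I1 I2||i p IH] q.
- rewrite rmorphB !mulrBl (additiveB WD) /ceq.
  have E (a b e d : mpoly r) : a - b - (e - d) = (a - e) - (b - d) by ring.
  by rewrite E; apply: cidB; [apply: I1 | apply: I2].
- by rewrite rmorph1 !mul1r; apply: ceq_refl.
rewrite rmorphM -!mulrA; apply: ceq_trans (step i _) _; exact: ceqM.
Qed.

(** By the projection formula and [W 1 = 1] modulo the ideal, pulling back and pushing forward is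
    the identity. Applying W to both legs of a Casimir element of the lifted star gives one for the
    coarse star. *)
Lemma HPD_descent d : HPD D' u' d -> HPD D u d.
Proof.
move=> [[D'd D'ex] [deg' deg'P ker]]; have [deg'D deg'0 deg'1] := deg'P.
have Dd s : s \in D -> (#|s| <= d)%N by move=> /lift_cone [t [tD _ <-]]; apply: D'd.
have carrier_d t : t \in D' -> #|t| = d -> #|carrier t| = d.
  move=> tD td; apply/eqP; rewrite eqn_leq Dd ?carrier_in// -td.
  exact: (card_carrier F' cE).
(* The coarse degree is the weight 1 on top cones. [push_sum] transports its balancing at s to the
   lift of s, where it is a relation killed by [deg']. *)
have wB : balanced D u (fun x : int => x = 0) set0 (fun s => ((s \in D) && (#|s| == d))%:Z).
  split=> [s /negPf ->//|s m sD _ ms].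
  have [t [tD ts tc]] := lift_cone sD.
  have ct : #|carrier t| = #|t| by rewrite ts.
  have [sd|sd] := eqVneq #|s|.+1 d; last first.
    rewrite big1// => v vs; rewrite cardsU1 vs add1n (negPf sd) andbF; exact: mul0rz.
  rewrite (bigID (fun v => v |: s \in D)) /= [X in _ + X]big1 ?addr0 => [|v /andP[_ /negPf ->]];
    last exact: mul0rz.
  have ms' l : l \in carrier t -> pairing m (u l) = 0 by rewrite ts; apply: ms.
  have := push_sum (fun _ => 1 : int) tD ct ms'; rewrite ts => E.
  rewrite (eq_bigr (fun v => 1 *~ pairing m (u v))) => [|v /andP[vs ->]]; last first.
    by rewrite cardsU1 vs add1n sd eqxx.
  rewrite -E.
  have mt v : v \in t -> pairing m (u' v) = 0.
    move=> vt; rewrite (u'E F' cE m tD vt) big1// => l _.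
    have [lt|lt] := boolP (l \in carrier t); first by rewrite ms' ?mulr0.
    by rewrite (c_out vt lt) mul0r.
  have td : #|t|.+1 = d by rewrite tc.
  have /deg'0 : cid D' u' (\sum_(v | v \notin t) xs (v |: t) *~ pairing m (u' v)).
    have h v : v \in t :|: set0 -> pairing m (u' v) = (fun=> 0) v by rewrite setU0; apply: mt.
    have := ceq_pl_xs D' h; rewrite star0 setU0.
    have -> : pl (fun=> 0) = 0 :> mpoly r' by rewrite /pl big1// => i _; rewrite mulr0z.
    rewrite mul0r /ceq sub0r => /cidN; rewrite opprK.
    rewrite (eq_bigr (fun v => - (xs (v |: t) *~ pairing m (u' v)))) => [|v _].
      by rewrite sumrN => /cidN; rewrite opprK.
    by rewrite sub0r mulrNz.
  rewrite (additive_sum deg'D) => Z; rewrite -[RHS]Z.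
  rewrite [RHS](bigID (fun v => v |: t \in D')) /= [X in _ = _ + X]big1 ?addr0 => [|v /andP[vt vD]]; last first.
    by rewrite deg'0//; apply: cidMz; rewrite -[xs _]mulr1; apply: cid_notin.
  apply: eq_big => [v|v /and3P[vt vD _]].
    case: (boolP (v \in t)) => //= vt; case: (boolP (v |: t \in D')) => //= vD.
    by rewrite carrier_d// cardsU1 vt add1n// td eqxx.
  by rewrite (additiveMz deg'D) deg'1// cardsU1 vt add1n td eqxx (push_vanish m tD vD).
have NB0 (x y : int) : x = 0 -> y = 0 -> x - y = 0 by move=> -> ->.
have [sD0|none] := boolP (set0 \in D); last first.
  have Dn s : s \notin D by apply: contra none => sD; apply: (fan_dc F sD); apply: sub0set.
  split; first by split=> s sD; case/negP: (Dn s).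
  exists (fun=> 0) => [|s sD]; last by case/negP: (Dn s).
  by split=> // s sD; case/negP: (Dn s).
have [deg [degD deg0 degx]] := balanced_hom (fan_dc F) (fan_uni F) (erefl 0) NB0 sD0 wB.
have degP : is_degree D u d deg.
  split=> // [p Ip|s sD]; first by apply: deg0; rewrite star0.
  have := degx s; rewrite disjoints_subset setC0 subsetT setU0 sD /= => /(_ isT) /eqP.
  by rewrite /eqN subr_eq0 => /eqP.
split.
  split=> // s sD; have [t [tD ts tc]] := lift_cone sD.
  have [t' t'D t'd] := D'ex t tD.
  by exists (carrier t'); [apply: carrier_in | apply: carrier_d].
exists deg => // s sD; have [t [tD ts tc]] := lift_cone sD.
have ct : #|carrier t| = #|t| by rewrite ts.
have [W [WD WN WX WM]] := push_forward tD ct; rewrite ts in WN WX WM.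
have degW q : deg (xs s * W q) = deg' (xs t * q).
  apply/eqP; rewrite -subr_eq0; apply/eqP; move: q.
  apply: (@star_functional _ _ _ _ (fan_uni F') _ (fun x : int => x = 0) (fun q =>
    deg (xs s * W q) - deg' (xs t * q)) t tD (erefl 0) NB0).
  - by move=> p q; rewrite WD !mulrDr degD deg'D opprD addrACA.
  - move=> p Ip; rewrite (cid_star_deg (fan_dc F) degP (WN p Ip)).
    by rewrite (cid_star_deg (fan_dc F') deg'P Ip) subrr.
  move=> K dK KD; have := WX K dK KD.
  move/(cid_star_deg (fan_dc F) degP); rewrite mulrBr (additiveB degD) => /eqP.
  rewrite subr_eq0 => /eqP ->; rewrite [xs t * _]mulrC -xsU// deg'1//.
  case: eqP => cK.
    have sub : s \subset carrier (K :|: t) by rewrite -ts; apply: carrierS; apply: subsetUr.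
    by have [_ _ dx] := degP; rewrite -xsD// dx ?carrier_in// cK subrr.
  rewrite mulr0 (additive0 degD); case: eqP => // Kd.
  by case: cK; rewrite carrier_d.
have [ks ksP] := ker t tD.
exists [seq (W ab.1, W ab.2) | ab <- ks] => p; rewrite big_map /=.
pose q := meval (fun i => pl (fun v => (c v i)%:Z)) p.
have E : \sum_(ab <- ks) W ab.2 *~ deg (xs s * (p * W ab.1)) =
  W (\sum_(ab <- ks) ab.2 *~ deg' (xs t * (q * ab.1))).
  rewrite (additive_sum WD); apply: eq_bigr => ab _; rewrite (additiveMz WD); congr (_ *~ _).
  rewrite -degW; apply/eqP; rewrite eq_sym -subr_eq0 -(additiveB degD) -mulrBr; apply/eqP.
  exact: (cid_star_deg (fan_dc F) degP (WM p ab.1)).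
rewrite (eq_bigr (fun ab => W ab.2 *~ deg (xs s * (p * W ab.1)))) => [|ab _]; last by rewrite mulrA.
rewrite E; have := WN _ (ksP q); rewrite (additiveB WD) => /ceq_sym h.
apply: ceq_sym; apply: ceq_trans h _; rewrite -(mulr1 q).
apply: ceq_trans (WM p 1) _; rewrite -[X in ceq _ _ _ X]mulr1; apply: ceqM.
have d0 : [disjoint (set0 : {set 'I_r'}) & t] by rewrite disjoints_subset sub0set.
by have := WX set0 d0; rewrite set0U xs0 ct eqxx ts setDv xs0; apply.
Qed.

End Descent.

Definition refines n r' (D' : {set {set 'I_r'}}) (u' : 'I_r' -> 'rV[int]_n)
    r (D : {set {set 'I_r}}) (u : 'I_r -> 'rV[int]_n) :=
  forall t, t \in D' -> exists2 s, s \in D &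
    forall v, v \in t -> exists2 c, supp c \subset s & comb u c = u' v.

Theorem HPD_refines n (T : 'rV[int]_n -> Prop) r (D : {set {set 'I_r}}) u
    r' (D' : {set {set 'I_r'}}) u' d :
  fan T D u -> fan T D' u' -> refines D' u' D u -> HPD D' u' d -> HPD D u d.
Proof.
move=> F F' ref H.
have cex v : exists c, [set v] \in D' -> supp c \in D /\ comb u c = u' v.
  case: (boolP ([set v] \in D')) => vD; last by exists (fun=> 0%N).
  have [s sD sP] := ref _ vD; have [c cs cE] := sP v (set11 v).
  by exists c => _; split=> //; apply: (fan_dc F sD).
have [c cP] := choice (fun v c => [set v] \in D' -> supp c \in D /\ comb u c = u' v) cex.
apply: (HPD_descent F F' (c := c)) H => [v vD|t tD]; first by have [_ ->] := cP v vD.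
have [s sD sP] := ref t tD; apply: (fan_dc F sD); apply/subsetP => i /carrierP [v vt].
have [vD cE] : supp (c v) \in D /\ comb u (c v) = u' v.
  by apply: cP; apply: (fan_dc F' tD); rewrite sub1set.
have [c' c's c'E] := sP v vt.
have -> : c v i = c' i by apply: (fan_inj F) => //; [apply: (fan_dc F sD) | rewrite cE c'E].
by move=> h; apply: (subsetP c's); rewrite inE.
Qed.

Arguments mvar : simpl never.

(* A new vertex ord0 is added to 'I_r; the old vertex v becomes lift ord0 v. *)
(** * Blowups of two-dimensional cones *)

Section NewVertex.
Variable r : nat.
Implicit Types (K : {set 'I_r.+1}) (s : {set 'I_r}).

Definition old K : {set 'I_r} := [set v | lift ord0 v \in K].
Definition up s : {set 'I_r.+1} := [set lift ord0 v | v in s].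
Definition ext (A : Type) (x : A) (f : 'I_r -> A) (w : 'I_r.+1) : A :=
  if unlift ord0 w is Some v then f v else x.

Lemma ext0 (A : Type) (x : A) f : ext x f ord0 = x.
Proof. by rewrite /ext unlift_none. Qed.

Lemma extS (A : Type) (x : A) f v : ext x f (lift ord0 v) = f v.
Proof. by rewrite /ext liftK. Qed.

Lemma old_up s : old (up s) = s.
Proof. by apply/setP => v; rewrite inE mem_imset//; apply: lift_inj. Qed.

Lemma in_old K v : (v \in old K) = (lift ord0 v \in K).
Proof. by rewrite inE. Qed.

Lemma ord0_up s : ord0 \notin up s.
Proof. by apply/negP => /imsetP [v _] /eqP; rewrite (negPf (neq_lift _ _)). Qed.

Lemma oldU K K' : old (K :|: K') = old K :|: old K'.
Proof. by apply/setP => v; rewrite !inE. Qed.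

Lemma oldS K K' : K \subset K' -> old K \subset old K'.
Proof. by move=> sKK; apply/subsetP => v; rewrite !inE; apply: (subsetP sKK). Qed.

Lemma old0 : old [set ord0] = set0.
Proof. by apply/setP => v; rewrite !inE eq_sym (negPf (neq_lift _ _)). Qed.

Lemma setE_old K : K = (if ord0 \in K then [set ord0] else set0) :|: up (old K).
Proof.
apply/setP => w; case: (unliftP ord0 w) => [v|] ->.
  rewrite inE (mem_imset _ _ (@lift_inj _ ord0)) in_old.
  by case: ifP; rewrite !inE // eq_sym (negPf (neq_lift _ _)).
by rewrite inE (negPf (ord0_up _)) orbF; case: ifP; rewrite !inE.
Qed.

Lemma card_old K : #|K| = ((ord0 \in K) + #|old K|)%N.
Proof.
rewrite {1}(setE_old K); have cu : #|up (old K)| = #|old K| by rewrite card_imset//; apply: lift_inj.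
by case: ifP => _; rewrite ?set0U ?cardsU1 ?ord0_up cu.
Qed.

Lemma xs_up s : xs (up s) = \prod_(v in s) mvar (lift ord0 v).
Proof. by rewrite /xs big_imset//; move=> x y _ _; apply: lift_inj. Qed.

Lemma xs_old K : xs K = (if ord0 \in K then mvar ord0 else 1) * xs (up (old K)).
Proof.
rewrite {1}(setE_old K); case: ifP => _; last by rewrite set0U mul1r.
by rewrite xsU1// ord0_up.
Qed.

Lemma sum_ext (V : zmodType) (f : 'I_r.+1 -> V) : \sum_w f w = f ord0 + \sum_v f (lift ord0 v).
Proof. by rewrite big_ord_recl. Qed.

Lemma pl_ext (f : 'I_r.+1 -> int) :
  pl f = mvar ord0 *~ f ord0 + \sum_v mvar (lift ord0 v) *~ f (lift ord0 v).
Proof. exact: sum_ext. Qed.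

End NewVertex.

Section Blowup.
Variables (r n : nat) (D : {set {set 'I_r}}) (u : 'I_r -> 'rV[int]_n) (i j : 'I_r).
Hypotheses (ij : i != j) (dD : dclosed D).
Local Notation tau := [set i; j].
Implicit Types (K : {set 'I_r.+1}) (s : {set 'I_r}).

(** The smallest cone of D containing the cone K of the subdivision. *)
Definition core K : {set 'I_r} := (if ord0 \in K then tau else set0) :|: old K.
(* Star subdivision of the cone spanned by u i and u j. *)
Definition blowup : {set {set 'I_r.+1}} := [set K | ~~ (tau \subset old K) && (core K \in D)].
Definition ublow : 'I_r.+1 -> 'rV[int]_n := ext (u i + u j) u.

Lemma coreS K K' : K \subset K' -> core K \subset core K'.
Proof.
move=> sKK; apply: setUSS; last exact: oldS.
by case: ifP => // K0; rewrite ?sub0set// (subsetP sKK _ K0).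
Qed.

Lemma blowup_dclosed : dclosed blowup.
Proof.
move=> K L; rewrite !inE => /andP[tK KD] LK; apply/andP; split.
  by apply: contra tK => /subset_trans; apply; apply: oldS.
exact: dD KD (coreS LK).
Qed.

(* Coordinates in which the Chow ring of the blowup is a quadratic extension:
   pullback sends the variable of u v to its total transform. *)
Definition pullback : {rmorphism mpoly r -> mpoly r.+1} :=
  meval (fun v => mvar (lift ord0 v) + (if v \in tau then mvar ord0 else 0)).

Lemma pullback_var v : pullback (mvar v) = mvar (lift ord0 v) + (if v \in tau then mvar ord0 else 0).
Proof. by rewrite /pullback meval_var. Qed.

Local Notation e := (mvar (@ord0 r)).
Local Notation xi := (mvar (lift ord0 i)).
Local Notation xj := (mvar (lift ord0 j)).

Lemma pullback_i : pullback (mvar i) = xi + e.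
Proof. by rewrite pullback_var !inE eqxx. Qed.

Lemma pullback_j : pullback (mvar j) = xj + e.
Proof. by rewrite pullback_var !inE eqxx orbT. Qed.

Lemma pullback_xs_disjoint s : [disjoint s & tau] -> pullback (xs s) = xs (up s).
Proof.
move=> ds; rewrite rmorph_xs xs_up; apply: eq_bigr => v vs.
by rewrite pullback_var (disjointFr ds vs) addr0.
Qed.

Lemma pullback_pl m : pullback (pl (fun v => pairing m (u v))) = pl (fun w => pairing m (ublow w)).
Proof.
rewrite rmorph_pl pl_ext /ublow ext0 addrC.
under eq_bigr => v _ do rewrite pullback_var mulrzDl.
rewrite big_split /=; congr (_ + _); first by apply: eq_bigr => v _; rewrite extS.
rewrite (bigD1 i)//= (bigD1 j)//= ?(eq_sym j)// big1 => [|v /andP[vi vj]].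
  by rewrite !inE !eqxx orbT addr0 pairingDr mulrzDr.
by rewrite !inE (negPf vi) (negPf vj) mul0rz.
Qed.

Lemma prodD_multiple (A : comNzRingType) (I : finType) (S : {set I}) (f g : I -> A) (x : A) :
  (forall v, exists q, g v = q * x) ->
  exists q, \prod_(v in S) (f v + g v) = \prod_(v in S) f v + q * x.
Proof.
move=> gx; apply: (big_ind2 (fun a b => exists q, a = b + q * x)).
- by exists 0; rewrite mul0r addr0.
- move=> a b a' b' [q ->] [q' ->]; exists (q * b' + b * q' + q * q' * x); ring.
by move=> v _; have [q ->] := gx v; exists q.
Qed.

Lemma pullback_xs s : exists q, pullback (xs s) = xs (up s) + q * (e * xs (up (s :\: tau))).
Proof.
have -> : xs s = xs (s :&: tau) * xs (s :\: tau) :> mpoly r.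
  by rewrite (xsD (subsetIl s tau)) setDIr setDv set0U.
rewrite rmorphM (pullback_xs_disjoint (s := s :\: tau)); last first.
  by rewrite -setI_eq0 setDE -setIA [~: _ :&: _]setIC setICr setI0.
have [|q qE] := @prodD_multiple _ _ (s :&: tau) (fun v => mvar (lift ord0 v)) (fun v =>
  if v \in tau then e else 0) e.
  by move=> v; case: ifP => _; [exists 1; rewrite mul1r | exists 0; rewrite mul0r].
exists q; rewrite rmorph_xs (eq_bigr _ (fun v _ => pullback_var v)) qE mulrDl mulrA; congr (_ + _).
by rewrite !xs_up [RHS](big_setID tau).
Qed.

Lemma cid_xij K : cid (star blowup K) ublow (xi * xj).
Proof.
have -> : xi * xj = xs (up tau).
  by rewrite xs_up big_setU1 ?inE//= big_set1.
rewrite -[xs _]mulr1; apply: cid_notin; rewrite !inE negb_and negbK oldU old_up.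
by rewrite subsetUl.
Qed.

(** The pullback of a nonface is its strict term plus a multiple of e times the rays off tau. The
    core of each contains the nonface, so neither is a face of the blowup. *)
Lemma cid_pullback K p : cid (star D (core K)) u p -> cid (star blowup K) ublow (pullback p).
Proof.
apply: cid_rmorph => [s sD|m]; last by rewrite pullback_pl -[pl _]mul1r; apply: cid_lin.
have [q ->] := pullback_xs s; rewrite inE in sD; apply: cid_add.
  rewrite -[xs _]mulr1; apply: cid_notin; apply: contra sD; rewrite !inE => /andP[_].
  move=> h; apply: dD h _; rewrite /core inE (negPf (ord0_up _)) orFb oldU old_up.
  by rewrite setUCA.
rewrite mulrA [q * e]mulrC -mulrA; 
have -> : e * (q * xs (up (s :\: tau))) = q * xs (ord0 |: up (s :\: tau)).
  by rewrite xsU1 ?ord0_up// mulrCA.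
apply: cid_face; apply: contra sD; rewrite !inE => /andP[_] h; apply: dD h _.
rewrite /core !inE eqxx /= !oldU old0 set0U old_up; apply/subsetP => v.
rewrite !inE; case: (ord0 \in K); rewrite ?inE; case: (v == i); case: (v == j) => //=.
Qed.

Definition quadQ : {poly mpoly r} := ('X - (mvar i)%:P) * ('X - (mvar j)%:P).

Lemma quadQ_monic : quadQ \is monic.
Proof. by rewrite rpredM// monicXsubC. Qed.

Lemma size_quadQ : size quadQ = 3%N.
Proof. by rewrite size_Mmonic ?polyXsubC_eq0 ?monicXsubC ?size_XsubC// -size_poly_eq0 size_XsubC. Qed.

(* Writing p in the coordinates pullback (mvar v), e and dividing by
   (e - y_i) (e - y_j), which is the product of the strict transforms. *)
Lemma blowup_decomp : exists P0 P1 : mpoly r.+1 -> mpoly r,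
  [/\ (forall p q, P0 (p + q) = P0 p + P0 q) /\ (forall p q, P1 (p + q) = P1 p + P1 q),
      (forall a p, P0 (pullback a * p) = a * P0 p) /\ (forall a p, P1 (pullback a * p) = a * P1 p),
      P0 1 = 1 /\ P1 1 = 0,
      (forall p, P0 (e * p) = - (mvar i * mvar j * P1 p)) /\
      (forall p, P1 (e * p) = P0 p + (mvar i + mvar j) * P1 p)
    & forall p, exists q, p = pullback (P0 p) + pullback (P1 p) * e + q * (xi * xj)].
Proof.
(* [s] and [back] are inverse isomorphisms between the new polynomial ring and polynomials in e over
   the old one. *)
pose s : {rmorphism mpoly r.+1 -> {poly mpoly r}} :=
  meval (ext 'X (fun v => (mvar v)%:P - (if v \in tau then 'X else 0))).
pose back : {rmorphism {poly mpoly r} -> mpoly r.+1} :=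
  horner_morph (fun a => mulrC e (pullback a)).
have backC a : back a%:P = pullback a by exact: horner_morphC.
have backX : back 'X = e by exact: horner_morphX.
have se : s e = 'X by rewrite meval_var ext0.
have backs p : back (s p) = p.
  have := meval_ext (f := back \o s) (g := idfun); apply => w; change (back (s (mvar w)) = mvar w).
  rewrite meval_var; case: (unliftP ord0 w) => [v|] ->; last by rewrite ext0.
  rewrite extS rmorphB backC pullback_var; case: ifP => _; last by rewrite rmorph0 subr0 addr0.
  by rewrite backX addrK.
have spull a : s (pullback a) = a%:P.
  have := meval_ext (f := s \o pullback) (g := polyC); apply => v; change (s (pullback (mvar v)) = (mvar v)%:P).
  rewrite pullback_var rmorphD [s (mvar (lift _ _))]meval_var extS.
  by case: ifP => _; rewrite ?se ?rmorph0 ?subr0 ?addr0 ?subrK.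
have mQ := quadQ_monic; have sQ := size_quadQ.
pose red p := Pdiv.Ring.rmodp (s p) quadQ.
have redD p q : red (p + q) = red p + red q by rewrite /red rmorphD Pdiv.RingMonic.rmodpD.
have redM a p : red (pullback a * p) = a *: red p.
  by rewrite /red rmorphM spull mul_polyC Pdiv.RingMonic.rmodpZ.
have szred p : (size (red p) <= 2)%N.
  by rewrite -ltnS -sQ Pdiv.Ring.ltn_rmodpN0 ?monic_neq0.
have redE p : red p = ((red p)`_0)%:P + (red p)`_1 *: 'X.
  apply/polyP => k; rewrite coefD coefC coefZ coefX.
  case: k => [|[|k]] /=; rewrite ?mulr0 ?mulr1 ?addr0 ?add0r//.
  by rewrite nth_default// (leq_trans (szred p)).
exists (fun p => (red p)`_0), (fun p => (red p)`_1); split.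
- by split=> p q; rewrite redD coefD.
- by split=> a p; rewrite redM coefZ.
- have -> : red 1 = 1 by rewrite /red rmorph1 Pdiv.Ring.rmodp_small// size_poly1 sQ.
  by rewrite !coef1.
- have redX p : red (e * p) = (- (mvar i * mvar j * (red p)`_1))%:P +
      ((red p)`_0 + (mvar i + mvar j) * (red p)`_1) *: 'X.
    set a := (red p)`_0; set b := (red p)`_1.
    rewrite /red rmorphM se -Pdiv.RingMonic.rmodp_mulmr// -/(red p).
    have -> : 'X * red p = b%:P * quadQ +
        ((- (mvar i * mvar j * b))%:P + (a + (mvar i + mvar j) * b) *: 'X) :> {poly mpoly r}.
      rewrite redE -/a -/b -!mul_polyC polyCN !polyCM !polyCD !polyCM !polyCD /quadQ; ring.
    rewrite Pdiv.RingMonic.rmodp_addl_mul_small//; rewrite sQ ltnS.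
    rewrite (leq_trans (size_polyD _ _))// geq_max (leq_trans (size_polyC_leq1 _))//=.
    by rewrite (leq_trans (size_scale_leq _ _))// size_polyX.
  by split=> p; rewrite redX coefD coefC coefZ coefX /= ?mulr0 ?mulr1 ?addr0 ?add0r.
move=> p; exists (back (Pdiv.Ring.rdivp (s p) quadQ)).
have bQ : back quadQ = xi * xj.
  rewrite /quadQ rmorphM !rmorphB !backC backX pullback_i pullback_j; ring.
have := congr1 back (Pdiv.RingMonic.rdivp_eq mQ (s p)); rewrite backs => E.
rewrite rmorphD [back (_ * quadQ)]rmorphM bQ -/(red p) redE rmorphD -mul_polyC in E.
rewrite [back (_ * 'X)]rmorphM !backC backX in E; rewrite [LHS]E; exact: addrC.
Qed.

End Blowup.

Section BlowupHPD.
Variables (r n : nat) (D : {set {set 'I_r}}) (u : 'I_r -> 'rV[int]_n) (i j : 'I_r).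
Hypotheses (ij : i != j) (dD : dclosed D).
Local Notation tau := [set i; j].
Hypothesis tD : tau \in D.
Implicit Types (K : {set 'I_r.+1}) (s : {set 'I_r}).
Local Notation e := (mvar (@ord0 r)).
Local Notation xi := (mvar (lift ord0 i)).
Local Notation xj := (mvar (lift ord0 j)).
Local Notation yi := (mvar i).
Local Notation yj := (mvar j).
Local Notation pull := (pullback i j).
Local Notation D' := (blowup D i j).
Local Notation u' := (ublow u i j).

Lemma xs_tau : xs tau = yi * yj.
Proof. by rewrite /xs big_setU1 ?inE// big_set1. Qed.

(* The restriction to the strict transform of u l, where the exceptional class e
   becomes the other coordinate y k and x k becomes 0. *)
Lemma xs_pull s l : l \in tau -> s :&: tau = [set l] ->
  xs (up s) = (pull (mvar l) - e) * pull (xs (s :\ l)).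
Proof.
move=> lt sl; have ls : l \in s by have := set11 l; rewrite -sl inE => /andP[].
rewrite -{1}(setD1K ls) pullback_xs_disjoint.
  rewrite !xs_up big_setU1 ?inE ?eqxx//= pullback_var lt addrK; congr (_ * _).
rewrite -setI_eq0 setIDAC sl setDv //.
Qed.

(** In the coordinates P0, P1 the new ring is the direct sum of the ring of D and e times that of
    the star of tau; J is its ideal in these coordinates, and the degree is that of P0. Casimir
    elements come in three cases: K meets tau in one ray, and its star has the same ring as the star
    of [core K]; K contains the exceptional ray but no ray of tau, and the new ring is that of a
    projective line bundle; or K avoids both, and the sum is orthogonal. *)
Lemma HPD_blowup d : HPD D u d -> HPD D' u' d.
Proof.
move=> [[Dd Dex] [deg degP ker]]; have [degD deg0 deg1] := degP.
have [P0 [P1 [[P0D P1D] [P0M P1M] [P01 P11] [P0e P1e] dec]]] := blowup_decomp i j.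
have P00 := additive0 P0D; have P10 := additive0 P1D.
have pij p : P0 (xi * xj * p) = 0 /\ P1 (xi * xj * p) = 0.
  have -> : xi * xj * p = pull (yi * yj) * p - pull (yi + yj) * (e * p) + e * (e * p).
    rewrite rmorphM rmorphD pullback_i pullback_j; ring.
  rewrite !P0D !P1D (additiveN P0D) (additiveN P1D) !P0M !P1M !P0e !P1e P0e; split; ring.
have P0pull a : P0 (pull a) = a by rewrite -[pull a]mulr1 P0M P01 mulr1.
have P1pull a : P1 (pull a) = 0 by rewrite -[pull a]mulr1 P1M P11 mulr0.
pose J p := cid D u (P0 p) /\ cid (star D tau) u (P1 p).
have Je p : J p -> J (e * p).
  move=> [J0 J1]; rewrite /J P0e P1e; split.
    apply: cidN; rewrite -xs_tau -[D]star0; apply: cid_star_xs => //; by rewrite setU0.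
  by apply: cid_add; [apply: cid_star|apply: cidM].
have JB p q : J p -> J q -> J (p - q).
  move=> [J0 J1] [J0' J1']; rewrite /J (additiveB P0D) (additiveB P1D).
  by split; apply: cidB.
have JM a p : J p -> J (a * p).
  move=> Jp; elim/mpoly_mon_ind: a => [a b Ja Jb||w a Ja]; first by rewrite mulrBl; apply: JB.
    by rewrite mul1r.
  rewrite -mulrA; case: (unliftP ord0 w) => [v|] ->; last exact: Je.
  have -> : mvar (lift ord0 v) = pull (mvar v) - (if v \in tau then e else 0).
    by rewrite pullback_var addrK.
  rewrite mulrBl; apply: JB; first by rewrite /J P0M P1M; case: Ja => *; split; apply: cidM.
  by case: ifP => _; [apply: Je | rewrite mul0r /J P00 P10; split; apply: cid0].
have Pxs s : ~~ (tau \subset s) ->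
    P0 (xs (up s)) = xs s /\ exists z : int, P1 (xs (up s)) = - xs (s :\: tau) *~ z.
  move=> ts; have [s0|[l]] := set_0Vmem (s :&: tau).
    have ds : [disjoint s & tau] by rewrite -setI_eq0 s0.
    by rewrite -(@pullback_xs_disjoint _ i j s ds) P0pull P1pull; split => //; exists 0; rewrite mulr0z.
  rewrite inE => /andP[ls lt].
  have sl : s :&: tau = [set l].
    apply/setP => v; rewrite !inE; move: ts lt; rewrite !inE subUset !sub1set.
    case: (eqVneq v l) => [->|vl]; first by rewrite ls => _ ->.
    move=> ts /orP[/eqP li|/eqP lj]; apply/negP => /andP[vs /orP[/eqP vi|/eqP vj]].
    - by rewrite vi li eqxx in vl.
    - by case/negP: ts; rewrite -vj vs -li ls.
    - by case/negP: ts; rewrite -vi vs -lj ls.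
    by rewrite vj lj eqxx in vl.
  rewrite (xs_pull lt sl) mulrBl (additiveB P0D) (additiveB P1D) -rmorphM -xsU1 ?inE ?eqxx// setD1K//.
  rewrite P0pull P1pull P0e P1e P1pull P0pull !mulr0 oppr0 subr0 addr0 sub0r; split=> //.
  exists 1; rewrite mulr1z; congr (- xs _); apply/setP => v; have := congr1 (fun A : {set _} => v \in A) sl.
  by rewrite !inE; case: (v \in s); rewrite ?andbF//= => ->; rewrite andbT.
have Jcid p : cid D' u' p -> J p.
  elim=> [a K KD|a m|p1 p2 _ J1 _ J2]; last first.
  - by rewrite -(opprK p2); apply: JB => //; rewrite -mulN1r; apply: JM.
  - apply: JM; rewrite -pullback_pl// /J P0pull P1pull; split; last exact: cid0.
    by rewrite -[pl _]mul1r; apply: cid_lin.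
  apply: JM; move: KD; rewrite inE negb_and negbK => KD.
  have [tK|tK] := boolP (tau \subset old K).
    have [q ->] : exists q, xs K = xi * xj * q.
      rewrite xs_old; exists ((if ord0 \in K then e else 1) * xs (up (old K :\: tau))).
      rewrite mulrCA; congr (_ * _); rewrite !xs_up (big_setID tau) /= (setIidPr tK).
      by rewrite big_setU1 ?inE// big_set1.
    by have [E0 E1] := pij q; rewrite /J E0 E1; split; apply: cid0.
  rewrite (negPf tK) /= in KD.
  have [E0 [z E1]] := Pxs _ tK; rewrite xs_old; move: KD; rewrite /core; case: ifP => K0 KD; last first.
    rewrite set0U in KD; rewrite mul1r /J E0 E1; split.
      by rewrite -[xs _]mulr1; apply: cid_notin.
    apply: cidMz; apply: cidN; rewrite -[xs _]mulr1; apply: cid_notin; rewrite inE.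
    by apply: contra KD => /dD; apply; apply/subsetP => v; rewrite !inE => ->; case: (v == i); case: (v == j).
  have KD' : old K :\: tau \notin star D tau.
    rewrite inE; apply: contra KD => /dD; apply; apply/subsetP => v; rewrite !inE.
    by case: (v == i); case: (v == j); rewrite ?orbT//= orbF => ->.
  rewrite /J P0e P1e E0 E1; split.
    rewrite mulrzAr; apply/cidN/cidMz; rewrite mulrN -xs_tau -xsU; last first.
      by rewrite disjoint_sym -setI_eq0 setDE -setIA [~: _ :&: _]setIC setICr setI0.
    by apply: cidN; rewrite -[xs _]mulr1; apply: cid_notin; move: KD'; rewrite inE setUC.
  apply: cid_add; last first.
    by rewrite mulrzAr; apply: cidMz; rewrite mulrN mulrC; apply/cidN/cid_notin.
  rewrite -[xs _]mulr1; apply: cid_notin; rewrite inE; apply: contra KD => /dD; apply.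
  by rewrite setUC.
pose deg' p := deg (P0 p).
have deg'D p q : deg' (p + q) = deg' p + deg' q by rewrite /deg' P0D degD.
have xs_disj s : [disjoint s & tau] -> xs (up s) = pull (xs s) by move=> ds; rewrite pullback_xs_disjoint.
have core_in K : K \in D' -> core i j K \in D by rewrite inE => /andP[].
have disjC s : s :&: tau = set0 -> [disjoint s & tau] by move=> h; rewrite -setI_eq0 h.
have cases K : K \in D' -> old K :&: tau = set0 \/
    exists l k, [/\ old K :&: tau = [set l], tau = [set l; k], l != k & yi * yj = mvar l * mvar k].
  rewrite inE => /andP[]; rewrite subUset !sub1set negb_and => h _.
  have [iK|iK] := boolP (i \in old K); have [jK|jK] := boolP (j \in old K).
  - by rewrite iK jK in h.
  - right; exists i, j; split=> //; apply/setP => v; rewrite !inE.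
    have [->|vi] := eqVneq v i; first by rewrite -in_old iK.
    by have [->|vj] := eqVneq v j; rewrite ?andbF//= -in_old (negPf jK).
  - right; exists j, i; rewrite eq_sym mulrC setUC; split=> //; apply/setP => v; rewrite !inE.
    have [->|vi] := eqVneq v j; first by rewrite -in_old jK.
    by have [->|vj] := eqVneq v i; rewrite ?andbF//= -in_old (negPf iK).
  left; apply/setP => v; rewrite !inE.
  have [->|vi] := eqVneq v i; first by rewrite -in_old (negPf iK).
  by have [->|vj] := eqVneq v j; rewrite ?andbF//= -in_old (negPf jK).
(* On the star of a cone containing the other ray of tau, the strict transform of k vanishes, so e
   equals the total transform of k. *)
pose th k : {rmorphism mpoly r.+1 -> mpoly r} :=
  meval (ext (mvar k) (fun v => mvar v - (if v \in tau then mvar k else 0))).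
have th_e k : th k e = mvar k by rewrite /th meval_var ext0.
have th_pull k a : th k (pull a) = a.
  have := meval_ext (f := th k \o pull) (g := idfun); apply => v.
  change (th k (pull (mvar v)) = mvar v); rewrite pullback_var rmorphD /th meval_var extS.
  by case: ifP => _; rewrite ?meval_var ?ext0 ?rmorph0 ?subr0 ?addr0 ?subrK.
have thE k p : k \in tau -> th k p = P0 p + mvar k * P1 p.
  move=> kt; have [q E] := dec p; rewrite {1}E !rmorphD !rmorphM !th_pull th_e.
  have -> : th k xi * th k xj = 0.
    rewrite /th !meval_var !extS !inE !eqxx orbT /=.
    by move: kt; rewrite !inE => /orP[] /eqP ->; rewrite subrr ?mul0r ?mulr0.
  by rewrite mulr0 addr0 mulrC.
have P0l K l k p : K \in D' -> old K :&: tau = [set l] -> tau = [set l; k] -> l != k ->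
    yi * yj = mvar l * mvar k -> P0 (xs K * p) = xs (core i j K) * th k p.
  move=> KD sl tlk lk yy; have lt : l \in tau by rewrite tlk !inE eqxx.
  have kt : k \in tau by rewrite tlk !inE eqxx orbT.
  have lK : l \in old K by have := set11 l; rewrite -sl inE => /andP[].
  have kK : k \notin old K.
    apply/negP => kK; have : k \in old K :&: tau by rewrite inE kK kt.
    by rewrite sl inE eq_sym (negPf lk).
  have key q : P0 (xs (up (old K)) * q) = xs (old K) * th k q.
    rewrite (xs_pull lt sl) -mulrA mulrBl (additiveB P0D) P0e yy !P0M P1M (thE _ _ kt).
    have -> : xs (old K) = mvar l * xs (old K :\ l) by rewrite -xsU1 ?inE ?eqxx// setD1K.
    ring.
  rewrite xs_old /core; case: ifP => _; last by rewrite mul1r set0U key.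
  rewrite -mulrA [e * _]mulrC -mulrA [p * e]mulrC key rmorphM th_e mulrA; congr (_ * _).
  rewrite mulrC -xsU1//; congr xs; apply/setP => v; rewrite tlk !inE.
  by have [->|] := eqVneq v l; rewrite ?orbT//= -in_old lK orbT.
have P0n K p : old K :&: tau = set0 ->
    P0 (xs K * p) = if ord0 \in K then - (xs (core i j K) * P1 p) else xs (core i j K) * P0 p.
  move=> /disjC dK; rewrite xs_old /core xs_disj//; case: ifP => _; last by rewrite set0U mul1r P0M.
  rewrite -mulrA P0e P1M setUC xsU// xs_tau; ring.
have card_core K : K \in D' -> deg' (xs K) = (#|K| == d)%:Z.
  move=> KD; rewrite /deg' -[xs K]mulr1; have [K0|[l [k [sl tlk lk yy]]]] := cases K KD.
    rewrite P0n// card_old; case: ifP => o0.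
      rewrite P11 mulr0 oppr0 (additive0 degD); case: eqP => // cd.
      have := Dd _ (core_in K KD); rewrite /core o0 setUC cardsU K0 cards0 subn0 cards2 ij; lia.
    rewrite P01 mulr1 deg1 ?core_in// /core o0 set0U; congr (_ == _)%:Z; lia.
  rewrite (P0l K l k)// rmorph1 mulr1 deg1 ?core_in//; congr ((_ == _)%:Z).
  rewrite card_old /core; case: ifP => _; last by rewrite set0U; lia.
  by rewrite setUC cardsU sl cards1 cards2 ij; lia.
have star_core K p : cid (star D (core i j K)) u p -> cid (star D' K) u' (pull p) by apply: cid_pullback.
have xij K : cid (star D' K) u' (xi * xj) by apply: cid_xij.
split; first split=> K KD.
- apply: leq_trans (Dd _ (core_in K KD)); rewrite card_old /core.
  have [K0|[l [k [sl tlk lk yy]]]] := cases K KD; case: ifP => _; rewrite ?set0U ?add0n//.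
    by rewrite setUC cardsU K0 cards0 cards2 ij; lia.
  by rewrite setUC cardsU sl cards1 cards2 ij; lia.
- have [s sD sd] := Dex _ (core_in K KD).
  have [ts|ts] := boolP (tau \subset s); last first.
    exists (up s); first by rewrite inE /core old_up (negPf (ord0_up s)) ts set0U.
    by rewrite card_old old_up (negPf (ord0_up s)).
  move: (ts); rewrite subUset !sub1set => /andP[is_ js].
  exists (ord0 |: up (s :\ j)); last first.
    by rewrite card_old !inE eqxx oldU old0 set0U old_up /= -sd (cardsD1 j s) js.
  rewrite inE /core !inE eqxx /= oldU old0 set0U old_up subUset !sub1set !inE eqxx andbF /=.
  congr (_ \in D): sD; apply/setP => v; rewrite !inE.
  have [->|vi] := eqVneq v i; first by rewrite is_.
  by have [->|vj] := eqVneq v j; rewrite ?js ?andbF//.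
exists deg'.
  split=> // p Ip; exact: (deg0 _ (Jcid p Ip).1).
move=> K KD; have [K0|[l [k [sl tlk lk yy]]]] := cases K KD; last first.
  have kt : k \in tau by rewrite tlk !inE eqxx orbT.
  apply: (@dualizing_transfer _ _ _ _ _ _ _ _ _ _ (th k) pull (star_core K) _ _ _ (ker _ (core_in K
    KD))) => [p|//|p].
    have [q E] := dec p; rewrite (thE _ _ kt) rmorphD rmorphM /ceq {1}E.
    have -> : pull (P0 p) + pull (P1 p) * e + q * (xi * xj) - (pull (P0 p) + pull (mvar k) * pull (P1 p)) =
       q * (xi * xj) - pull (P1 p) * mvar (lift ord0 k) by rewrite pullback_var kt; ring.
    apply: cidB; apply: cidM; first exact: xij.
    rewrite -xs1 -[xs _]mulr1; apply: cid_notin; rewrite !inE negb_and negbK; apply/orP; left.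
    rewrite tlk subUset !sub1set !in_old !inE eqxx orTb andbT.
    by have := set11 l; rewrite -sl inE in_old => /andP[-> _]; rewrite orbT.
  by rewrite /deg' (P0l K l k).
have dec' p : ceq (star D' K) u' p (pull (P0 p) + e * pull (P1 p)).
  have [q E] := dec p; rewrite /ceq {1}E addrAC [pull (P1 p) * e]mulrC subrr add0r.
  exact/cidM/xij.
have [ks ksP] := ker _ (core_in K KD).
have pull_ks p : ceq (star D' K) u' (pull p) (\sum_(ab <- ks) pull ab.2 *~ deg (xs (core i j K) * (p * ab.1))).
  have := star_core K _ (ksP p); rewrite rmorphB rmorph_sum; congr (cid _ _ (_ - _)).
  by apply: eq_bigr => ab _; rewrite rmorphMz mulrA.
have [o0|o0] := boolP (ord0 \in K).
  (* In the basis 1, e the functional -P1 has Gram matrix [[0,-1],[-1,-S]], since [P1 (e * e)] is S.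
     The three families below are the nonzero entries of the inverse matrix [[S,-1],[-1,0]]. *)
  pose S := yi + yj; set sg := core i j K.
  have FE p : deg' (xs K * p) = - deg (xs sg * P1 p) by rewrite /deg' P0n// o0 (additiveN degD).
  exists ([seq (e * pull ab.1, - pull ab.2) | ab <- ks] ++
    ([seq (pull (S * ab.1), pull ab.2) | ab <- ks] ++ [seq (pull ab.1, - (e * pull ab.2)) | ab <- ks])) => p.
  apply: ceq_trans (dec' p) _; apply: ceq_trans (ceqD (pull_ks (P0 p)) (ceqM e (pull_ks (P1 p)))) _.
  rewrite !big_cat !big_map /= addrA -big_split mulr_sumr.
  rewrite (eq_bigr (fun ab => (- pull ab.2) *~ deg' (xs K * (p * (e * pull ab.1))) +
     pull ab.2 *~ deg' (xs K * (p * pull (S * ab.1))))) => [|ab _]; last first.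
    rewrite !FE [p * (e * _)]mulrCA. rewrite P1e ![p * pull _]mulrC P0M !P1M.
    rewrite mulNrz mulrNz opprK mulrNz -mulrzBr -(additiveB degD); congr (_ *~ deg _).
    by rewrite /S; ring.
  rewrite [X in ceq _ _ (_ + X)](eq_bigr (fun ab => - (e * pull ab.2) *~ deg' (xs K * (p * pull
    ab.1)))) => [|ab _].
    exact: ceq_refl.
  by rewrite FE [p * pull _]mulrC P1M mulNrz mulrNz opprK mulrzAr [P1 p * _]mulrC.
have FE p : deg' (xs K * p) = deg (xs (core i j K) * P0 p) by rewrite /deg' P0n// (negPf o0).
have cE : core i j (ord0 |: K) = tau :|: core i j K.
  by rewrite /core !inE eqxx (negPf o0) /= set0U oldU old0 set0U.
have eK q : cid (star D' (ord0 |: K)) u' q -> cid (star D' K) u' (e * q).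
  by rewrite -xs1; apply: cid_star_xs; apply: blowup_dclosed.
(* If K and tau lie in no common cone, e vanishes on the star of K and the first summand is
   everything. Otherwise 1 and e are orthogonal, and [e * e] pairs to minus the degree on the star
   of [tau :|: core i j K]. *)
have [cD|cD] := boolP (core i j (ord0 |: K) \in D); last first.
  exists [seq (pull ab.1, pull ab.2) | ab <- ks] => p.
  apply: ceq_trans (dec' p) _; rewrite -[X in ceq _ _ _ X]addr0; apply: ceqD.
    apply: ceq_trans (pull_ks (P0 p)) _; rewrite big_map.
    rewrite (eq_bigr (fun ab => pull ab.2 *~ deg' (xs K * (p * pull ab.1)))) => [|ab _].
      exact: ceq_refl.
    by rewrite FE [p * pull _]mulrC P0M [P0 p * _]mulrC.
  apply: ceq0; rewrite -xs1; apply: cid_notin; rewrite inE; apply: contra cD.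
  by rewrite inE => /andP[].
have [ks2 ks2P] := ker _ cD.
exists ([seq (pull ab.1, pull ab.2) | ab <- ks] ++ [seq (e * pull ab.1, - (e * pull ab.2)) | ab <- ks2]) => p.
apply: ceq_trans (dec' p) _; rewrite big_cat !big_map; apply: ceqD.
  apply: ceq_trans (pull_ks (P0 p)) _.
  rewrite (eq_bigr (fun ab => pull ab.2 *~ deg' (xs K * (p * pull ab.1)))) => [|ab _].
    exact: ceq_refl.
  by rewrite FE [p * pull _]mulrC P0M [P0 p * _]mulrC.
have := eK _ (cid_pullback ij dD (ks2P (P1 p))); rewrite rmorphB mulrBr rmorph_sum mulr_sumr.
congr (cid _ _ (_ - _)); apply: eq_bigr => ab _; rewrite rmorphMz mulrzAr FE.
rewrite [p * (e * _)]mulrCA P0e [p * _]mulrC P1M mulrN (additiveN degD) mulNrz mulrNz opprK.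
congr (_ *~ deg _); rewrite cE xsU; last first.
  by rewrite disjoint_sym /core (negPf o0) set0U disjC.
by rewrite xs_tau; ring.
Qed.
End BlowupHPD.

Section FanBlowup.
Variables (n : nat) (T : 'rV[int]_n -> Prop).
Variables (r : nat) (D : {set {set 'I_r}}) (u : 'I_r -> 'rV[int]_n) (i j : 'I_r).
Hypotheses (ij : i != j) (F : fan T D u).
Local Notation tau := [set i; j].
Local Notation D' := (blowup D i j).
Local Notation u' := (ublow u i j).

Lemma comb_ublow (c : 'I_r.+1 -> nat) :
  comb u' c = comb u (fun v => c (lift ord0 v) + (v \in tau) * c ord0)%N.
Proof.
rewrite /comb sum_ext /ublow ext0; under eq_bigr => v _ do rewrite extS.
under [RHS]eq_bigr => v _ do rewrite mulrnDr.
rewrite big_split /= addrC; congr (_ + _).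
rewrite (bigD1 i)//= (bigD1 j)//= ?(eq_sym j)// big1 => [|v /andP[vi vj]].
  by rewrite !inE !eqxx orbT !mul1n addr0 mulrnDl.
by rewrite !inE (negPf vi) (negPf vj) mul0n mulr0n.
Qed.

Lemma core_supp (c : 'I_r.+1 -> nat) :
  core i j (supp c) = supp (fun v => c (lift ord0 v) + (v \in tau) * c ord0)%N.
Proof.
apply/setP => v; rewrite /core !inE; case: ifP => h; rewrite !inE.
  by case: ((v == i) || (v == j)) => /=; lia.
by move/negbFE/eqP: h => ->; rewrite muln0 addn0.
Qed.

Lemma fan_blowup : fan T D' u'.
Proof.
split.
- exact: blowup_dclosed (fan_dc F).
- move=> s k sD ks; suff intp (f : 'I_r.+1 -> int) :
      exists m, forall w, w \in s -> pairing m (u' w) = f w.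
    have [m mP] := intp (fun w => (w == k)%:Z); exists m; split; first by rewrite mP// eqxx.
    by move=> l ls /negPf lk; rewrite mP// lk.
  move: sD; rewrite inE => /andP[ts]; rewrite /core; case: ifP => [o0 cD|o0]; last first.
    rewrite set0U => oD; have [m mP] := unimodular_interp (fan_uni F) (fun v => f (lift ord0 v)) oD.
    exists m => w ws; case: (unliftP ord0 w) ws => [v ->|->]; last by rewrite o0.
    by rewrite -in_old /ublow extS => /mP.
  pose g v := if v \in old s then f (lift ord0 v) else 0.
  (* Some ray [k0] of tau is absent from s; its value is free and is chosen so that [u i + u j]
     receives [f ord0]. *)
  have [k0 [l0 [k0s tkl kl uij]]] : exists k0 l0, [/\ k0 \notin old s, tau = [set k0; l0],
      k0 != l0 & u i + u j = u k0 + u l0].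
    move: ts; rewrite subUset !sub1set negb_and => /orP[h|h]; first by exists i, j.
    by exists j, i; rewrite eq_sym setUC addrC.
  pose f' v := if v == k0 then f ord0 - g l0 else g v.
  have [m mP] := unimodular_interp (fan_uni F) f' cD.
  exists m => w ws; case: (unliftP ord0 w) ws => [v ->|-> _].
    rewrite -in_old /ublow extS => vs; rewrite mP 1?in_setU 1?vs ?orbT// /f' /g vs.
    by case: eqP => // vk; move: k0s; rewrite -vk vs.
  rewrite /ublow ext0 uij pairingDr !mP; try by rewrite tkl !inE eqxx ?orbT.
  by rewrite /f' eqxx eq_sym (negPf kl) subrK.
- move=> c; rewrite inE => /andP[_ cD]; rewrite comb_ublow; apply: (fan_in F).
  by rewrite -core_supp.
- move=> x Tx; have [c cD cE] := fan_ex F Tx.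
  pose k := minn (c i) (c j).
  pose c' := ext k (fun v => c v - (v \in tau) * k)%N.
  have kc v : ((v \in tau) * k <= c v)%N.
    rewrite !inE; case: eqP => [->|_] /=; first by rewrite mul1n geq_minl.
    by case: eqP => [->|_]; rewrite ?mul0n// mul1n geq_minr.
  have cc' : (fun v => c' (lift ord0 v) + (v \in tau) * c' ord0)%N =1 c.
    by move=> v; rewrite /c' ext0 extS subnK.
  exists c'; last by rewrite comb_ublow -cE /comb; apply: eq_bigr => v _; rewrite cc'.
  rewrite inE core_supp; apply/andP; split.
    rewrite subUset !sub1set !inE /c' !extS !inE !eqxx orbT !mul1n /k; lia.
  by congr (_ \in D): cD; apply/setP => v; rewrite inE [in RHS]inE cc'.
move=> c c'; rewrite !inE => /andP[tc cD] /andP[tc' c'D]; rewrite !comb_ublow => E.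
rewrite !core_supp in cD c'D.
have cc := fan_inj F cD c'D E.
have e0 : c ord0 = c' ord0.
  have := cc i; have := cc j; rewrite !inE !eqxx orbT !mul1n.
  move: tc tc'; rewrite !subUset !sub1set !inE; lia.
move=> w; case: (unliftP ord0 w) => [v|] -> //.
by have := cc v; rewrite e0; apply: addIn.
Qed.

End FanBlowup.

(** * Common refinements *)

(** The hyperplane of m cuts through no cone. Testing pairs suffices ([unmixed_sign]), and a
    violating pair is a two-dimensional cone to blow up. *)
Definition unmixed r n (D : {set {set 'I_r}}) (u : 'I_r -> 'rV[int]_n) (m : 'rV[int]_n) :=
  forall a b, [set a; b] \in D -> ~ (0 < pairing m (u a) /\ pairing m (u b) < 0).

Section Subdivide.
Variables (n : nat) (T : 'rV[int]_n -> Prop).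
Variable P : forall r, {set {set 'I_r}} -> ('I_r -> 'rV[int]_n) -> Prop.
Hypothesis PB : forall r (D : {set {set 'I_r}}) u i j, i != j -> [set i; j] \in D ->
  fan T D u -> P D u -> P (blowup D i j) (ublow u i j).

Lemma pair_sub r (D : {set {set 'I_r}}) (s : {set 'I_r}) a b :
  dclosed D -> s \in D -> a \in s -> b \in s -> [set a; b] \in D.
Proof. by move=> dD sD as_ bs; apply: dD sD _; rewrite subUset !sub1set as_ bs. Qed.

Lemma unmixed_blowup r (D : {set {set 'I_r}}) (u : 'I_r -> 'rV[int]_n) i j m : dclosed D ->
  unmixed D u m -> unmixed (blowup D i j) (ublow u i j) m.
Proof.
move=> dD um a b; rewrite inE => /andP[_ cD].
have inc v : lift ord0 v \in [set a; b] -> v \in core i j [set a; b].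
  by move=> vab; rewrite inE in_old vab orbT.
have o0 : ord0 \in [set a; b] -> i \in core i j [set a; b] /\ j \in core i j [set a; b].
  by move=> h; rewrite /core h !inE !eqxx !orbT.
have pr v w : v \in core i j [set a; b] -> w \in core i j [set a; b] ->
    ~ (0 < pairing m (u v) /\ pairing m (u w) < 0).
  by move=> vc wc; apply: um; apply: pair_sub cD _ _.
move: inc o0 pr; case: (unliftP ord0 a) => [x|] ->; case: (unliftP ord0 b) => [y|] ->.
- by move=> inc _ pr; rewrite /ublow !extS; apply: pr; apply: inc; rewrite !inE eqxx ?orbT.
- move=> inc o0 pr; rewrite /ublow extS ext0 pairingDr.
  have [|ic jc] := o0; first by rewrite !inE eqxx orbT.
  have xc : x \in core i j [set lift ord0 x; ord0] by apply: inc; rewrite !inE eqxx.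
  have := pr x i xc ic; have := pr x j xc jc; lia.
- move=> inc o0 pr; rewrite /ublow extS ext0 pairingDr.
  have [|ic jc] := o0; first by rewrite !inE eqxx.
  have yc : y \in core i j [set ord0; lift ord0 y] by apply: inc; rewrite !inE eqxx orbT.
  have := pr i y ic yc; have := pr j y jc yc; lia.
move=> _ _ _; lia.
Qed.

Definition mixed_diff r (u : 'I_r -> 'rV[int]_n) m (ab : 'I_r * 'I_r) :=
  pairing m (u ab.1) - pairing m (u ab.2).
Definition mixed r (D : {set {set 'I_r}}) (u : 'I_r -> 'rV[int]_n) m : {set 'I_r * 'I_r} :=
  [set ab | [&& [set ab.1; ab.2] \in D, 0 < pairing m (u ab.1) & pairing m (u ab.2) < 0]].

(* Subdividing a pair with maximal difference only creates pairs with smaller difference. *)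
Lemma subdivide1 m r (D : {set {set 'I_r}}) u : fan T D u -> P D u ->
  exists r' (D' : {set {set 'I_r'}}) u', [/\ fan T D' u', P D' u', unmixed D' u' m &
    forall m', unmixed D u m' -> unmixed D' u' m'].
Proof.
(* Lexicographic induction on a bound B for the differences of mixed pairs and on the number of
   pairs attaining B. *)
suff main (B N : nat) r0 (D0 : {set {set 'I_r0}}) u0 : fan T D0 u0 -> P D0 u0 ->
    (forall ab, ab \in mixed D0 u0 m -> mixed_diff u0 m ab <= B%:Z) ->
    (#|[set ab in mixed D0 u0 m | mixed_diff u0 m ab == B%:Z]| <= N)%N ->
    exists r' (D' : {set {set 'I_r'}}) u', [/\ fan T D' u', P D' u', unmixed D' u' m &
    forall m', unmixed D0 u0 m' -> unmixed D' u' m'].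
  move=> F PD; apply: (main (\sum_(ab in mixed D u m) `|mixed_diff u m ab|)%N _ _ _ _ F PD) (leqnn _).
  move=> ab h; rewrite (bigD1 ab)//= PoszD; have : 0 <= (\sum_(i in mixed D u m | i != ab) `|mixed_diff
    u m i|)%N%:Z by [].
  have := ler_norm (mixed_diff u m ab); rewrite -abszE; lia.
elim: B N r0 D0 u0 => [|B IHB] N r0 D0 u0.
  move=> F PD h _; exists r0, D0, u0; split=> // a b abD [pa pb].
  have := h (a, b); rewrite inE abD pa pb /mixed_diff /= => /(_ isT); lia.
elim: N r0 D0 u0 => [|N IHN] r0 D0 u0 F PD hB.
  rewrite leqn0 cards_eq0 => /eqP h0; apply: (IHB _ r0 D0 u0 F PD _ (leqnn _)) => ab abM.
  have := hB ab abM; suff : mixed_diff u0 m ab != B.+1%:Z by lia.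
  by apply/negP => E; have := in_set0 ab; rewrite -h0 inE abM E.
have [none|[[i j]]] := set_0Vmem [set ab in mixed D0 u0 m | mixed_diff u0 m ab == B.+1%:Z].
  by move=> _; apply: IHN; rewrite // none cards0.
rewrite inE => /andP[ijM /eqP ijB] cN; move: (ijM); rewrite inE => /and3P[ijD /= mi mj].
have ij : i != j by apply/eqP => ij; move: mi mj; rewrite ij; lia.
set D1 := blowup D0 i j; set u1 := ublow u0 i j.
have F1 : fan T D1 u1 by apply: fan_blowup.
have uS v : u1 (lift ord0 v) = u0 v by rewrite /u1 /ublow extS.
have ue : pairing m (u1 ord0) = pairing m (u0 i) + pairing m (u0 j).
  by rewrite /u1 /ublow ext0 pairingDr.
have coreD a b : [set a; b] \in D1 -> core i j [set a; b] \in D0 by rewrite inE => /andP[].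
(* Mixed pairs involving the new ray have a smaller difference, because its value lies strictly
   between those at j and i; the pair (i, j) itself is gone. *)
have new ab : ab \in mixed D1 u1 m ->
    (exists2 cd, cd \in mixed D0 u0 m & cd != (i, j) /\ ab = (lift ord0 cd.1, lift ord0 cd.2)) \/
    mixed_diff u1 m ab < B.+1%:Z.
  case: ab => a b; rewrite inE /= => /and3P[abD].
  have cD := coreD a b abD; have pr v w := pair_sub (fan_dc F) cD (a := v) (b := w).
  have bound v w : v \in core i j [set a; b] -> w \in core i j [set a; b] ->
      0 < pairing m (u0 v) -> pairing m (u0 w) < 0 -> pairing m (u0 v) - pairing m (u0 w) <= B.+1%:Z.
    by move=> vc wc v0 w0; apply: (hB (v, w)); rewrite inE /= v0 w0 pr.
  move: ijB; rewrite /mixed_diff /= => ijB.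
  have inc v : lift ord0 v \in [set a; b] -> v \in core i j [set a; b].
    by move=> vab; rewrite inE in_old vab orbT.
  have o0 : ord0 \in [set a; b] -> i \in core i j [set a; b] /\ j \in core i j [set a; b].
    by move=> h; rewrite /core h !inE !eqxx !orbT.
  move: abD bound inc o0; case: (unliftP ord0 a) => [x|] ->; case: (unliftP ord0 b) => [y|] -> abD bound inc o0.
  - rewrite !uS => x0 y0; left; exists (x, y).
      have xc : x \in core i j [set lift ord0 x; lift ord0 y] by apply: inc; rewrite !inE eqxx.
      have yc : y \in core i j [set lift ord0 x; lift ord0 y] by apply: inc; rewrite !inE eqxx orbT.
      by rewrite inE /= x0 y0 (pair_sub (fan_dc F) (coreD _ _ abD) xc yc).
    split=> //; apply: contraTneq abD => -[-> ->]; rewrite inE negb_and negbK; apply/orP; left.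
    by rewrite subUset !sub1set !in_old !inE !eqxx orbT.
  - rewrite uS ue => x0 y0; right; have [|ic jc] := o0; first by rewrite !inE eqxx orbT.
    have xc : x \in core i j [set lift ord0 x; ord0] by apply: inc; rewrite !inE eqxx.
    by have := bound x j xc jc x0 mj; lia.
  - rewrite uS ue => x0 y0; right; have [|ic jc] := o0; first by rewrite !inE eqxx.
    have yc : y \in core i j [set ord0; lift ord0 y] by apply: inc; rewrite !inE eqxx orbT.
    by have := bound i y ic yc mi y0; lia.
  by rewrite ue; lia.
have [|||r' [D' [u' [F' PD' um um']]]] := IHN _ D1 u1 F1.
- exact: PB.
- move=> ab /new [[cd cdM [_ ->]]|/ltW//]; rewrite /mixed_diff !uS; exact: hB.
- rewrite -ltnS; apply: leq_trans cN; rewrite [X in (_ < X)%N](cardsD1 (i, j)) inE ijM ijB eqxx add1n ltnS.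
  pose L (cd : 'I_r0 * 'I_r0) := (lift ord0 cd.1, lift ord0 cd.2).
  apply: leq_trans (leq_imset_card L _); apply: subset_leq_card; apply/subsetP => ab.
  rewrite inE => /andP[/new [[cd cdM [cdn ->]]|lt] /eqP E]; last by rewrite E ltxx in lt.
  by apply/imsetP; exists cd => //; rewrite !inE cdn -E /mixed_diff !uS eqxx andbT; move: cdM; rewrite inE.
exists r', D', u'; split=> // m' h; apply: um'; apply: unmixed_blowup h; exact: (fan_dc F).
Qed.

Lemma subdivide (ms : seq 'rV[int]_n) r (D : {set {set 'I_r}}) u : fan T D u -> P D u ->
  exists r' (D' : {set {set 'I_r'}}) u', [/\ fan T D' u', P D' u' &
    forall m, m \in ms -> unmixed D' u' m].
Proof.
move=> F PD; elim: ms => [|m ms [r1 [D1 [u1 [F1 P1 um1]]]]]; first by exists r, D, u.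
have [r2 [D2 [u2 [F2 P2 um2 um2']]]] := subdivide1 m F1 P1.
exists r2, D2, u2; split=> // m'; rewrite inE => /orP[/eqP -> //|/um1]; exact: um2'.
Qed.

End Subdivide.

Section Coherent.
Variables (n : nat) (r : nat) (D : {set {set 'I_r}}) (u : 'I_r -> 'rV[int]_n).
Hypothesis dD : dclosed D.

Lemma unmixed_sign m t : unmixed D u m -> t \in D ->
  (forall v, v \in t -> 0 <= pairing m (u v)) \/ (forall v, v \in t -> pairing m (u v) <= 0).
Proof.
move=> um tD; have [[a [at_ a0]]|none] := classic (exists a, a \in t /\ pairing m (u a) < 0).
  right=> v vt; rewrite leNgt; apply/negP => v0; apply: (um v a) => //.
  exact: pair_sub tD vt at_.
by left=> v vt; rewrite leNgt; apply/negP => v0; apply: none; exists v.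
Qed.

Lemma pairing_bary m t : pairing m (bary u t) = \sum_(v in t) pairing m (u v).
Proof.
rewrite pairing_combz [RHS]big_mkcond; apply: eq_bigr => v _.
by case: ifP; rewrite ?mulr1 ?mulr0.
Qed.

Lemma unmixed_ge0 m t : unmixed D u m -> t \in D ->
  0 < pairing m (bary u t) -> forall v, v \in t -> 0 <= pairing m (u v).
Proof.
move=> um tD; rewrite pairing_bary => b0; have [//|np] := unmixed_sign um tD.
have : \sum_(v in t) pairing m (u v) <= 0 by apply: sumr_le0.
by rewrite leNgt b0.
Qed.

Lemma unmixed_eq0 m t : unmixed D u m -> t \in D ->
  pairing m (bary u t) = 0 -> forall v, v \in t -> pairing m (u v) = 0.
Proof.
move=> um tD; rewrite pairing_bary => b0; have [p|p] := unmixed_sign um tD => v vt.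
  by apply: (psumr_eq0P p b0).
apply/eqP; rewrite -oppr_eq0; apply/eqP; move: v vt; apply: psumr_eq0P => [v vt|].
  by rewrite oppr_ge0 p.
by rewrite sumrN b0 oppr0.
Qed.

Lemma bary_combE (t : {set 'I_r}) : bary u t = comb u (fun v => v \in t).
Proof. by rewrite combzE; apply: combz_eq. Qed.

Lemma supp_mem (t : {set 'I_r}) : supp (fun v : 'I_r => (v \in t : nat)) = t.
Proof. by apply/setP => v; rewrite inE; case: (v \in t). Qed.

End Coherent.

(** The functionals are the coordinates on each cone s of D and the residues [res] that cut out its
    span. If the barycentre of t lies in the relative interior of s, positive coordinates there are
    nonnegative on every ray of t and zero residues are zero on every ray, so all of t lies in s. *)
Lemma fan_refinement n (T : 'rV[int]_n -> Prop) r (D : {set {set 'I_r}}) u :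
  fan T D u -> exists ms : seq 'rV[int]_n, forall r' (D' : {set {set 'I_r'}}) u',
    fan T D' u' -> (forall m, m \in ms -> unmixed D' u' m) -> refines D' u' D u.
Proof.
move=> F.
have /fin_all_exists [m mP] (sk : {set 'I_r} * 'I_r) : exists m, sk.1 \in D ->
    forall i, i \in sk.1 -> pairing m (u i) = (i == sk.2)%:Z.
  case: sk => s k /=; case: (boolP (s \in D)) => sD; last by exists 0.
  by have [m mP] := unimodular_interp (fan_uni F) (fun i => (i == k)%:Z) sD; exists m.
pose res (sl : {set 'I_r} * 'I_n) := delta_mx 0 sl.2 - \sum_(k in sl.1) m (sl.1, k) *~ u k 0 sl.2.
exists ([seq m sk | sk <- enum {: {set 'I_r} * 'I_r}] ++ [seq res sl | sl <- enum {: {set 'I_r} * 'I_n}]).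
move=> r' D' u' F' um t tD.
have um1 sk : unmixed D' u' (m sk).
  by apply: um; rewrite mem_cat; apply/orP; left; apply: map_f; rewrite mem_enum.
have um2 sl : unmixed D' u' (res sl).
  by apply: um; rewrite mem_cat; apply/orP; right; apply: map_f; rewrite mem_enum.
have dD' := fan_dc F'.
have Tb : T (bary u' t) by rewrite bary_combE; apply: (fan_in F'); rewrite supp_mem.
have [c cD cb] := fan_ex F Tb; set s := supp c in cD; exists s => // v vt.
have mb k : k \in s -> pairing (m (s, k)) (bary u' t) = (c k)%:Z.
  move=> ks; rewrite -cb combzE pairing_combz (bigD1 k)//= (mP (s, k))//= eqxx mul1r.
  rewrite big1 ?addr0// => l lk; have [ls|ls] := boolP (l \in s).
    by rewrite (mP (s, k))//= (negPf lk) mul0r.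
  by move: ls; rewrite inE negbK => /eqP ->; rewrite mulr0.
have m0 k : k \in s -> 0 <= pairing (m (s, k)) (u' v).
  move=> ks; apply: (unmixed_ge0 dD' (um1 (s, k)) tD) => //.
  by rewrite mb// ltz_nat lt0n; move: ks; rewrite inE.
have resE l x : pairing (res (s, l)) x = x 0 l - \sum_(k in s) pairing (m (s, k)) x * u k 0 l.
  rewrite pairingBl pairing_delta pairing_suml; congr (_ - _); apply: eq_bigr => k _.
  by rewrite pairingMzl /= -mulrzr intz.
have r0 l : pairing (res (s, l)) (u' v) = 0.
  apply: (unmixed_eq0 dD' (um2 (s, l)) tD) => //; rewrite resE.
  have -> : bary u' t 0 l = \sum_(k in s) u k 0 l *+ c k.
    rewrite -cb /comb summxE [RHS]big_mkcond; apply: eq_bigr => k _; rewrite mulmxnE.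
    by case: ifP => //; rewrite inE => /negbFE/eqP ->.
  apply/eqP; rewrite subr_eq0; apply/eqP; apply: eq_bigr => k ks.
  by rewrite mb// -mulr_natl natz.
exists (fun k => if k \in s then absz (pairing (m (s, k)) (u' v)) else 0%N).
  by apply/subsetP => k; rewrite inE; case: ifP.
apply/rowP => l; have := r0 l; rewrite resE => /eqP; rewrite subr_eq0 => /eqP ->.
rewrite /comb summxE [RHS]big_mkcond; apply: eq_bigr => k _; rewrite mulmxnE.
case: ifP => ks; last by rewrite mulr0n.
by rewrite -mulr_natl natz gez0_abs// m0.
Qed.

(* Any smooth fan on T can be refined by iterated blowups of any other one. *)
Theorem HPD_indep n (T : 'rV[int]_n -> Prop) r1 (D1 : {set {set 'I_r1}}) u1
    r2 (D2 : {set {set 'I_r2}}) u2 d :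
  fan T D1 u1 -> HPD D1 u1 d -> fan T D2 u2 -> HPD D2 u2 d.
Proof.
move=> F1 H1 F2; have [ms msP] := fan_refinement F2.
have [|r' [D' [u' [F' H' um]]]] := subdivide (P := fun r D u => HPD D u d) _ ms F1 H1.
  by move=> r D u i j ij tD F H; apply: HPD_blowup => //; apply: (fan_dc F).
exact: HPD_refines F2 F' (msP _ _ _ F' um) H'.
Qed.

Lemma pl_delta r i : pl (fun j => (j == i)%:Z) = mvar i :> mpoly r.
Proof.
rewrite /pl (bigD1 i)//= eqxx big1 ?addr0// => j /negPf ->.
by rewrite mulr0z.
Qed.

Lemma cid_mvar r n (D : {set {set 'I_r}}) (u : 'I_r -> 'rV[int]_n) (v : 'I_r) (p : mpoly r) :
  [set v] \notin D -> cid D u (mvar v * p).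
Proof. by move=> vD; rewrite -xs1; apply: cid_notin. Qed.

Lemma ceq_pl r n (D : {set {set 'I_r}}) (u : 'I_r -> 'rV[int]_n) f f' :
  (forall v, [set v] \in D -> f v = f' v) -> ceq D u (pl f) (pl f').
Proof.
move=> ff; rewrite /ceq -pl_is_additive; apply: cid_sum => v _.
have [vD|vD] := boolP ([set v] \in D); first by rewrite ff// subrr mulr0z; apply: cid0.
by apply: cidMz; rewrite -[mvar v]mulr1; apply: cid_mvar.
Qed.

(** * Tropical modifications *)

Section LinearPart.
Variables (r n : nat) (D : {set {set 'I_r}}) (u : 'I_r -> 'rV[int]_n).
Hypotheses (dD : dclosed D) (uD : unimodular D u).
Implicit Types (s t : {set 'I_r}) (p : mpoly r).

(* Degree-one part of p evaluated at c: a linear relation among the rays of the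
   star of s gives a functional on its Chow ring. *)
Definition linpart (c : 'I_r -> int) p : int :=
  (meval (fun v => (c v)%:P * 'X : {poly int}) p)`_1.

Lemma linpartD c p q : linpart c (p + q) = linpart c p + linpart c q.
Proof. by rewrite /linpart rmorphD coefD. Qed.

Lemma linpart_pl c f : linpart c (pl f) = \sum_v c v * f v.
Proof.
rewrite /pl (additive_sum (linpartD c)); apply: eq_bigr => v _.
by rewrite (additiveMz (linpartD c)) /linpart meval_var coefCM coefX mulr1 -mulrzr intz.
Qed.

(** Among face generators only single vertices have a linear part, and c vanishes at vertices
    outside the star; a linear generator evaluates to its pairing with [combz u c]. *)
Lemma linpart_cid c s p : s \in D -> (forall v, c v != 0 -> v |: s \in D) ->
  combz u c = 0 -> cid (star D s) u p -> linpart c p = 0.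
Proof.
move=> sD cs c0; elim=> [a K KD|a m|p1 p2 _ I1 _ I2]; last by rewrite linpartD I1 I2.
  have E : meval (fun v => (c v)%:P * 'X : {poly int}) (xs K) = (\prod_(v in K) c v)%:P * 'X^#|K|.
    rewrite rmorph_xs (eq_bigr _ (fun v _ => meval_var _ v)) big_split /= rmorph_prod.
    by rewrite prodr_const.
  rewrite /linpart rmorphM E mulrA coefMXn; case: ifP => // K1.
  have [K0|[v vK]] := set_0Vmem K; first by move: KD; rewrite K0 inE set0U sD.
  have {K1 E} KE : K = [set v].
    apply/eqP; rewrite eq_sym eqEcard sub1set vK cards1; move: K1; lia.
  rewrite KE big_set1 cards1 subnn coefMC.
  have [->|/cs vD] := eqVneq (c v) 0; first by rewrite mulr0.
  by move: KD; rewrite KE inE vD.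
rewrite /linpart rmorphM rmorph_pl.
have -> : \sum_i meval (fun v => (c v)%:P * 'X : {poly int}) (mvar i) *~ pairing m (u i) = 0.
  transitivity ((\sum_i pairing m (u i) * c i)%:P * 'X : {poly int}).
    rewrite rmorph_sum mulr_suml; apply: eq_bigr => i _.
    by rewrite meval_var rmorphM /= -mulrzl -mulrA; congr (_ * _);
      rewrite -[in RHS](intz (pairing m (u i))) rmorph_int.
  by rewrite -pairing_combz c0 pairing0r mul0r.
by rewrite mulr0 coef0.
Qed.

(** A class killing every larger face behaves like a top-degree class on the star of s: any variable
    can be moved off s, where it dies. *)
Lemma cid_socle s (G : mpoly r) v : s \in D ->
  (forall w, w \notin s -> cid D u (xs (w |: s) * G)) -> cid D u (mvar v * (xs s * G)).
Proof.
move=> sD sG; have [m mP] := unimodular_interp uD (fun w => (w == v)%:Z) sD.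
have := ceq_pl_xs (s := set0) (K := s) D (u := u) (m := m) (f := fun w => (w == v)%:Z).
rewrite setU0 star0 pl_delta => /(_ mP) /(ceqMr G); rewrite mulrA => h; apply: ceq_cid h _.
rewrite mulr_suml; apply: cid_sum => w ws; rewrite mulrzAl; apply: cidMz; exact: sG.
Qed.

Lemma deg_socle d deg s (G a : mpoly r) : is_degree D u d deg -> s \in D ->
  (forall w, w \notin s -> cid D u (xs (w |: s) * G)) ->
  deg (xs s * (G * a)) = meval (fun=> 0 : int) a * deg (xs s * G).
Proof.
move=> [degD deg0 _] sD sG; elim/mpoly_mon_ind: a => [p q Ip Iq||v p Ip].
- by rewrite rmorphB mulrBl -Ip -Iq -(additiveB degD); congr deg; ring.
- by rewrite rmorph1 mul1r mulr1.
rewrite rmorphM meval_var !mul0r; apply: deg0.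
have -> : xs s * (G * (mvar v * p)) = p * (mvar v * (xs s * G)) by ring.
by apply: cidM; apply: cid_socle.
Qed.

Lemma deg_facet d deg s f : is_degree D u d deg -> s \in D -> #|s|.+1 != d ->
  deg (xs s * pl f) = 0.
Proof.
move=> [degD deg0 deg1] sD sd; have [m mP] := unimodular_interp uD f sD.
have := ceq_pl_xs (s := set0) (K := s) D (u := u) (m := m) (f := f).
rewrite setU0 star0 => /(_ mP) /deg0; rewrite (additiveB degD) mulrC => /eqP; rewrite subr_eq0 => /eqP ->.
rewrite (additive_sum degD) big1// => v vs; rewrite (additiveMz degD).
have [vD|vD] := boolP (v |: s \in D); first by rewrite deg1// cardsU1 vs add1n (negPf sd) mul0rz.
by rewrite deg0 ?mul0rz// -[xs _]mulr1; apply: cid_notin.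
Qed.

End LinearPart.

Section Modification.
Variables (r n : nat) (D D2 : {set {set 'I_r}}) (u : 'I_r -> 'rV[int]_n) (phi : 'I_r -> int).
Hypotheses (dD : dclosed D) (uD : unimodular D u) (dD2 : dclosed D2) (D2D : D2 \subset D).
Hypothesis phi_linear : forall s, s \in D -> s \notin D2 ->
  exists m, forall v, v |: s \in D -> phi v = pairing m (u v).
(** A local lattice relation on which phi takes the value -1: phi bends at s with multiplicity one,
    which is where unimodularity of the new pairing comes from. *)
Hypothesis phi_bends : forall s, s \in D2 -> exists c : 'I_r -> int,
  [/\ forall v, c v != 0 -> v |: s \in D, forall v, v \notin s -> 0 <= c v,
      combz u c = 0 & \sum_v c v * phi v = -1].
Implicit Types (s t : {set 'I_r}).

Lemma cid_phi s : s \in D -> s \notin D2 -> cid (star D s) u (pl phi).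
Proof.
move=> sD sD2; have [m mP] := phi_linear sD sD2.
apply: (@ceq_cid _ _ _ _ _ (pl (fun v => pairing m (u v)))); last by rewrite -[pl _]mul1r; apply: cid_lin.
by apply: ceq_pl => v; rewrite inE => /mP.
Qed.

Lemma cid_xs_phi s : s \notin D2 -> cid D u (xs s * pl phi).
Proof.
move=> sD2; have [sD|sD] := boolP (s \in D); last exact: cid_notin.
by rewrite -[D]star0; apply: cid_star_xs => //; rewrite setU0; apply: cid_phi.
Qed.

(** The relation c defines a functional on the ring of the star. Expanding by the Casimir element,
    it equals N times the degree on classes killed by every variable. As s is maximal in [D2],
    [pl phi] is such a class with value -1, so N and its degree are units; their signs follow from
    [N = c w], which is nonnegative for w off s. *)
Lemma deg_phi d deg s : is_degree D u d deg -> (forall t, t \in D -> #|t| <= d)%N -> s \in D2 ->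
  dualizing (star D s) u (fun p => deg (xs s * p)) ->
  (forall v, v \notin s -> v |: s \notin D2) ->
  d = #|s|.+1 /\ deg (xs s * pl phi) = -1.
Proof.
move=> degP Dd sD2 [ks ksP] smax; have [degD deg0 deg1] := degP.
have sD := subsetP D2D _ sD2; have [c [cs c0 cu cphi]] := phi_bends sD2.
pose N : int := \sum_(ab <- ks) linpart c ab.2 * meval (fun=> 0 : int) ab.1.
have cN G : (forall w, w \notin s -> cid D u (xs (w |: s) * G)) ->
    linpart c G = N * deg (xs s * G).
  move=> sG; have := linpart_cid sD cs cu (ksP G).
  rewrite (additiveB (linpartD c)) => /eqP; rewrite subr_eq0 => /eqP ->.
  rewrite (additive_sum (linpartD c)) /N mulr_suml; apply: eq_bigr => ab _.
  by rewrite (additiveMz (linpartD c)) (deg_socle uD ab.1 degP sD sG) -mulrzr intz mulrA.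
have Nphi : N * deg (xs s * pl phi) = -1.
  by rewrite -cN ?linpart_pl// => w ws; apply: cid_xs_phi; apply: smax.
have sd : #|s|.+1 = d.
  by apply/eqP; apply: contraT => sd; move: Nphi; rewrite (deg_facet uD phi degP sD sd) mulr0.
split=> //.
have [w ws wD] : exists2 w, w \notin s & w |: s \in D.
  apply: NNPP => none; have [m mP] := unimodular_interp uD phi sD.
  move: Nphi; have := ceq_pl_xs (s := set0) (K := s) D (u := u) (m := m) (f := phi).
  rewrite setU0 star0 => /(_ mP) /deg0; rewrite (additiveB degD) mulrC => /eqP.
  rewrite subr_eq0 => /eqP ->; rewrite (additive_sum degD) big1 ?mulr0// => v vs.
  rewrite (additiveMz degD) deg0 ?mul0rz// -[xs _]mulr1; apply: cid_notin.
  by apply/negP => vD; apply: none; exists v.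
(* In top dimension [mvar w] is also killed by every variable and has degree 1, so the functional
   takes the value N on it. *)
have cw : c w = N.
  have <- : linpart c (mvar w) = c w.
    rewrite -pl_delta linpart_pl (bigD1 w)//= eqxx mulr1 big1 ?addr0// => v /negPf ->.
    by rewrite mulr0.
  rewrite cN => [|v vs].
    by rewrite [xs s * _]mulrC -xsU1// deg1// cardsU1 ws add1n sd eqxx mulr1.
  have big t : (#|t| > d)%N -> cid D u (xs t).
    move=> td; rewrite -[xs _]mulr1; apply: cid_notin; apply/negP => /Dd; lia.
  have [->|vw] := eqVneq v w.
    rewrite mulrC -[xs _]mulr1; apply: cid_socle => // x xws; rewrite mulr1; apply: big.
    by rewrite !cardsU1 xws ws add1n add1n sd.
  rewrite mulrC -xsU1 ?inE ?negb_or 1?eq_sym ?vw//; apply: big.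
  by rewrite !cardsU1 !inE negb_or eq_sym vw vs ws /= !add1n sd.
suff fin (k x : int) : k * x = -1 -> 0 <= k -> x = -1 by apply: fin Nphi _; rewrite -cw c0.
move=> kx k0; have x0 : x < 0 by rewrite ltNge; apply/negP => x0; have := mulr_ge0 k0 x0; rewrite kx.
by have k1 : k != 0; [apply/eqP => k1; move: kx; rewrite k1 mul0r | nia].
Qed.

Variable g : 'I_n.
Implicit Types (K : {set 'I_r.+1}).
Hypothesis u_g : forall v, [set v] \in D -> u v 0 g = 0.

Definition modif : {set {set 'I_r.+1}} :=
  [set K : {set 'I_r.+1} | if ord0 \in K then old K \in D2 else old K \in D].
(* Graph of phi in the direction of the g-th coordinate, and the new ray. For ghosts the
   g-th coordinate is overwritten. *)
Definition umodif : 'I_r.+1 -> 'rV[int]_n :=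
  ext (delta_mx 0 g) (fun v => u v + delta_mx 0 g *~ (phi v - u v 0 g)).

Lemma pairing_deltar (m : 'rV[int]_n) : pairing m (delta_mx 0 g) = m 0 g.
Proof. by rewrite pairingC pairing_delta. Qed.

Lemma umodif0 m : pairing m (umodif ord0) = m 0 g.
Proof. by rewrite /umodif ext0 pairing_deltar. Qed.

Lemma umodifS m v : pairing m (umodif (lift ord0 v)) = pairing m (u v) + m 0 g * (phi v - u v 0 g).
Proof. by rewrite /umodif extS pairingDr pairingMzr pairing_deltar -[_ *~ _]mulrzr intz. Qed.

Lemma modif_dclosed : dclosed modif.
Proof.
move=> K L; rewrite !inE => KD LK; have oLK := oldS LK.
case: ifP KD => K0 KD; case: ifP => L0.
- exact: dD2 KD oLK.
- exact: (subsetP D2D _ (dD2 KD oLK)).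
- by rewrite (subsetP LK _ L0) in K0.
exact: dD KD oLK.
Qed.

Local Notation e := (mvar (@ord0 r)).

(** The coordinate g gives the relation [e + pl phi = 0], which eliminates the new variable. *)
Definition elim_e : {rmorphism mpoly r.+1 -> mpoly r} := meval (ext (- pl phi) (@mvar r)).
Definition incl : {rmorphism mpoly r -> mpoly r.+1} := meval (fun v => mvar (lift ord0 v)).

Lemma elim_xs K : elim_e (xs K) = (if ord0 \in K then - pl phi else 1) * xs (old K).
Proof.
rewrite xs_old rmorphM; congr (_ * _).
  by case: ifP => _; rewrite ?rmorph1// /elim_e meval_var ext0.
rewrite xs_up rmorph_prod; apply: eq_bigr => v _.
by rewrite /elim_e meval_var extS.
Qed.

Lemma incl_xs s : incl (xs s) = xs (up s).
Proof. by rewrite rmorph_xs xs_up; apply: eq_bigr => v _; rewrite /incl meval_var. Qed.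

Lemma elim_incl p : elim_e (incl p) = p.
Proof.
have := meval_ext (f := elim_e \o incl) (g := idfun); apply => v.
change (elim_e (incl (mvar v)) = mvar v).
by rewrite /incl meval_var /elim_e meval_var extS.
Qed.

Lemma incl_elim (D1 : {set {set 'I_r.+1}}) p : ceq D1 umodif p (incl (elim_e p)).
Proof.
elim/mpoly_mon_ind: p => [p q Ip Iq||w p Ip].
- rewrite /ceq !rmorphB; set a := incl _; set b := incl _.
  have -> : p - q - (a - b) = (p - a) - (q - b) by ring.
  exact: cidB.
- by rewrite !rmorph1; apply: ceq_refl.
rewrite !rmorphM; apply: ceq_trans (ceqM _ Ip) _; apply: ceqMr.
case: (unliftP ord0 w) => [v|] ->; rewrite /elim_e meval_var ?extS ?ext0.
  by rewrite /incl meval_var; apply: ceq_refl.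
rewrite rmorphN rmorph_pl /ceq opprK.
have -> : e + \sum_v incl (mvar v) *~ phi v = pl (fun w => pairing (delta_mx 0 g) (umodif w)).
  rewrite pl_ext umodif0 mxE !eqxx mulr1z; congr (_ + _); apply: eq_bigr => v _.
  by rewrite umodifS pairing_delta mxE !eqxx mul1r addrC subrK /incl meval_var.
by rewrite -[pl _]mul1r; apply: cid_lin.
Qed.

Lemma cid_elim p : cid modif umodif p -> cid D u (elim_e p).
Proof.
apply: cid_rmorph => [K|m]; rewrite ?elim_xs.
  rewrite inE; case: ifP => _ KD; last by rewrite mul1r -[xs _]mulr1; apply: cid_notin.
  by rewrite mulNr mulrC; apply/cidN/cid_xs_phi.
rewrite rmorph_pl sum_ext umodif0 /elim_e meval_var ext0 mulNrz.
under eq_bigr => v _ do rewrite meval_var extS umodifS.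
have -> : - (pl phi *~ m 0 g) + \sum_v mvar v *~ (pairing m (u v) + m 0 g * (phi v - u v 0 g)) =
    pl (fun v => pairing (m - delta_mx 0 g *~ m 0 g) (u v)).
  rewrite /pl mulrz_suml -sumrN -big_split /=; apply: eq_bigr => v _.
  rewrite -mulrzA -mulrNz -mulrzDr pairingBl pairingMzl pairing_delta; congr (_ *~ _).
  by rewrite -[_ *~ m 0 g]mulrzr intz; ring.
by rewrite -[pl _]mul1r; apply: cid_lin.
Qed.

Lemma cid_incl (D' : {set {set 'I_r}}) (D1 : {set {set 'I_r.+1}}) p : D1 \subset modif ->
  (forall s, s \notin D' -> up s \notin D1) ->
  cid D' u p -> cid D1 umodif (incl p).
Proof.
move=> D1m DD; apply: cid_rmorph => [s sD|m].
  by rewrite incl_xs -[xs _]mulr1; apply/cid_notin/DD.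
pose m' := m - delta_mx 0 g *~ m 0 g.
have -> : incl (pl (fun v => pairing m (u v))) = pl (fun w => pairing m' (umodif w)) +
    \sum_v mvar (lift ord0 v) *~ (m 0 g * u v 0 g).
  have m'g : m' 0 g = 0 by rewrite -pairing_delta /m' pairingBr pairingMzr !pairing_delta mxE !eqxx intz subrr.
  rewrite rmorph_pl pl_ext umodif0 m'g mulr0z add0r -big_split /=; apply: eq_bigr => v _.
  rewrite umodifS m'g mul0r addr0 -mulrzDr /incl meval_var; congr (_ *~ _).
  by rewrite pairingBl pairingMzl pairing_delta -[_ *~ m 0 g]mulrzr intz; ring.
apply: cid_add; first by rewrite -[pl _]mul1r; apply: cid_lin.
apply: cid_sum => v _; have [vD|vD] := boolP ([set v] \in D).
  by rewrite u_g// mulr0 mulr0z; apply: cid0.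
apply: cidMz; rewrite -[mvar _]mulr1; apply: cid_mvar; apply: contra vD => /(subsetP D1m).
rewrite inE inE (negPf (neq_lift _ _)); congr (_ \in D).
by apply/setP => x; rewrite !inE (inj_eq lift_inj).
Qed.

(** Eliminating e identifies the new ring with that of D. Stars of cones without the new ray are
    stars in D; stars of cones containing it are stars in [D2], provided that -phi represents
    [D2]. *)
Lemma HPD_modif d d2 : HPD D u d -> HPD D2 u d2 -> HPD modif umodif d.
Proof.
move=> [[Dd Dex] [deg degP ker]] [[D2d D2ex] [deg2 deg2P ker2]].
have [degD deg0 deg1] := degP; have [deg2D deg20 deg21] := deg2P.
have top s : s \in D2 -> #|s| = d2 -> d = d2.+1 /\ deg (xs s * pl phi) = -1.
  move=> sD2 sd; have := deg_phi degP Dd sD2 (ker _ (subsetP D2D _ sD2)); rewrite sd; apply.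
  by move=> v vs; apply/negP => /D2d; rewrite cardsU1 vs sd; lia.
(* The codimension of [D2] is a consequence of the bending relation at its maximal cones. *)
have dd s : s \in D2 -> d = d2.+1.
  by move=> /D2ex [t tD2 td]; have [] := top t tD2 td.
have NB0 (x y : int) : x = 0 -> y = 0 -> x - y = 0 by move=> -> ->.
have uD2 : unimodular D2 u by move=> s k sD2 ks; apply: uD ks; apply: (subsetP D2D).
have degphi s p : s \in D2 -> deg (- pl phi * (xs s * p)) = deg2 (xs s * p).
  move=> sD2; move: (xs s * p) => {}p.
  have s0 : set0 \in D2 by apply: dD2 sD2 _; apply: sub0set.
  apply/eqP; rewrite -subr_eq0; apply/eqP; move: p.
  apply: (@star_functional _ _ _ _ uD2 _ (fun x : int => x = 0) (fun p =>
    deg (- pl phi * p) - deg2 p) set0 s0 (erefl 0) NB0).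
  - by move=> p q; rewrite mulrDr degD deg2D opprD addrACA.
  - rewrite star0 => p; elim=> [a K KD|a m|p1 p2 _ I1 _ I2].
    + rewrite deg0 ?deg20 ?subrr//; first exact: cid_face.
      have -> : - pl phi * (a * xs K) = - (a * (xs K * pl phi)) by ring.
      by apply/cidN/cidM/cid_xs_phi.
    + by rewrite deg0 ?deg20 ?subrr//; [apply: cid_lin | rewrite mulrA; apply: cid_lin].
    by rewrite mulrDr degD deg2D opprD addrACA I1 I2.
  move=> K _; rewrite setU0 => KD2; rewrite deg21// mulNr (additiveN degD) mulrC.
  have [Kd|Kd] := eqVneq #|K| d2; first by have [_ ->] := top K KD2 Kd.
  rewrite (deg_facet uD phi degP) ?oppr0// ?(subsetP D2D)// (dd _ sD2).
  by apply: contra Kd => /eqP [->].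
have degP' : is_degree modif umodif d (fun p => deg (elim_e p)).
  split=> [p q|p Ip|K KD]; [by rewrite rmorphD degD | exact: deg0 (cid_elim Ip) |].
  rewrite elim_xs card_old; move: KD; rewrite inE; case: ifP => _ KD; last by rewrite mul1r deg1.
  rewrite -[xs _]mulr1 degphi// mulr1 deg21// (dd _ KD); congr (_ _)%:Z; lia.
split.
  split=> K KD.
    rewrite card_old; move: KD; rewrite inE; case: ifP => _ KD; last exact: Dd.
    by rewrite (dd _ KD) add1n ltnS D2d.
  have [s sD sd] : exists2 s, s \in D & #|s| = d.
    by move: KD; rewrite inE; case: ifP => _ KD; [apply: Dex (subsetP D2D _ KD) | apply: Dex KD].
  exists (up s); last by rewrite card_old (negPf (ord0_up s)) old_up.
  by rewrite inE (negPf (ord0_up s)) old_up.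
exists (fun p => deg (elim_e p)) => // K KD.
have starm : star modif K \subset modif.
  by apply/subsetP => L; rewrite inE => h; apply: modif_dclosed h _; apply: subsetUl.
move: (KD); rewrite inE; case: ifP => K0 KD2.
  apply: (dualizing_transfer (th := elim_e) (io := incl) _ _ _ _ (ker2 _ KD2)) => [p|p|p|p].
  - apply: cid_incl => // s sD; apply: contra sD; rewrite !inE K0 orbT oldU old_up.
    by [].
  - exact: incl_elim.
  - exact: elim_incl.
  by rewrite rmorphM elim_xs K0 -mulrA degphi.
apply: (dualizing_transfer (th := elim_e) (io := incl) _ _ _ _ (ker _ KD2)) => [p|p|p|p].
- apply: cid_incl => // s sD; apply: contra sD; rewrite !inE K0 (negPf (ord0_up s)) oldU old_up.
  by [].
- exact: incl_elim.
- exact: elim_incl.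
by rewrite rmorphM elim_xs K0 mul1r.
Qed.

End Modification.

Section FanModif.
Variables (n : nat) (T T' : 'rV[int]_n -> Prop) (g : 'I_n).
Variables (r : nat) (D D2 : {set {set 'I_r}}) (u : 'I_r -> 'rV[int]_n) (phi : 'I_r -> int).
Hypotheses (F : fan T' D u) (dD2 : dclosed D2) (D2D : D2 \subset D).
Hypothesis T'g : forall x, T' x -> x 0 g = 0.
Hypothesis T_lift : forall c z, supp c \in D ->
  (T (comb u c + delta_mx 0 g *~ z) <->
   z = \sum_v (c v)%:Z * phi v \/ (\sum_v (c v)%:Z * phi v < z /\ supp c \in D2)).
Hypothesis T_proj : forall x, T x -> T' (x - delta_mx 0 g *~ x 0 g).
Local Notation D' := (modif D D2).
Local Notation u' := (umodif u phi g).
Local Notation eg := (delta_mx 0 g : 'rV[int]_n).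

Lemma u_g v : [set v] \in D -> u v 0 g = 0.
Proof.
move=> vD; apply: T'g; rewrite -combz_delta -combzE; apply: (fan_in F).
by congr (_ \in D): vD; apply/setP => w; rewrite !inE; case: (w == v).
Qed.

Lemma old_supp (c : 'I_r.+1 -> nat) : old (supp c) = supp (fun v => c (lift ord0 v)).
Proof. by apply/setP => v; rewrite !inE. Qed.

Lemma modif_old K : K \in D' -> old K \in D.
Proof. by rewrite inE; case: ifP => _ // /(subsetP D2D). Qed.

Lemma comb_umodif (c : 'I_r.+1 -> nat) : old (supp c) \in D ->
  comb u' c = comb u (fun v => c (lift ord0 v)) +
    eg *~ (\sum_v (c (lift ord0 v))%:Z * phi v + (c ord0)%:Z).
Proof.
move=> cD; rewrite /comb sum_ext /umodif ext0 addrC mulrzDr addrA -pmulrn; congr (_ + _).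
rewrite mulrz_sumr -big_split /=; apply: eq_bigr => v _; rewrite extS mulrnDl; congr (_ + _).
have [->|cv] := eqVneq (c (lift ord0 v)) 0%N; first by rewrite mulr0n mul0r mulr0z.
rewrite u_g ?subr0; last by apply: (fan_dc F cD); rewrite sub1set !inE.
by rewrite mulrC mulrzA pmulrn.
Qed.

Lemma fan_modif : fan T D' u'.
Proof.
split.
- exact: modif_dclosed (fan_dc F) dD2 D2D.
- move=> s k sD ks; suff intp (f : 'I_r.+1 -> int) :
      exists m, forall w, w \in s -> pairing m (u' w) = f w.
    have [m mP] := intp (fun w => (w == k)%:Z); exists m; split; first by rewrite mP// eqxx.
    by move=> l ls /negPf lk; rewrite mP// lk.
  have oD := modif_old sD; pose z := f ord0.
  have [m mP] := unimodular_interp (fan_uni F) (fun v => f (lift ord0 v) - z * phi v) oD.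
  exists (m + eg *~ (z - m 0 g)) => w ws.
  have mg : (m + eg *~ (z - m 0 g)) 0 g = z.
    by rewrite -[LHS]pairing_delta pairingDr pairingMzr !pairing_delta mxE !eqxx intz addrC subrK.
  case: (unliftP ord0 w) ws => [v ->|-> _]; last by rewrite umodif0 mg.
  rewrite -in_old => vs; rewrite umodifS mg u_g ?subr0; last first.
    by apply: (fan_dc F oD); rewrite sub1set.
  rewrite pairingDl pairingMzl pairing_delta u_g ?mul0rz ?addr0 ?mP ?subrK//.
  by apply: (fan_dc F oD); rewrite sub1set.
- move=> c cD; rewrite comb_umodif ?modif_old//.
  apply/T_lift; rewrite -old_supp ?modif_old//.
  have [->|c0] := eqVneq (c ord0) 0%N; first by left; rewrite addr0.
  right; split; first by rewrite ltrDl ltz_nat lt0n.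
  by move: cD; rewrite inE inE c0.
- move=> x Tx; have [c cD cE] := fan_ex F (T_proj Tx); pose t := x 0 g.
  have xE : x = comb u c + eg *~ t by rewrite cE subrK.
  pose k := t - \sum_v (c v)%:Z * phi v.
  have [k0 kD] : 0 <= k /\ (k != 0 -> supp c \in D2).
    rewrite /k subr_ge0 subr_eq0; have : T (comb u c + eg *~ t) by rewrite -xE.
    by case/(T_lift _ cD) => [->|[lt cD2]]; [rewrite lexx eqxx | rewrite ltW].
  pose c' := ext (absz k) c.
  have c'o : old (supp c') = supp c by rewrite old_supp; apply/setP => v; rewrite !inE /c' extS.
  exists c'; first by rewrite inE c'o inE /c' ext0 absz_eq0; case: eqP => //= /eqP /kD.
  rewrite comb_umodif ?c'o// /c' ext0 xE gez0_abs//; congr (_ + _ *~ _).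
    by rewrite /comb; apply: eq_bigr => v _; rewrite extS.
  by under eq_bigr => v _ do rewrite extS; rewrite /k addrC subrK.
move=> c c' cD c'D; rewrite !comb_umodif ?modif_old// => E.
have oD := modif_old cD; have oD' := modif_old c'D.
have Tg (d : 'I_r.+1 -> nat) : old (supp d) \in D -> comb u (fun v => d (lift ord0 v)) 0 g = 0.
  by rewrite old_supp => h; apply/T'g/(fan_in F).
have := congr1 (fun x => pairing eg x) E; rewrite /= !pairingDr !pairingMzr !pairing_delta !Tg// mxE
  !eqxx !intz !add0r => Eg.
move: E; rewrite Eg => /addIr /(fan_inj F); rewrite -!old_supp => /(_ oD oD') cc.
have c0 : c ord0 = c' ord0.
  move: Eg; under eq_bigr => v _ do rewrite cc.
  by move/addrI => [].
by move=> w; case: (unliftP ord0 w) => [v|] -> //; apply: cc.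
Qed.

End FanModif.

(** * Deletion and contraction of matroids *)

Section MinTwice.
Variable n : nat.
Implicit Types (w x b : 'rV[int]_n) (U V W E P : {set 'I_n}) (UU : {set {set 'I_n}}) (f g h : 'I_n).

Definition mintwice w U := [exists a in U, exists b in U,
  [&& a != b, w 0 a == w 0 b & [forall y in U, w 0 a <= w 0 y]]].

Lemma mintwiceP w U : reflect (exists a c, [/\ a \in U, c \in U, a != c, w 0 a = w 0 c &
  forall y, y \in U -> w 0 a <= w 0 y]) (mintwice w U).
Proof.
apply: (iffP exists_inP) => [[a aU /exists_inP [c cU /and3P[ac /eqP E /forall_inP h]]]|].
  by exists a, c.
move=> [a [c [aU cU ac E h]]]; exists a => //; apply/exists_inP; exists c => //.
by rewrite ac E eqxx -E /=; apply/forall_inP.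
Qed.

Lemma eq_mintwice w w' U :
  (forall a c, a \in U -> c \in U -> (w 0 a <= w 0 c) = (w' 0 a <= w' 0 c)) ->
  mintwice w U = mintwice w' U.
Proof.
move=> E; have eqE a c : a \in U -> c \in U -> (w 0 a == w 0 c) = (w' 0 a == w' 0 c).
  by move=> aU cU; rewrite !eq_le !E.
apply/idP/idP => /mintwiceP [a [c [aU cU ac wac h]]]; apply/mintwiceP; exists a, c; split=> //.
- by apply/eqP; rewrite -eqE// wac.
- by move=> y yU; rewrite -E// h.
- by apply/eqP; rewrite eqE// wac.
by move=> y yU; rewrite E// h.
Qed.

Lemma argmin_exists w U : U != set0 -> exists2 a, a \in U & forall y, y \in U -> w 0 a <= w 0 y.
Proof.
case/set0Pn => a0 a0U; case: (@arg_minP _ int 'I_n a0 (mem U) (fun a => w 0 a) a0U) => a aU h.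
by exists a.
Qed.

Lemma not_mintwice w U f : f \in U -> (forall y, y \in U -> y != f -> w 0 f < w 0 y) -> ~~ mintwice w U.
Proof.
move=> fU h; apply/mintwiceP => -[a [c [aU cU ac E m]]].
have af : a = f by apply/eqP; apply: contraT => /(h a aU); have := m f fU; lia.
have cf : c = f by apply/eqP; apply: contraT => /(h c cU); have := m f fU; lia.
by move: ac; rewrite af cf eqxx.
Qed.

Lemma mintwiceN w U : U != set0 -> ~~ mintwice w U ->
  exists2 f, f \in U & forall y, y \in U -> y != f -> w 0 f < w 0 y.
Proof.
move=> U0 nm; have [f fU fm] := argmin_exists w U0; exists f => // y yU yf.
rewrite lt_neqAle fm// andbT; apply: contraNneq nm => E.
by apply/mintwiceP; exists f, y; rewrite eq_sym yf.
Qed.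

(* Strong elimination; it holds for the circuits of a matroid, and unlike
   minimality of circuits it is inherited by deletions and contractions below. *)
Definition selim UU := forall U V g f, U \in UU -> V \in UU -> g \in U -> g \in V ->
  f \in U -> f \notin V -> exists W, [/\ W \in UU, f \in W & W \subset (U :|: V) :\ g].

Definition deletion UU g := [set U in UU | g \notin U].
Definition contraction UU g := [set U :\ g | U in UU].

Lemma selim_deletion UU g : selim UU -> selim (deletion UU g).
Proof.
move=> se U V x f; rewrite !inE => /andP[UUU gU] /andP[VUU gV] xU xV fU fV.
have [W [WUU fW WUV]] := se U V x f UUU VUU xU xV fU fV; exists W; split=> //.
rewrite inE WUU; apply/negP => /(subsetP WUV); rewrite !inE (negPf gU) (negPf gV) andbF.
by [].
Qed.

Lemma selim_contraction UU g : selim UU -> selim (contraction UU g).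
Proof.
move=> se U' V' x f /imsetP [U UUU ->] /imsetP [V VUU ->]; rewrite !inE.
move=> /andP[xg xU] /andP[_ xV] /andP[fg fU]; rewrite fg /= => fV.
have [W [WUU fW WUV]] := se U V x f UUU VUU xU xV fU fV; exists (W :\ g); split.
- exact: imset_f.
- by rewrite !inE fg.
by apply/subsetP => y; rewrite !inE => /andP[-> /(subsetP WUV)]; rewrite !inE.
Qed.

(* isphi w t: t is the maximum over U containing g of the minimum of w on U \ g. *)
Definition isphi UU g w t :=
  (exists U a, [/\ U \in UU, g \in U, a \in U :\ g, w 0 a = t & forall y, y \in U :\ g -> t <= w 0 y]) /\
  (forall U, U \in UU -> g \in U -> exists2 a, a \in U :\ g & w 0 a <= t).

Lemma isphi_unique UU g w t t' : isphi UU g w t -> isphi UU g w t' -> t = t'.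
Proof.
move=> [[U [a [UU1 gU aU wa ta]]] h] [[U' [a' [UU1' gU' aU' wa' ta']]] h'].
have [c cU' ct] := h U' UU1' gU'; have [c' cU ct'] := h' U UU1 gU.
have := ta c' cU; have := ta' c cU'; lia.
Qed.

Section Phi.
Variables (UU : {set {set 'I_n}}) (g : 'I_n).
Hypothesis se : selim UU.
Hypothesis nonloop : forall U, U \in UU -> g \in U -> U :\ g != set0.

Lemma isphi_exists w : (exists2 U, U \in UU & g \in U) -> exists t, isphi UU g w t.
Proof.
move=> [U0 U0UU gU0].
have /fin_all_exists [a aP] (U : {set 'I_n}) : exists a, U \in UU -> g \in U ->
    a \in U :\ g /\ forall y, y \in U :\ g -> w 0 a <= w 0 y.
  case: (boolP ((U \in UU) && (g \in U))) => [/andP[UUU gU]|/negP h].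
    by have [a aU am] := argmin_exists w (nonloop UUU gU); exists a.
  by exists g => UUU gU; case: h; rewrite UUU.
pose S := [set U in UU | g \in U]; have U0S : U0 \in S by rewrite inE U0UU.
case: (@arg_maxP _ int {set 'I_n} U0 (mem S) (fun U => w 0 (a U)) U0S) => U US Um.
have US' : U \in S := US; have /andP[UUU gU] : (U \in UU) && (g \in U) by move: US'; rewrite inE.
have [aU am] := aP U UUU gU; exists (w 0 (a U)); split.
  by exists U, (a U).
move=> V VUU gV; exists (a V); first by have [] := aP V VUU gV.
have VS : V \in S by rewrite inE VUU.
exact: (Um _ VS).
Qed.

(** If a set V through g had all its other entries above [w 0 f], eliminating g from U and V while
    keeping f would give a set of the deletion with its minimum at f alone. *)
Lemma isphi_strict w U f : (forall V, V \in deletion UU g -> mintwice w V) ->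
  U \in UU -> g \in U -> f \in U :\ g ->
  (forall y, y \in U :\ g -> y != f -> w 0 f < w 0 y) -> isphi UU g w (w 0 f).
Proof.
move=> wd UUU gU fU fm; split.
  exists U, f; split=> // y yU; have [->//|yf] := eqVneq y f; exact: ltW (fm y yU yf).
move=> V VUU gV; apply: NNPP => none.
have big y : y \in V :\ g -> w 0 f < w 0 y.
  by move=> yV; rewrite ltNge; apply/negP => h; apply: none; exists y.
have fV : f \notin V.
  apply/negP => fV; move: fU; rewrite !inE => /andP[fg fU].
  by have := big f; rewrite !inE fg fV ltxx => /(_ isT).
move: (fU); rewrite !inE => /andP[fg fU'].
have [W [WUU fW WUV]] := se UUU VUU gU gV fU' fV.
have gW : g \notin W by apply/negP => /(subsetP WUV); rewrite !inE eqxx.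
have := wd W; rewrite inE WUU gW => /(_ isT); apply/negP.
apply: (not_mintwice fW) => y yW yf.
have := subsetP WUV y yW; rewrite !inE => /andP[yg /orP[yU|yV]].
  by apply: fm; rewrite // !inE yg.
by apply: big; rewrite !inE yg.
Qed.

Lemma mintwice_graph w t : (forall V, V \in deletion UU g -> mintwice w V) ->
  isphi UU g w t -> w 0 g = t -> forall U, U \in UU -> mintwice w U.
Proof.
move=> wd wt wg U UUU; have [gU|gU] := boolP (g \in U); last by apply: wd; rewrite inE UUU.
have [f fU fm] := argmin_exists w (nonloop UUU gU).
move: (fU); rewrite !inE => /andP[fg fU'].
have [a aU at_] := wt.2 U UUU gU.
have := fm a aU; rewrite le_eqVlt => le.
have [ft|ft] := eqVneq (w 0 f) t.
  apply/mintwiceP; exists f, g; rewrite ft wg; split=> // y yU.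
  by have [->|yg] := eqVneq y g; [rewrite wg | rewrite -ft fm// !inE yg].
have ft' : w 0 f < t by rewrite lt_neqAle ft (le_trans (fm a aU)).
apply: contraT => nm; have strict y : y \in U :\ g -> y != f -> w 0 f < w 0 y.
  move=> yU yf; rewrite lt_neqAle fm// andbT; apply: contraNneq nm => E.
  move: (yU); rewrite !inE => /andP[yg yU'].
  apply/mintwiceP; exists f, y; split; rewrite // 1?eq_sym// => x xU.
  by have [->|xg] := eqVneq x g; [rewrite wg ltW | rewrite fm// !inE xg].
by have := isphi_unique wt (isphi_strict wd UUU gU fU strict) => E; rewrite E eqxx in ft.
Qed.

Lemma isphi_le w t : (forall U, U \in UU -> mintwice w U) -> isphi UU g w t -> t <= w 0 g.
Proof.
move=> wU [[U [a [UUU gU aU wa ta]]] _]; rewrite leNgt; apply/negP => lt.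
have := wU U UUU; apply/negP; apply: (not_mintwice gU) => y yU yg.
by apply: lt_le_trans lt _; apply: ta; rewrite !inE yg.
Qed.

Lemma mintwice_above w t : (forall U, U \in UU -> mintwice w U) -> isphi UU g w t ->
  t < w 0 g -> forall V, V \in contraction UU g -> mintwice w V.
Proof.
move=> wU wt tg V /imsetP [U UUU ->]; have := wU U UUU.
have [gU|gU] := boolP (g \in U); last first.
  by move=> h; rewrite (setDidPl _)// disjoint_sym disjoints1.
move=> /mintwiceP [x [y [xU yU xy E m]]].
have [a aU at_] := wt.2 U UUU gU; move: (aU); rewrite !inE => /andP[_ aU'].
have xg : x != g by apply/eqP => xg; have := m a aU'; rewrite xg; lia.
have yg : y != g by apply/eqP => yg; have := m a aU'; rewrite E yg; lia.
apply/mintwiceP; exists x, y; rewrite !inE xg yg; split=> // z; rewrite !inE => /andP[_]; exact: m.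
Qed.

Lemma mintwice_below w t : (forall V, V \in contraction UU g -> mintwice w V) ->
  isphi UU g w t -> t <= w 0 g -> forall U, U \in UU -> mintwice w U.
Proof.
move=> wV wt tg U UUU; have := wV _ (imset_f (fun U => U :\ g) UUU).
have [gU|gU] := boolP (g \in U); last first.
  by rewrite (setDidPl _)// disjoint_sym disjoints1.
move=> /mintwiceP [x [y [xU yU xy E m]]].
have [a aU at_] := wt.2 U UUU gU; move: (xU) (yU); rewrite !inE => /andP[_ xU'] /andP[_ yU'].
apply/mintwiceP; exists x, y; split=> // z zU; have [->|zg] := eqVneq z g.
  by apply: le_trans (m a aU) (le_trans at_ tg).
by apply: m; rewrite !inE zg.
Qed.

Lemma contraction_deletion w : (forall V, V \in contraction UU g -> mintwice w V) ->
  forall V, V \in deletion UU g -> mintwice w V.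
Proof.
move=> wV V; rewrite inE => /andP[VUU gV]; have := wV _ (imset_f (fun U => U :\ g) VUU).
by rewrite (setDidPl _)// disjoint_sym disjoints1.
Qed.

Lemma isphi_ext w w' t : (forall y, y != g -> w 0 y = w' 0 y) -> isphi UU g w t -> isphi UU g w' t.
Proof.
move=> E [[U [a [UUU gU aU wa ta]]] h]; split.
  exists U, a; split=> //; first by rewrite -E//; move: aU; rewrite !inE => /andP[].
  by move=> y yU; rewrite -E ?ta//; move: yU; rewrite !inE => /andP[].
move=> V VUU gV; have [c cV ct] := h V VUU gV; exists c => //.
by rewrite -E//; move: cV; rewrite !inE => /andP[].
Qed.

End Phi.
End MinTwice.

(** * The local matroid at a point and its parallel classes *)

Section Parallel.
Variables (n : nat) (UU : {set {set 'I_n}}) (E : {set 'I_n}) (g : 'I_n) (b : 'rV[int]_n).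
Hypotheses (se : selim UU) (UE : forall U, U \in UU -> U \subset E).
Hypotheses (bU : forall U, U \in UU -> mintwice b U)
  (bV : forall V, V \in contraction UU g -> mintwice b V) (bphi : isphi UU g b (b 0 g)).
Implicit Types (U V W : {set 'I_n}) (f h x y : 'I_n).

(* The sets ini U form the initial (local) matroid at b. *)
Definition ini U : {set 'I_n} := [set x in U | [forall y in U, b 0 x <= b 0 y]].

Lemma iniP U x : reflect (x \in U /\ forall y, y \in U -> b 0 x <= b 0 y) (x \in ini U).
Proof.
rewrite inE; apply: (iffP andP) => -[xU h]; split=> //; first exact/forall_inP.
exact/forall_inP.
Qed.

Lemma ini_val U x y : x \in ini U -> y \in ini U -> b 0 x = b 0 y.
Proof. by move=> /iniP [xU xm] /iniP [yU ym]; have := xm y yU; have := ym x xU; lia. Qed.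

Lemma ini_lt U x y : x \in ini U -> y \in U -> y \notin ini U -> b 0 x < b 0 y.
Proof.
move=> /iniP [xU xm] yU yn; rewrite lt_neqAle xm// andbT; apply: contra yn => /eqP E'.
by apply/iniP; split=> // z zU; rewrite -E' xm.
Qed.

Lemma ini_two U h : U \in UU -> exists2 x, x \in ini U & x != h.
Proof.
move=> /bU /mintwiceP [a [c [aU cU ac E' m]]].
have [ah|ah] := eqVneq a h; last by exists a => //; apply/iniP.
exists c; first by apply/iniP; split=> // y yU; rewrite -E' m.
by rewrite -ah eq_sym.
Qed.

(** An element f with the minimal value of V but outside [ini V] is outside V, so strong elimination
    applies to U and V. No entry of the resulting W is below [b 0 f], so its minima lie among those
    of U and V. *)
Lemma ini_elim U V x f : U \in UU -> V \in UU -> x \in ini U -> x \in ini V ->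
  f \in ini U -> f \notin ini V ->
  exists W, [/\ W \in UU, f \in ini W & ini W \subset (ini U :|: ini V) :\ x].
Proof.
move=> UUU VUU xU xV fU fV.
have [xU' _] := iniP _ _ xU; have [xV' xVm] := iniP _ _ xV; have [fU' fm] := iniP _ _ fU.
have bfx := ini_val fU xU.
have fV' : f \notin V.
  by apply: contra fV => fV'; apply/iniP; split=> // y yV; rewrite bfx xVm.
have [W [WUU fW WUV]] := se UUU VUU xU' xV' fU' fV'.
have minW y : y \in W -> b 0 f <= b 0 y.
  move=> yW; have := subsetP WUV y yW; rewrite !inE => /andP[_ /orP[/fm//|/xVm]].
  by rewrite bfx.
exists W; split=> //; first by apply/iniP.
apply/subsetP => y /iniP [yW ym]; have := subsetP WUV y yW; rewrite in_setD1 => /andP[yx].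
have yf : b 0 y = b 0 f by apply/eqP; rewrite eq_le ym// minW.
rewrite in_setD1 yx /= !in_setU => /orP[yU|yV]; apply/orP; [left|right]; apply/iniP; split=> // z zU.
  by rewrite yf fm.
by rewrite yf bfx xVm.
Qed.

Definition par f h := [exists U in UU, ini U == [set f; h]].
Definition pclass f : {set 'I_n} := [set h in E :\ g | (h == f) || par f h].

Lemma parP f h : reflect (exists2 U, U \in UU & ini U = [set f; h]) (par f h).
Proof. by apply: (iffP exists_inP) => -[U UUU /eqP]; exists U => //; apply/eqP. Qed.

Lemma par_sym f h : par f h = par h f.
Proof. by apply/parP/parP => -[U UUU E']; exists U => //; rewrite setUC. Qed.

Lemma par_trans f h k : par f h -> par h k -> f = k \/ par f k.
Proof.
move=> /parP [U UUU iU] /parP [V VUU iV]; have [fk|fk] := eqVneq f k; first by left.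
right; have [fh|fh] := eqVneq f h; first by apply/parP; exists V; rewrite // fh.
have [|||| W [WUU fW Wsub]] := ini_elim (x := h) (f := f) UUU VUU.
- by rewrite iU !inE eqxx orbT.
- by rewrite iV !inE eqxx.
- by rewrite iU !inE eqxx.
- by rewrite iV !inE negb_or fh fk.
have Wfk : ini W \subset [set f; k].
  apply/subsetP => y /(subsetP Wsub); rewrite iU iV !inE => /andP[/negPf ->].
  by rewrite orbF.
have [x xW xf] := ini_two f WUU; have := subsetP Wfk x xW; rewrite !inE (negPf xf) /= => /eqP xk.
apply/parP; exists W => //; apply/eqP; rewrite eqEsubset Wfk subUset !sub1set fW -xk xW.
by [].
Qed.

Lemma pclass_refl f : f \in E :\ g -> f \in pclass f.
Proof. by move=> fE; rewrite inE fE eqxx. Qed.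

Lemma pclass_sub f : pclass f \subset E :\ g.
Proof. by apply/subsetP => x; rewrite inE => /andP[]. Qed.

Lemma pclass_eq f h : f \in E :\ g -> h \in pclass f -> pclass h = pclass f.
Proof.
move=> fE; rewrite inE => /andP[hE]; have [->//|hf /= fh] := eqVneq h f.
apply/setP => k; rewrite [LHS]inE [RHS]inE; case: (boolP (k \in E :\ g)) => //= kE.
have hf' : par h f by rewrite par_sym.
have [->|kh] := eqVneq k h; first by rewrite fh orbT.
have [->|kf] := eqVneq k f; first by rewrite hf' orbT.
apply/idP/idP => [/(par_trans fh)[fk|//]|/(par_trans hf')[hk|//]].
  by rewrite fk eqxx in kf.
by rewrite hk eqxx in kh.
Qed.

(* The class is closed: no circuit of the local matroid leaves it in one element. *)
Lemma pclass_closed f U h : f \in E :\ g -> U \in UU -> h \in ini U -> h \notin pclass f ->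
  ini U \subset h |: pclass f -> False.
Proof.
move=> fE; have [k] := ubnP #|ini U :&: (pclass f :\ f)|.
elim: k U => // k IH U Uk UUU hU hP Usub.
have hf : h != f by apply: contraNneq hP => ->; apply: pclass_refl.
have [none|[x]] := set_0Vmem (ini U :&: (pclass f :\ f)).
  have Ufh : ini U \subset [set f; h].
    apply/subsetP => y yU; have := subsetP Usub y yU; rewrite in_setU1 in_set2 => /orP[->|yP].
      by rewrite orbT.
    have := in_set0 y; rewrite -none inE yU in_setD1 yP andbT => /negbFE ->.
    by [].
  have iU : ini U = [set f; h].
    have [x xU xh] := ini_two h UUU; have := subsetP Ufh x xU.
    rewrite !inE (negPf xh) orbF => /eqP xf.
    by apply/eqP; rewrite eqEsubset Ufh subUset !sub1set hU -xf xU.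
  have [hU' _] := iniP _ _ hU.
  (* For h other than g the pair {f, h} puts h into the class; for h = g the contracted set [U :\ g]
     would have its minimum at f alone, against [bV]. *)
  have [hg|hg] := eqVneq h g; last first.
    case/negP: hP; rewrite inE in_setD1 hg (subsetP (UE UUU) h hU') /=.
    by apply/orP; right; apply/parP; exists U.
  have fU : f \in ini U by rewrite iU !inE eqxx.
  have := bV (imset_f (fun U => U :\ g) UUU); apply/negP.
  apply: (@not_mintwice _ _ _ f) => [|y].
    by have [fU' _] := iniP _ _ fU; rewrite in_setD1 fU' -hg eq_sym hf.
  rewrite in_setD1 => /andP[yg yU] yf; apply: (ini_lt fU yU).
  by rewrite iU !inE negb_or yf hg.
rewrite inE in_setD1 => /and3P[xU xf xP].
(* The local circuit {f, x} eliminates x from U, which leaves fewer elements of the class other than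
   f. *)
have [V VUU iV] : exists2 V, V \in UU & ini V = [set f; x].
  by apply/parP; move: xP; rewrite inE (negPf xf) => /andP[].
have hx : h != x by apply: contraNneq hP => ->.
have [||W [WUU hW Wsub]] := @ini_elim U V x h UUU VUU xU _ hU _.
- by rewrite iV !inE eqxx orbT.
- by rewrite iV !inE negb_or hf hx.
have Wsub' : ini W \subset h |: pclass f.
  apply/subsetP => y /(subsetP Wsub); rewrite iV in_setD1 in_setU in_set2 => /andP[yx].
  rewrite (negPf yx) orbF => /orP[/(subsetP Usub)//|/eqP ->].
  by rewrite in_setU1 pclass_refl ?orbT.
apply: (IH W _ WUU hW hP Wsub'); rewrite ltnS in Uk; apply: leq_trans Uk; apply: proper_card.
apply/properP; split; last first.
  exists x; first by rewrite in_setI xU in_setD1 xf xP.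
  rewrite in_setI negb_and; apply/orP; left; apply/negP => /(subsetP Wsub).
  by rewrite in_setD1 eqxx.
apply/subsetP => y; rewrite !in_setI in_setD1 => /and3P[yW yf yP].
rewrite yf yP !andbT; have := subsetP Wsub y yW.
rewrite in_setD1 iV in_setU in_set2 (negPf yf) /= => /andP[/negPf ->].
by rewrite orbF.
Qed.

Section Bump.
Variables (f : 'I_n) (N : nat) (s : int) (w : 'rV[int]_n).
Hypotheses (fE : f \in E :\ g) (N2 : (2 <= N)%N).
Hypothesis wE : forall x, x \in E :\ g -> w 0 x = b 0 x * N%:Z + (x \in pclass f)%:Z - s.

(** A gap in b is multiplied by N and outweighs the raise by 1. Since the class is closed, the local
    minima of V either all lie in it or at least two lie outside. *)
Lemma bump_mintwice V : V \in deletion UU g -> mintwice w V.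
Proof.
rewrite inE => /andP[VUU gV].
have VE x : x \in V -> x \in E :\ g.
  move=> xV; rewrite in_setD1 (subsetP (UE VUU) x xV) andbT.
  by apply: contraNneq gV => <-.
have iV x : x \in ini V -> x \in V by case/iniP.
have [sub|/subsetPn [h hV hP]] := boolP (ini V \subset pclass f).
  have [x xV _] := ini_two f VUU; have [y yV yx] := ini_two x VUU.
  have xE z : z \in ini V -> w 0 z = b 0 x * N%:Z + 1 - s.
    by move=> zV; rewrite wE ?VE ?iV// (subsetP sub z zV) (ini_val zV xV).
  apply/mintwiceP; exists x, y; split; rewrite ?iV//; first by rewrite eq_sym.
    by rewrite !xE.
  move=> z zV; rewrite xE//; have [zi|zi] := boolP (z \in ini V); first by rewrite xE.
  have lt := ini_lt xV zV zi; rewrite wE ?VE//; nia.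
have [h' [h'V h'P h'h]] : exists h', [/\ h' \in ini V, h' \notin pclass f & h' != h].
  apply: NNPP => none; apply: (pclass_closed fE VUU hV hP); apply/subsetP => y yV.
  rewrite in_setU1; case: eqP => //= yh; apply: contraT => yP.
  by case: none; exists y; split=> //; apply/eqP.
apply/mintwiceP; exists h, h'; split; rewrite ?iV//; first by rewrite eq_sym.
  by rewrite !wE ?VE ?iV// (negPf hP) (negPf h'P) (ini_val hV h'V).
move=> y yV; rewrite (wE (VE h (iV h hV))) (wE (VE y yV)) (negPf hP).
by have [_ /(_ y yV) le] := iniP _ _ hV; case: (y \in _); nia.
Qed.

(** Whenever g is a local minimum of U, closedness of the class gives another local minimum outside
    it, which is not raised. So phi stays at the multiple of [b 0 g]; s is the shift that normalises
    [e0]. *)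
Lemma bump_phi : isphi UU g w (b 0 g * N%:Z - s).
Proof.
have UE' U x : U \in UU -> x \in U :\ g -> x \in E :\ g.
  by move=> UUU; rewrite !in_setD1 => /andP[-> /(subsetP (UE UUU))].
have key U : U \in UU -> g \in U -> (forall y, y \in U :\ g -> b 0 g <= b 0 y) ->
    exists a, [/\ a \in U :\ g, w 0 a = b 0 g * N%:Z - s & forall y, y \in U :\ g -> w 0 a <= w 0 y].
  move=> UUU gU Um.
  have gi : g \in ini U.
    by apply/iniP; split=> // y yU; have [->//|yg] := eqVneq y g; apply: Um; rewrite in_setD1 yg.
  have gP : g \notin pclass f by apply/negP => /(subsetP (pclass_sub f)); rewrite !inE eqxx.
  have [a [aU aP ag]] : exists a, [/\ a \in ini U, a \notin pclass f & a != g].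
    apply: NNPP => none; apply: (pclass_closed fE UUU gi gP); apply/subsetP => y yV.
    rewrite in_setU1; case: eqP => //= yh; apply: contraT => yP.
    by case: none; exists y; split=> //; apply/eqP.
  have aU' : a \in U :\ g by rewrite in_setD1 ag; case/iniP: aU.
  have wa : w 0 a = b 0 g * N%:Z - s.
    by rewrite wE ?(UE' U)// (negPf aP) (ini_val aU gi) addr0.
  exists a; split=> // y yU; rewrite wa wE ?(UE' U)//; have := Um y yU; nia.
have [[U [a [UUU gU aU ba bm]]] h] := bphi; split.
  have [c [cU wc cm]] := key U UUU gU bm.
  by exists U, c; split=> // y yU; rewrite -wc cm.
move=> V VUU gV; have [c cV bc] := h V VUU gV.
have [lt|ge] := ltP (b 0 c) (b 0 g).
  exists c => //; rewrite wE ?(UE' V)//; case: (c \in _); nia.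
have [x xV xlt] : exists2 x, x \in V :\ g & w 0 x <= b 0 g * N%:Z - s; last by exists x.
have [all|] := boolP [forall y in V :\ g, b 0 g <= b 0 y].
  by have [x [xV wx _]] := key V VUU gV (forall_inP all); exists x; rewrite ?wx.
move=> /forall_inPn [y yV]; rewrite -ltNge => lt; exists y => //.
rewrite wE ?(UE' V)//; case: (y \in _); nia.
Qed.
End Bump.
End Parallel.

(* Lattice points of the tropical linear space on the ground set E, with
   the lineality killed by setting the coordinate e0 to zero. *)
Definition TL n (e0 : 'I_n) (UU : {set {set 'I_n}}) (E : {set 'I_n}) (w : 'rV[int]_n) : Prop :=
  [/\ forall x, x \notin E -> w 0 x = 0, w 0 e0 = 0 & forall U, U \in UU -> mintwice w U].

(** * Passing from deletion and contraction to the original ground set *)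

Section Step.
Variables (n : nat) (e0 g : 'I_n) (UU : {set {set 'I_n}}) (E : {set 'I_n}).
Hypotheses (se : selim UU) (UE : forall U, U \in UU -> U \subset E).
Hypotheses (e0E : e0 \in E) (gE : g \in E) (ge0 : g != e0).
Hypothesis g_dep : exists2 U, U \in UU & g \in U.
Hypothesis nonloop : forall U, U \in UU -> g \in U -> U :\ g != set0.
Local Notation T := (TL e0 UU E).
Local Notation T' := (TL e0 (deletion UU g) (E :\ g)).
Local Notation T'' := (TL e0 (contraction UU g) (E :\ g)).
Variables (r : nat) (D : {set {set 'I_r}}) (u : 'I_r -> 'rV[int]_n).
Hypothesis F : fan T' D u.
Hypothesis coherent : forall a c : 'I_n, unmixed D u (delta_mx 0 a - delta_mx 0 c).
Implicit Types (s t : {set 'I_r}) (a x y : 'I_n).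
Local Notation dD := (fan_dc F).

Lemma diffE a c (w : 'rV[int]_n) : pairing (delta_mx 0 a - delta_mx 0 c) w = w 0 a - w 0 c.
Proof. by rewrite pairingBl !pairing_delta. Qed.

Lemma coord_comb c a : comb u c 0 a = \sum_v (c v)%:Z * u v 0 a.
Proof.
rewrite /comb summxE; apply: eq_bigr => v _.
by rewrite mulmxnE -mulr_natl natz.
Qed.

Lemma coord_bary s a : bary u s 0 a = \sum_(v in s) u v 0 a.
Proof. by rewrite -pairing_delta pairing_bary; apply: eq_bigr => v _; rewrite pairing_delta. Qed.

Lemma cone_le s a y v : s \in D -> bary u s 0 a <= bary u s 0 y -> v \in s -> u v 0 a <= u v 0 y.
Proof.
move=> sD; rewrite -subr_ge0 -(diffE y a) le_eqVlt => /orP[/eqP h|h] vs.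
  have := unmixed_eq0 dD (@coherent y a) sD (esym h) vs; rewrite diffE => /eqP.
  by rewrite subr_eq0 => /eqP ->.
by have := unmixed_ge0 dD (@coherent y a) sD h vs; rewrite diffE subr_ge0.
Qed.

Lemma cone_le_comb s c a y : s \in D -> supp c \subset s -> bary u s 0 a <= bary u s 0 y ->
  comb u c 0 a <= comb u c 0 y.
Proof.
move=> sD cs h; rewrite !coord_comb; apply: ler_sum => v _.
have [->|cv] := eqVneq (c v) 0%N; first by rewrite !mul0r.
apply: ler_wpM2l => //; apply: (cone_le sD h); apply: (subsetP cs).
by rewrite inE.
Qed.

Lemma order_comb c a y : supp c \in D ->
  (comb u c 0 a <= comb u c 0 y) = (bary u (supp c) 0 a <= bary u (supp c) 0 y).
Proof.
move=> cD; apply/idP/idP; last exact: cone_le_comb.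
apply: contraTT; rewrite -!ltNge => lt.
have [v vc lv] : exists2 v, v \in supp c & u v 0 y < u v 0 a.
  apply: NNPP => none; move: lt; rewrite ltNge => /negP; apply; rewrite !coord_bary.
  by apply: ler_sum => v vc; rewrite leNgt; apply/negP => lv; apply: none; exists v.
have le w : w \in supp c -> u w 0 y <= u w 0 a by apply: (cone_le cD); apply: ltW.
rewrite !coord_comb (bigD1 v)//= [X in _ < X](bigD1 v)//=; apply: ltr_leD.
  have cv0 : 0 < (c v)%:Z by rewrite ltz_nat lt0n; move: vc; rewrite inE.
  by rewrite (ltr_pM2l cv0).
apply: ler_sum => w _; have [->|cw] := eqVneq (c w) 0%N; first by rewrite !mul0r.
by apply: ler_wpM2l => //; apply: le; rewrite inE.
Qed.

(** The order of the coordinates is constant on the relative interior of a cone ([order_comb]), so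
    the barycentre decides whether the cone lies in the space of the contraction. *)
Definition D2 : {set {set 'I_r}} :=
  [set s in D | [forall V in contraction UU g, mintwice (bary u s) V]].

Lemma D2D : D2 \subset D.
Proof. by apply/subsetP => s; rewrite inE => /andP[]. Qed.

Lemma T''_comb c : supp c \in D -> (T'' (comb u c) <-> supp c \in D2).
Proof.
move=> cD; rewrite inE cD /=; have [c0 ce0 _] := fan_in F cD.
have E' V : mintwice (bary u (supp c)) V = mintwice (comb u c) V.
  by apply: eq_mintwice => a y _ _; rewrite (order_comb _ _ cD).
split=> [[_ _ h]|/forall_inP h]; first by apply/forall_inP => V VV; rewrite E' h.
by split=> // V VV; rewrite -E' h.
Qed.

Lemma D2_dclosed : dclosed D2.
Proof.
move=> s t; rewrite !inE => /andP[sD /forall_inP h] ts; rewrite (dD sD ts) /=.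
apply/forall_inP => V VV; have /mintwiceP [a [c [aV cV ac E' m]]] := h V VV.
have le x y : bary u s 0 x <= bary u s 0 y -> bary u t 0 x <= bary u t 0 y.
  move=> xy; rewrite [bary u t]bary_combE; apply: (cone_le_comb sD) => //.
  by rewrite supp_mem.
apply/mintwiceP; exists a, c; split=> // [|y yV]; last by apply: le; apply: m.
by apply/eqP; rewrite eq_le !le// E'.
Qed.

Lemma T''_sub (x : 'rV[int]_n) : T'' x -> T' x.
Proof. by move=> [x0 xe h]; split=> // V VV; apply: (contraction_deletion h). Qed.

Lemma fan_D2 : fan T'' D2 u.
Proof.
split.
- exact: D2_dclosed.
- by move=> s k /(subsetP D2D); apply: (fan_uni F).
- by move=> c cD; apply/T''_comb => //; apply: (subsetP D2D).
- move=> x Tx; have [c cD cE] := fan_ex F (T''_sub Tx); exists c => //.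
  by apply/T''_comb => //; rewrite cE.
by move=> c c' /(subsetP D2D) cD /(subsetP D2D) cD'; apply: (fan_inj F).
Qed.

(** With a constant order of coordinates on the cone, maximum and minimum are attained at the same
    place throughout, so phi is one coordinate there. *)
Lemma phi_cone s : s \in D -> exists f, forall c, supp c \subset s ->
  isphi UU g (comb u c) (comb u c 0 f).
Proof.
move=> sD; have [t [[U [a [UUU gU aU ba bm]]] h]] := isphi_exists nonloop (bary u s) g_dep.
exists a => c cs; have le := cone_le_comb sD cs; split.
  by exists U, a; split=> // y yU; apply: le; rewrite ba bm.
by move=> V VUU gV; have [x xV xt] := h V VUU gV; exists x => //; apply: le; rewrite ba.
Qed.

Lemma phi_exists : exists phi : 'I_r -> int, forall c, supp c \in D ->
  isphi UU g (comb u c) (\sum_v (c v)%:Z * phi v).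
Proof.
have /fin_all_exists [phi phiP] (v : 'I_r) : exists z : int, isphi UU g (u v) z :=
  isphi_exists nonloop (u v) g_dep.
exists phi => c cD; have [f fP] := phi_cone cD.
suff -> : \sum_v (c v)%:Z * phi v = comb u c 0 f by apply: fP.
rewrite coord_comb; apply: eq_bigr => v _; have [->|cv] := eqVneq (c v) 0%N; first by rewrite !mul0r.
congr (_ * _); apply: (isphi_unique (phiP v)).
have := fP (fun w => (w == v)%N); rewrite combzE combz_delta; apply.
by apply/subsetP => w; rewrite !inE; case: (eqVneq w v) => [->|].
Qed.

Variable phi : 'I_r -> int.
Hypothesis phiP : forall c, supp c \in D -> isphi UU g (comb u c) (\sum_v (c v)%:Z * phi v).

Lemma phi_bary s : s \in D -> isphi UU g (bary u s) (\sum_(v in s) phi v).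
Proof.
move=> sD; have := phiP (c := fun v => v \in s); rewrite supp_mem bary_combE => /(_ sD).
rewrite (_ : \sum_v _ = \sum_(v in s) phi v)//.
by rewrite [RHS]big_mkcond; apply: eq_bigr => v _; case: ifP; rewrite ?mul1r ?mul0r.
Qed.

Lemma T'_bary s : s \in D -> T' (bary u s).
Proof. by move=> sD; rewrite bary_combE; apply: (fan_in F); rewrite supp_mem. Qed.

(** Off [D2] some set U through g has its minimum on [U :\ g] at a single f. This persists after
    adding a neighbouring ray, and [isphi_strict] makes phi the coordinate f around s. *)
Lemma step_linear s : s \in D -> s \notin D2 ->
  exists m, forall v, v |: s \in D -> phi v = pairing m (u v).
Proof.
move=> sD; rewrite inE sD /= => /forall_inPn [V /imsetP [U UUU ->] nm].
have [b0 be bd] := T'_bary sD.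
have gU : g \in U.
  apply: contraT => gU; move: nm; rewrite (setDidPl _); last by rewrite disjoint_sym disjoints1.
  by rewrite bd// inE UUU.
have [f fU fm] := mintwiceN (nonloop UUU gU) nm; exists (delta_mx 0 f) => v vD.
rewrite pairing_delta.
pose c w := ((w \in s) + (w == v))%N.
have cE : supp c = v |: s by apply/setP => w; rewrite !inE /c; case: (w \in s); case: (w == v).
have cD : supp c \in D by rewrite cE.
have xE : comb u c = bary u s + u v.
  by rewrite bary_combE !combzE -(combz_delta u v) -combzD; apply: combz_eq => w; rewrite /c PoszD.
have xf y : y \in U :\ g -> y != f -> comb u c 0 f < comb u c 0 y.
  move=> yU yf; have lt := fm y yU yf; rewrite xE !mxE.
  apply: ltr_leD => //.
  have le w : w \in v |: s -> u w 0 f <= u w 0 y.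
    have [h|h] := unmixed_sign dD (@coherent y f) vD.
      by move=> wv; have := h w wv; rewrite diffE subr_ge0.
    have : bary u s 0 y <= bary u s 0 f.
      by rewrite !coord_bary; apply: ler_sum => w' ws; have := h w'; rewrite diffE subr_le0; apply;
        rewrite inE ws orbT.
    by rewrite leNgt lt.
  by apply: le; rewrite setU11.
have [_ _ xd] := fan_in F cD.
have ph_x := isphi_unique (isphi_strict se xd UUU gU fU xf) (phiP cD).
have ph_b := isphi_unique (isphi_strict se bd UUU gU fU fm) (phi_bary sD).
move: ph_x; rewrite xE [LHS]mxE ph_b.
have -> : \sum_w (c w)%:Z * phi w = \sum_(w in s) phi w + phi v.
  rewrite /c; under eq_bigr => w _ do rewrite PoszD mulrDl.
  rewrite big_split /=; congr (_ + _).
    by rewrite [RHS]big_mkcond; apply: eq_bigr => w _; case: ifP; rewrite ?mul1r ?mul0r.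
  by rewrite (bigD1 v)//= eqxx mul1r big1 ?addr0// => w /negPf ->; rewrite mul0r.
by move/addrI => <-.
Qed.

(** For each parallel class at b, the direction that raises this class stays in the space of the
    deletion and keeps phi. Normalising [e0] subtracts the all-ones vector from the direction of the
    class of [e0] and lowers phi by 1 there. The normalised directions sum to 0 and their phi values
    to -1; c adds up their local coordinates. *)
Lemma step_bends s : s \in D2 -> exists c : 'I_r -> int,
  [/\ forall v, c v != 0 -> v |: s \in D, forall v, v \notin s -> 0 <= c v,
      combz u c = 0 & \sum_v c v * phi v = -1].
Proof.
move=> sD2; have sD := subsetP D2D _ sD2; pose b := bary u s; pose tt := \sum_(v in s) phi v.
(* Lifting b to the graph of phi lets g take part in the local matroid. *)
pose bh := b + delta_mx 0 g *~ tt.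
have [b0 be bV] : T'' b by rewrite /b bary_combE; apply/T''_comb; rewrite supp_mem.
have bhE x : x != g -> bh 0 x = b 0 x.
  move=> xg; rewrite -(pairing_delta x bh) pairingDr pairingMzr !pairing_delta mxE eqxx /=.
  by rewrite (negPf xg) mul0rz addr0.
have bhg : bh 0 g = tt.
  rewrite -(pairing_delta g bh) pairingDr pairingMzr !pairing_delta mxE !eqxx b0 ?add0r ?intz//.
  by rewrite !inE eqxx.
have bhV V : V \in contraction UU g -> mintwice bh V.
  move=> VV; suff -> : mintwice bh V = mintwice b V by exact: bV.
  apply: eq_mintwice => a y aV yV.
  have ng z : z \in V -> z != g by case/imsetP: VV => U _ ->; rewrite !inE => /andP[].
  by rewrite !bhE ?ng.
have bhphi : isphi UU g bh (bh 0 g).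
  rewrite bhg; apply: (isphi_ext _ (phi_bary sD)) => y yg; by rewrite bhE.
have bhU U : U \in UU -> mintwice bh U.
  by move=> UUU; apply: (mintwice_below bhV bhphi).
pose E' := E :\ g; pose pc := pclass UU E g bh.
have pc_refl f : f \in E' -> f \in pc f by apply: pclass_refl.
have pc_eq f h : f \in E' -> h \in pc f -> pc h = pc f by apply: pclass_eq.
pose cls := [set pc f | f in E'].
have cls_sum x : \sum_(P in cls) (x \in P)%:Z = (x \in E')%:Z.
  case: (boolP (x \in E')) => xE; last first.
    rewrite big1// => P /imsetP [f fE ->]; case: (boolP (x \in pc f)) => // /(subsetP (pclass_sub _ _ _ _ _)).
    by rewrite (negPf xE).
  rewrite (bigD1 (pc x)) ?imset_f//= pc_refl// big1 ?addr0// => P /andP[/imsetP [f fE ->] ne].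
  by case: (boolP (x \in pc f)) => // xf; rewrite (pc_eq f x fE xf) eqxx in ne.
have e0E' : e0 \in E' by rewrite in_setD1 e0E eq_sym ge0.
pose y (P : {set 'I_n}) : 'rV[int]_n := \row_x ((x \in P)%:Z - (e0 \in P)%:Z * (x \in E')%:Z).
have /fin_all_exists [z zP] (P : {set 'I_n}) : exists z : 'I_r -> int, P \in cls ->
    [/\ local D s z, combz u z = y P & \sum_v z v * phi v = - (e0 \in P)%:Z].
  have [/imsetP [f fE ->]|_] := boolP (P \in cls); last by exists (fun=> 0).
  pose s' : int := (e0 \in pc f)%:Z.
  have wE N x : x \in E' -> (y (pc f) + b *~ N%:Z) 0 x = bh 0 x * N%:Z + (x \in pc f)%:Z - s'.
    move=> xE; have xg : x != g by move: xE; rewrite !inE => /andP[].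
    rewrite -pairing_delta pairingDr pairingMzr !pairing_delta bhE// mxE xE mulr1.
    by rewrite -[_ *~ N%:Z]mulrzr intz; ring.
  have Ty N : (2 <= N)%N -> T' (y (pc f) + b *~ N%:Z).
    move=> N2; split.
    - move=> x xE; rewrite -pairing_delta pairingDr pairingMzr !pairing_delta b0// mxE.
      rewrite (negPf xE) mulr0 subr0 mul0rz addr0; case: (boolP (x \in pc f)) => // xf.
      by rewrite (subsetP (pclass_sub _ _ _ _ _) _ xf) in xE.
    - by rewrite wE// bhE 1?eq_sym// be mul0r add0r subrr.
    by move=> V VV; apply: (bump_mintwice se UE bhU bhV fE N2 (s := s') (w := y (pc f) + b *~ N%:Z) (wE N)).
  have [w lw wy] := fan_local_ex F sD Ty; exists w => _; split=> //.
  have [N wN] := bound_exists w; pose M := N.+2.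
  have [|c [cD cE cz]] := local_comb F lw (N := M).
    by move=> i; apply: le_trans (wN i) _; rewrite lez_nat /M; lia.
  have ph1 := phiP cD; rewrite -cz wy in ph1.
  have M2 : (2 <= M)%N by [].
  have ph2 := bump_phi se UE bhU bhV bhphi fE M2 (s := s') (w := y (pc f) + b *~ M%:Z) (wE M).
  have := isphi_unique ph1 ph2; rewrite bhg.
  have -> : \sum_v (c v)%:Z * phi v = \sum_v w v * phi v + tt * M%:Z.
    rewrite /tt mulr_suml [X in _ = _ + X]big_mkcond -big_split /=; apply: eq_bigr => v _.
    by rewrite cE; case: (v \in s); rewrite ?mulr1 ?mulr0; ring.
  by rewrite addrC => /addrI.
exists (fun v => \sum_(P in cls) z P v); split.
- move=> v cv; have [P Pc zv] : exists2 P, P \in cls & z P v != 0.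
    apply: NNPP => none; case/eqP: cv; apply: big1 => P Pc; apply/eqP; apply: contraT => zv.
    by case: none; exists P.
  have [[_ lD] _ _] := zP P Pc; apply: (dD lD); rewrite setSU// sub1set inE //.
- move=> v vs; apply: sumr_ge0 => P Pc; have [[l0 _] _ _] := zP P Pc; exact: l0.
- have -> : combz u (fun v => \sum_(P in cls) z P v) = \sum_(P in cls) y P.
    rewrite /combz; under eq_bigr => v _ do rewrite mulrz_sumr.
    by rewrite exchange_big /=; apply: eq_bigr => P Pc; have [_ <- _] := zP P Pc.
  apply/rowP => x; rewrite summxE mxE; under eq_bigr => P _ do rewrite mxE.
  by rewrite sumrB -mulr_suml !cls_sum e0E' mul1r subrr.
under eq_bigr => v _ do rewrite mulr_suml.
rewrite exchange_big /= (eq_bigr (fun P : {set 'I_n} => - (e0 \in P)%:Z)) => [|P Pc].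
  by rewrite sumrN cls_sum e0E'.
by have [_ _ ->] := zP P Pc.
Qed.

Lemma T'g (x : 'rV[int]_n) : T' x -> x 0 g = 0.
Proof. by case=> x0 _ _; apply: x0; rewrite !inE eqxx. Qed.

Lemma step_proj (x : 'rV[int]_n) : T x -> T' (x - delta_mx 0 g *~ x 0 g).
Proof.
move=> [x0 xe xU].
have E1 y : y != g -> (x - delta_mx 0 g *~ x 0 g) 0 y = x 0 y.
  move=> yg; rewrite -[LHS]pairing_delta pairingBr pairingMzr !pairing_delta mxE eqxx /=.
  by rewrite (negPf yg) mul0rz subr0.
have E2 : (x - delta_mx 0 g *~ x 0 g) 0 g = 0.
  by rewrite -[LHS]pairing_delta pairingBr pairingMzr !pairing_delta mxE !eqxx intz subrr.
split.
- move=> y; rewrite in_setD1 negb_and negbK; case: eqP => [->//|/eqP yg] /= yE.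
  by rewrite E1// x0.
- by rewrite E1// eq_sym.
move=> V; rewrite inE => /andP[VUU gV].
suff -> : mintwice (x - delta_mx 0 g *~ x 0 g) V = mintwice x V by exact: xU.
apply: eq_mintwice => a y aV yV.
by rewrite !E1//; apply: contraNneq gV => <-.
Qed.

Lemma step_lift c z : supp c \in D ->
  (T (comb u c + delta_mx 0 g *~ z) <->
   z = \sum_v (c v)%:Z * phi v \/ (\sum_v (c v)%:Z * phi v < z /\ supp c \in D2)).
Proof.
move=> cD; set x := comb u c + _; set tt := \sum_v _.
have Tc := fan_in F cD; have [c0 ce cU] := Tc.
have E1 y : y != g -> x 0 y = comb u c 0 y.
  move=> yg; rewrite -[LHS]pairing_delta pairingDr pairingMzr !pairing_delta mxE eqxx /=.
  by rewrite (negPf yg) mul0rz addr0.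
have E2 : x 0 g = z.
  by rewrite -[LHS]pairing_delta pairingDr pairingMzr !pairing_delta mxE !eqxx intz (T'g Tc) add0r.
have xphi : isphi UU g x tt by apply: (isphi_ext _ (phiP cD)) => y yg; rewrite E1.
have x0 y : y \notin E -> x 0 y = 0.
  move=> yE; have yg : y != g by apply: contraNneq yE => ->.
  by rewrite E1// c0// in_setD1 negb_and yE orbT.
have xe : x 0 e0 = 0 by rewrite E1// eq_sym.
have xdel V : V \in deletion UU g -> mintwice x V.
  move=> VV; suff -> : mintwice x V = mintwice (comb u c) V by exact: cU.
  apply: eq_mintwice => a y aV yV.
  have gV : g \notin V by move: VV; rewrite inE => /andP[].
  by rewrite !E1//; apply: contraNneq gV => <-.
have con_eq V : V \in contraction UU g -> mintwice x V = mintwice (comb u c) V.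
  case/imsetP => U _ ->; apply: eq_mintwice => a y; rewrite !in_setD1 => /andP[ag _] /andP[yg _].
  by rewrite !E1.
split=> [[_ _ xU]|[zt|[lt cD2]]].
- have := isphi_le xU xphi; rewrite E2 le_eqVlt => /orP[/eqP ->|lt]; [by left | right].
  split=> //; apply/T''_comb => //; split=> // V VV.
  by rewrite -con_eq//; apply: (mintwice_above xU xphi _ VV); rewrite E2.
- by split=> //; apply: (mintwice_graph se nonloop xdel xphi); rewrite E2.
split=> // U UUU; have [_ _ h] := (T''_comb cD).2 cD2.
apply: (mintwice_below (w := x) _ xphi) => //; last by rewrite E2 ltW.
by move=> V VV; rewrite con_eq// h.
Qed.

End Step.

Definition has_HPD_fan n (T : 'rV[int]_n -> Prop) d :=
  exists r (D : {set {set 'I_r}}) (u : 'I_r -> 'rV[int]_n), fan T D u /\ HPD D u d.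

(** Blowing up until all coordinate differences are unmixed makes phi linear on cones and turns the
    space of the contraction into a subfan; [HPD_indep] gives that subfan its duality from any other
    fan on it. *)
Lemma HPD_step n (e0 g : 'I_n) (UU : {set {set 'I_n}}) (E : {set 'I_n}) d d2 :
  selim UU -> (forall U, U \in UU -> U \subset E) -> e0 \in E -> g != e0 ->
  (exists2 U, U \in UU & g \in U) -> (forall U, U \in UU -> g \in U -> U :\ g != set0) ->
  has_HPD_fan (TL e0 (deletion UU g) (E :\ g)) d ->
  has_HPD_fan (TL e0 (contraction UU g) (E :\ g)) d2 ->
  has_HPD_fan (TL e0 UU E) d.
Proof.
move=> se UE e0E ge0 gdep nonloop.
have gE : g \in E by have [U UUU] := gdep; apply/subsetP/UE.
move=> [r1 [D1 [u1 [F1 H1]]]] [r2 [Dc [uc [Fc Hc]]]].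
have [|r [D [u [F H um]]]] := subdivide (P := fun r D u => HPD D u d) _
    [seq (delta_mx 0 ac.1 - delta_mx 0 ac.2 : 'rV[int]_n) | ac <- enum {: 'I_n * 'I_n}] F1 H1.
  by move=> r D u i j ij tD F H; apply: HPD_blowup => //; apply: (fan_dc F).
have coh (a c : 'I_n) : unmixed D u (delta_mx 0 a - delta_mx 0 c).
  by apply: um; apply/mapP; exists (a, c); rewrite ?mem_enum.
have [phi phiP] := phi_exists gdep nonloop F coh.
have F2 := fan_D2 F coh; have H2 := HPD_indep Fc Hc F2.
have D2dc := D2_dclosed F coh; have D2s : D2 g UU D u \subset D by exact: D2D.
exists r.+1, (modif D (D2 g UU D u)), (umodif u phi g); split.
  apply: (fan_modif F D2dc D2s); first exact: T'g.
    by move=> c z cD; apply: (step_lift se gE ge0 nonloop F coh phiP).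
  by move=> x; apply: step_proj.
apply: (HPD_modif (fan_dc F) (fan_uni F) D2dc D2s _ _ _ H H2) => [s sD sD2|s sD2|v vD].
- exact: (step_linear se nonloop F coh phiP).
- exact: (step_bends se UE e0E gE ge0 F coh phiP).
by apply: (u_g F _ vD) => x; apply: T'g.
Qed.

(** * Free matroids *)

Section ProjectiveSpace.
Variables (n : nat) (e0 : 'I_n) (E : {set 'I_n}).
Hypothesis e0E : e0 \in E.
Local Notation T := (TL e0 set0 E).
Local Notation eps a := (delta_mx 0 a : 'rV[int]_n).

Definition Dproj : {set {set 'I_n}} := [set K : {set 'I_n} | K \proper E].
Definition uproj (v : 'I_n) : 'rV[int]_n :=
  if v == e0 then - \sum_(a in E :\ e0) eps a else if v \in E then eps v else 0.

Lemma uprojE v a : uproj v 0 a =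
  if a \in E :\ e0 then (if v == e0 then -1 else (v == a)%:Z) else 0.
Proof.
rewrite -pairing_delta /uproj; case: (eqVneq v e0) => [_|ve].
  rewrite pairingNr pairing_sumr; case: ifP => aE.
    rewrite (bigD1 a)//= pairing_delta mxE !eqxx big1 ?addr0// => x /andP[_ xa].
    by rewrite pairing_delta mxE eqxx eq_sym (negPf xa).
  rewrite big1 ?oppr0// => x xE; rewrite pairing_delta mxE eqxx /=.
  by case: eqP => // ax; rewrite -ax aE in xE.
case: ifP => vE; rewrite pairing_delta mxE ?eqxx /=; last first.
  by case: ifP => //; case: eqP => // <-; rewrite in_setD1 vE andbF.
rewrite eq_sym; case: ifP => //; case: eqP => // <-.
by rewrite in_setD1 vE ve.
Qed.

Lemma comb_uproj c a : comb uproj c 0 a = if a \in E :\ e0 then (c a)%:Z - (c e0)%:Z else 0.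
Proof.
rewrite /comb summxE; under eq_bigr => v _ do rewrite mulmxnE uprojE.
case: ifP => aE; last by rewrite big1// => v _; rewrite mul0rn.
have ae : a != e0 by move: aE; rewrite in_setD1 => /andP[].
rewrite (bigD1 a)//= (bigD1 e0) 1?eq_sym//= big1 => [|v /andP[va ve]].
  by rewrite !eqxx eq_sym (negPf ae) addr0 mulNrn !natz.
by rewrite (negPf ve) (negPf va) mul0rn.
Qed.

Lemma fan_proj : fan T Dproj uproj.
Proof.
split.
- by move=> s t; rewrite !inE => sE ts; apply: sub_proper_trans ts sE.
- move=> s k; rewrite inE => /properP [sE [l lE ls]] ks.
  have kE := subsetP sE k ks; have kl : k != l by apply: contraNneq ls => <-.
  have [ke|ke] := eqVneq k e0.
    have le : l != e0 by rewrite -ke eq_sym.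
    exists (- eps l); rewrite pairingC pairingNr pairingC pairing_delta uprojE ke eqxx in_setD1 lE le.
    split=> // x xs xe; rewrite pairingC pairingNr pairingC pairing_delta uprojE in_setD1 lE le (negPf xe).
    by case: eqP xs ls => // -> ->.
  have [e0s|e0s] := boolP (e0 \in s).
    have le : l != e0 by apply: contraNneq ls => ->.
    exists (eps k - eps l); split=> [|x xs xk]; rewrite pairingBl !pairing_delta !uprojE !in_setD1 lE
      le ke kE /=.
      by rewrite (negPf ke) eqxx (negPf kl).
    case: eqP => // _; rewrite (negPf xk); case: eqP xs ls => // -> ->.
    by [].
  exists (eps k); split=> [|x xs xk]; rewrite pairing_delta uprojE in_setD1 ke kE /=.
    by rewrite (negPf ke) eqxx.
  by rewrite (negPf xk); case: eqP xs e0s => // -> ->.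
- move=> c cD; split; last by move=> U; rewrite inE.
    by move=> x xE; rewrite comb_uproj in_setD1 (negPf xE) andbF.
  by rewrite comb_uproj !inE eqxx.
- move=> x [x0 xe _].
  (* Subtracting the minimum over E makes all coefficients nonnegative and drops one ray. *)
  have [a aE am] := @argmin_exists _ x E (ltac:(by apply/set0Pn; exists e0)).
  pose c v := if v \in E then absz (x 0 v - x 0 a)%R else 0%N.
  have cE v : v \in E -> (c v)%:Z = x 0 v - x 0 a.
    by move=> vE; rewrite /c vE gez0_abs// subr_ge0 am.
  exists c.
    rewrite inE; apply/properP; split.
      by apply/subsetP => v; rewrite inE /c; case: ifP.
    by exists a => //; rewrite inE /c aE subrr.
  apply/rowP => v; rewrite comb_uproj in_setD1.
  have [->|ve] /= := eqVneq v e0; first by rewrite xe.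
  case: ifP => [vE|/negbT /x0 ->//]; rewrite !cE// xe; ring.
move=> c c'; rewrite !inE => /properP [cE [a aE ca]] /properP [cE' [a' aE' ca']] h.
have eqd v : v \in E -> (c v)%:Z - (c e0)%:Z = (c' v)%:Z - (c' e0)%:Z.
  have [->|ve] := eqVneq v e0; first by rewrite !subrr.
  by move=> vE; have := comb_uproj c v; rewrite h comb_uproj in_setD1 ve vE.
move: ca ca'; rewrite !inE !negbK => /eqP ca /eqP ca'.
have := eqd a aE; have := eqd a' aE'; rewrite ca ca' => h1 h2 v.
have [vE|vE] := boolP (v \in E); first by have := eqd v vE; lia.
have c0 (k : 'I_n -> nat) : supp k \subset E -> k v = 0%N.
  by move=> kE; apply/eqP; apply: contraNT vE => kv; apply: (subsetP kE); rewrite inE.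
by rewrite !c0.
Qed.

Local Notation h := (mvar e0).

Definition tohyp : {rmorphism mpoly n -> {poly int}} := meval (fun v => if v \in E then 'X else 0).

Lemma tohyp_xs (K : {set 'I_n}) : tohyp (xs K) = if K \subset E then 'X^#|K| else 0.
Proof.
rewrite rmorph_xs; under eq_bigr => v _ do rewrite /tohyp meval_var.
case: ifP => [KE|/negbT /subsetPn [v vK vE]].
  by rewrite (eq_bigr (fun=> 'X)) ?prodr_const// => v vK; rewrite (subsetP KE).
by rewrite (bigD1 v)//= (negPf vE) mul0r.
Qed.

Lemma ceq_h D v : v \in E -> ceq D uproj (mvar v) h.
Proof.
move=> vE; have [->|ve] := eqVneq v e0; first exact: ceq_refl.
rewrite /ceq; have -> : mvar v - h = pl (fun w => pairing (eps v) (uproj w)).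
  rewrite /pl (bigD1 v)//= (bigD1 e0) 1?eq_sym//= big1 => [|x /andP[xv xe]].
    by rewrite !pairing_delta !uprojE !in_setD1 vE ve !eqxx (negPf ve) addr0.
  by rewrite pairing_delta uprojE in_setD1 vE ve (negPf xe) (negPf xv).
by rewrite -[pl _]mul1r; apply: cid_lin.
Qed.

Lemma ceq_h_xs D (K : {set 'I_n}) : K \subset E -> ceq D uproj (xs K) (h ^+ #|K|).
Proof.
elim/finset_ind: K => [|v K vK IH] KE; first by rewrite xs0 cards0 expr0; apply: ceq_refl.
move: KE; rewrite subUset sub1set => /andP[vE KE].
rewrite xsU1// cardsU1 vK add1n exprS; apply: ceq_trans (ceqM _ (IH KE)) _.
by apply: ceqMr; apply: ceq_h.
Qed.

(** Every variable of E is congruent to h, so the star of s has the ring of polynomials in h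
    truncated above degree k, where [k = d - #|s|]; the power dual to [h ^+ j] is [h ^+ (k - j)]. *)
Lemma HPD_proj : HPD Dproj uproj #|E|.-1.
Proof.
set d := #|E|.-1; have cE : #|E| = d.+1 by rewrite /d prednK// card_gt0; apply/set0Pn; exists e0.
have inD (s : {set 'I_n}) : s \in Dproj -> s \subset E /\ (#|s| <= d)%N.
  by rewrite inE => sE; split; [apply: proper_sub | rewrite -ltnS -cE; apply: proper_card].
split.
  split=> [s /inD []//|s _]; exists (E :\ e0).
    by rewrite inE properD1.
  by apply/eqP; rewrite -eqSS -cE [#|E|](cardsD1 e0) e0E add1n.
pose deg (p : mpoly n) := (tohyp p)`_d.
have degP : is_degree Dproj uproj d deg.
  split=> [p q|p|s sD]; first by rewrite /deg rmorphD coefD.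
    elim=> [a K KD|a m|p1 p2 _ I1 _ I2]; last by rewrite /deg rmorphD coefD -/(deg p1) -/(deg p2) I1 I2.
      rewrite /deg rmorphM tohyp_xs; case: ifP => KE; last by rewrite mulr0 coef0.
      have -> : K = E by move: KD; rewrite inE properE KE negbK => EK; apply/eqP; rewrite eqEsubset KE.
      by rewrite coefMXn cE ltnSn.
    rewrite /deg rmorphM rmorph_pl; set S := \sum_i _; suff -> : S = 0 by rewrite mulr0 coef0.
    transitivity ('X *~ pairing m (\sum_(v in E) uproj v) : {poly int}).
      rewrite pairing_sumr mulrz_sumr /S [RHS]big_mkcond; apply: eq_bigr => v _.
      by rewrite /tohyp meval_var; case: ifP => _; rewrite ?mul0rz.
    suff -> : \sum_(v in E) uproj v = 0 by rewrite pairing0r mulr0z.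
    rewrite (bigD1 e0)//= {1}/uproj eqxx; apply/eqP; rewrite addrC subr_eq0; apply/eqP.
    apply: eq_big => [v|v /andP[vE /negPf ve]]; first by rewrite in_setD1 andbC.
    by rewrite /uproj ve vE.
  by rewrite /deg tohyp_xs (inD s sD).1 coefXn eq_sym natz.
exists deg => // s sD; have [sE sd] := inD s sD; set k := (d - #|s|)%N.
have hk : cid (star Dproj s) uproj (h ^+ k.+1).
  have -> : k.+1 = #|E :\: s| by rewrite cardsDS// cE /k; lia.
  apply: (ceq_cid (ceq_sym (ceq_h_xs _ (subsetDl E s)))).
  rewrite -[xs _]mulr1; apply: cid_notin; rewrite inE.
  have -> : E :\: s :|: s = E by apply/setP => v; rewrite !inE;
    case: (boolP (v \in s)) => [/(subsetP sE) ->|]; rewrite /= ?orbT ?orbF.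
  by rewrite inE properxx.
have reduce (p : mpoly n) : ceq (star Dproj s) uproj p (\sum_(j < k.+1) h ^+ j *~ (tohyp p)`_j).
  elim/mpoly_mon_ind: p => [p q Ip Iq||v p Ip].
  - rewrite (eq_bigr (fun j : 'I_k.+1 => h ^+ j *~ (tohyp p)`_j - h ^+ j *~ (tohyp q)`_j)) => [|j _];
    last first.
      by rewrite rmorphB coefB mulrzBr.
    rewrite sumrB /ceq; set A := \sum_(j < _) _; set B := \sum_(j < _) _.
    rewrite (_ : p - q - (A - B) = (p - A) - (q - B)); [exact: cidB | by rewrite !opprB addrACA
      [RHS]addrACA; congr (_ + _); rewrite addrC].
  - rewrite big_ord_recl rmorph1 coef1 big1 ?addr0 => [|j _]; first exact: ceq_refl.
    by rewrite coef1 mulr0z.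
  have [vE|vE] := boolP (v \in E); last first.
    rewrite big1 => [|j _]; first by apply: ceq0; apply: cid_mvar; rewrite !inE;
      apply: contra vE => /proper_sub; rewrite subUset sub1set => /andP[].
    by rewrite rmorphM /tohyp meval_var (negPf vE) mul0r coef0 mulr0z.
  apply: ceq_trans (ceqMr p (ceq_h _ vE)) _; apply: ceq_trans (ceqM h Ip) _.
  have tv : tohyp (mvar v * p) = 'X * tohyp p by rewrite rmorphM {1}/tohyp meval_var vE.
  rewrite big_ord_recr big_ord_recl /= tv coefXM mulr0z add0r mulrDr.
  rewrite -[X in ceq _ _ _ X]addr0; apply: ceqD; last first.
    by apply: ceq0; rewrite mulrzAr -exprS; apply: cidMz.
  rewrite mulr_sumr; rewrite (eq_bigr (fun j : 'I_k => h ^+ (bump 0 j) *~ ('X * tohyp p)`_(bump 0 j))).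
    exact: ceq_refl.
  by move=> j _; rewrite coefXM /= mulrzAr exprS.
exists [seq (h ^+ (k - j), h ^+ j) | j <- iota 0 k.+1] => p.
apply: ceq_trans (reduce p) _; rewrite big_map -(big_mkord xpredT (fun j =>
  h ^+ j *~ (tohyp p)`_j)) /index_iota subn0.
rewrite (eq_big_seq (fun j => h ^+ j *~ deg (xs s * (p * h ^+ (k - j))))) => [|j]; first exact: ceq_refl.
rewrite mem_iota add0n => /andP[_ jk]; congr (_ *~ _).
rewrite /deg !rmorphM tohyp_xs sE rmorphXn {2}/tohyp meval_var e0E mulrCA -exprD coefMXn.
have -> : (#|s| + (k - j) = d - j)%N by rewrite /k; lia.
by rewrite ltnNge leq_subr /= subKn//; move: jk; rewrite /k; lia.
Qed.

End ProjectiveSpace.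

(* Induction on the ground set: delete and contract g, or reach a free matroid,
   whose tropical linear space carries the fan of projective space. *)
Theorem TL_HPD n (e0 : 'I_n) (UU : {set {set 'I_n}}) (E : {set 'I_n}) :
  selim UU -> (forall U, U \in UU -> U \subset E) -> e0 \in E ->
  exists d, has_HPD_fan (TL e0 UU E) d.
Proof.
have [k] := ubnP #|E|; elim: k UU E => // k IH UU E Ek se UE e0E.
have [[w Tw]|none] := classic (exists w, TL e0 UU E w); last first.
  (* Contraction can create loops, after which no point satisfies the minimum condition; the empty
     complex then carries the empty space. *)
  exists 0%N, 0%N, set0, (fun=> 0); split.
    split=> //.
    - by move=> s t; rewrite inE.
    - by move=> s t; rewrite inE.
    - by move=> c; rewrite inE.
    - by move=> x Tx; case: none; exists x.
    by move=> c c'; rewrite inE.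
  split; first by split=> s; rewrite inE.
  exists (fun=> 0) => [|s]; last by rewrite inE.
  by split=> // s; rewrite inE.
have [_ _ wU] := Tw.
have [[g [ge0 [U UUU gU]]]|free] := classic (exists g, g != e0 /\ exists2 U, U \in UU & g \in U).
  have gE : g \in E := subsetP (UE U UUU) g gU.
  have Eg : (#|E :\ g| < k)%N by move: Ek; rewrite (cardsD1 g) gE.
  have nl V : V \in UU -> g \in V -> V :\ g != set0.
    move=> VUU gV; have /mintwiceP [a [c [aV cV ac _ _]]] := wU V VUU.
    have [ag|ag] := eqVneq a g; apply/set0Pn; [exists c | exists a]; rewrite !inE ?aV ?cV ?andbT//.
    by rewrite -ag eq_sym.
  have e0Eg : e0 \in E :\ g by rewrite !inE e0E eq_sym ge0.
  have [d H1] := IH (deletion UU g) (E :\ g) Eg (selim_deletion se) (ltac:(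
    by move=> V; rewrite inE => /andP[VUU gV]; rewrite subsetD1 UE)) e0Eg.
  have [d2 H2] := IH (contraction UU g) (E :\ g) Eg (selim_contraction se) (ltac:(
    by move=> V' /imsetP [V VUU ->]; apply: setSD; apply: UE)) e0Eg.
  by exists d; apply: (HPD_step se UE e0E ge0 _ nl H1 H2); exists U.
(* A minimum attained twice forces two elements in every member of [UU], one of them different from
   [e0]; as no such element lies in a member, [UU] is empty. *)
have -> : UU = set0.
  apply/setP => U; rewrite inE; apply/negP => UUU.
  have /mintwiceP [a [c [aU cU ac _ _]]] := wU U UUU.
  have [ae|ae] := eqVneq a e0; apply: free; [exists c | exists a]; split=> //; try by exists U.
  by rewrite -ae eq_sym.
by exists #|E|.-1, n, (Dproj E), (uproj e0 E); split; [apply: fan_proj | apply: HPD_proj].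
Qed.

(** * Graded components *)

Section Homogeneous.
Variable r : nat.
Implicit Types (p q : mpoly r) (k l : nat) (K : {set 'I_r}).

Lemma homogD k p q : homog k p -> homog k q -> homog k (p + q).
Proof.
move=> [c ->] [c' ->]; exists (fun t => c t + c' t); rewrite -big_split.
by apply: eq_bigr => t _; rewrite mulrzDr.
Qed.

Lemma homog0 k : homog k (0 : mpoly r).
Proof. by exists (fun=> 0); rewrite big1// => t _; rewrite mulr0z. Qed.

Lemma homogMz k p z : homog k p -> homog k (p *~ z).
Proof.
move=> [c ->]; exists (fun t => c t * z); rewrite mulrz_suml.
by apply: eq_bigr => t _; rewrite mulrzA.
Qed.

Lemma homogB k p q : homog k p -> homog k q -> homog k (p - q).
Proof. by move=> hp hq; apply: homogD => //; rewrite -mulrN1z; apply: homogMz. Qed.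

Lemma homog_sum k (I : Type) (s : seq I) (P : pred I) (F : I -> mpoly r) :
  (forall i, P i -> homog k (F i)) -> homog k (\sum_(i <- s | P i) F i).
Proof. by move=> hF; apply: big_ind => //; [apply: homog0 | apply: homogD]. Qed.

Lemma homog_mon k (t : k.-tuple 'I_r) : homog k (\prod_(i <- t) mvar i).
Proof.
exists (fun t' => (t' == t)%:Z); rewrite (bigD1 t)//= eqxx mulr1z.
by rewrite [X in _ = _ + X]big1 ?addr0// => t' /negPf ->; rewrite mulr0z.
Qed.

Lemma homogM k l p q : homog k p -> homog l q -> homog (k + l) (p * q).
Proof.
move=> [c ->] [c' ->]; rewrite mulr_suml; apply: homog_sum => t _.
rewrite mulr_sumr; apply: homog_sum => t' _; rewrite mulrzAr mulrzAl.
by do 2![apply: homogMz]; rewrite -big_cat; apply: (homog_mon [tuple of t ++ t']).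
Qed.

Lemma homog1 : homog 0 (1 : mpoly r).
Proof. by have := homog_mon [tuple]; rewrite big_nil. Qed.

Lemma homog_mvar i : homog 1 (mvar i : mpoly r).
Proof. by have := homog_mon [tuple i]; rewrite big_seq1. Qed.

Lemma homog_xs K : homog #|K| (xs K).
Proof.
elim/finset_ind: K => [|i K iK IH]; first by rewrite cards0 xs0; apply: homog1.
by rewrite cardsU1 iK xsU1//; apply: homogM; first exact: homog_mvar.
Qed.

Definition grading : {rmorphism mpoly r -> {poly mpoly r}} := meval (fun i => (mvar i)%:P * 'X).
Definition component k p : mpoly r := (grading p)`_k.

Lemma grading_homog k p : homog k p -> grading p = p%:P * 'X^k.
Proof.
move=> [c ->]; rewrite !rmorph_sum mulr_suml; apply: eq_bigr => t _.
rewrite !rmorphMz mulrzAl !rmorph_prod; congr (_ *~ _).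
rewrite (eq_bigr (fun i => (mvar i)%:P * 'X)) => [|i _]; last exact: meval_var.
by rewrite big_split /= big_const_seq count_predT iter_mulr_1 size_tuple.
Qed.

Lemma component_homog k l p : homog k p -> component l p = if l == k then p else 0.
Proof.
move=> hp; rewrite /component (grading_homog hp) coefCM coefXn.
by case: eqP; rewrite ?mulr1 ?mulr0.
Qed.

Lemma componentB k p q : component k (p - q) = component k p - component k q.
Proof. by rewrite /component rmorphB coefB. Qed.

Lemma componentD k p q : component k (p + q) = component k p + component k q.
Proof. by rewrite /component rmorphD coefD. Qed.

Lemma component_sum k (I : Type) (s : seq I) (F : I -> mpoly r) :
  component k (\sum_(i <- s) F i) = \sum_(i <- s) component k (F i).
Proof. by rewrite /component rmorph_sum coef_sum. Qed.

Lemma componentMz k p z : component k (p *~ z) = component k p *~ z.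
Proof. by rewrite /component rmorphMz coefMrz. Qed.

Lemma component_mul l k p q : homog l q ->
  component k (p * q) = if (k < l)%N then 0 else component (k - l) p * q.
Proof.
move=> hq; rewrite /component rmorphM (grading_homog hq) mulrA coefMXn.
by case: ifP => // _; rewrite coefMC.
Qed.

Lemma homog_component k p : homog k (component k p).
Proof.
elim/mpoly_mon_ind: p k => [p q hp hq|| i p hp] k.
- by rewrite componentB; apply: homogB.
- rewrite (component_homog _ homog1); case: eqP => [->|_]; [exact: homog1 | exact: homog0].
rewrite mulrC (component_mul _ _ (homog_mvar i)); case: k => [|k]; first exact: homog0.
by have := homogM (hp k) (homog_mvar i); rewrite addn1 subn1.
Qed.

Lemma sum_components p : p = \sum_(k < size (grading p)) component k p.
Proof.
suff {1}<- : (grading p).[1] = p.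
  by rewrite horner_coef; apply: eq_bigr => k _; rewrite expr1n mulr1.
pose h : {rmorphism {poly mpoly r} -> mpoly r} := horner_eval 1.
pose g : {rmorphism mpoly r -> mpoly r} := h \o grading.
apply: (meval_ext (f := g) (g := idfun)) => i.
by rewrite /= /horner_eval /grading meval_var hornerM hornerX mulr1 hornerC.
Qed.
End Homogeneous.
Arguments grading {r}.

Lemma cid_component r n (D : {set {set 'I_r}}) (u : 'I_r -> 'rV[int]_n) k p :
  cid D u p -> cid D u (component k p).
Proof.
have mono l q : homog l q -> (forall a, cid D u (a * q)) -> forall a, cid D u (component k (a * q)).
  by move=> hq Iq a; rewrite (component_mul _ _ hq); case: ifP => // _; apply: cid0.
elim=> [a K KD|a m|p1 p2 _ I1 _ I2].
- by apply: (mono _ _ (homog_xs K)) => b; apply: cid_face.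
- apply: (mono 1%N) => [|b]; last exact: cid_lin.
  by apply: homog_sum => i _; apply/homogMz/homog_mvar.
by rewrite componentD; apply: cid_add.
Qed.

Section PoincareDuality.
Variables (r n : nat) (D : {set {set 'I_r}}) (u : 'I_r -> 'rV[int]_n) (d : nat).
Hypotheses (D0 : set0 \in D) (dD : dclosed D) (uD : unimodular D u).
Implicit Types (p q : mpoly r).

Lemma homog_span k p : homog k p -> span D u set0 (fun l => l = k) p.
Proof.
move=> [c ->]; apply: span_sum => t _; apply: spanMz.
rewrite -[in fun l => l = k](size_tuple t); elim: {t}(tval t) => [|i s IH] /=.
  by rewrite big_nil -(xs0 r); apply: span_xs; rewrite ?cards0// disjoints_subset sub0set.
by rewrite big_cons; apply: (span_mvar uD i _ IH) => l ->.
Qed.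

Lemma homog_cid k p : (forall s, s \in D -> #|s| != k) -> homog k p -> cid D u p.
Proof.
move=> Dk /homog_span [c [cP]]; rewrite star0 big1 => [|K _]; first by rewrite /ceq subr0.
have [->|/cP [_ KD Kk]] := eqVneq (c K) 0; first by rewrite mulr0z.
by have := Dk K; rewrite -{1}[K]setU0 => /(_ KD); rewrite Kk eqxx.
Qed.

Lemma deg_homog deg k p : is_degree D u d deg -> k != d -> homog k p -> deg p = 0.
Proof.
move=> [degD degI degx] kd /homog_span [c [cP]]; rewrite star0 => /degI /eqP.
rewrite additiveB// subr_eq0 => /eqP ->; rewrite (additive_sum degD) big1// => K _.
rewrite (additiveMz degD); have [->|/cP [_ KD Kk]] := eqVneq (c K) 0; first by rewrite mulr0z.
by rewrite degx ?Kk ?(negPf kd) ?mul0rz//; move: KD; rewrite setU0.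
Qed.

Lemma deg_component deg k p a : is_degree D u d deg -> (k <= d)%N -> homog k p ->
  deg (p * a) = deg (p * component (d - k) a).
Proof.
move=> degP kd hp; have [degD _ _] := degP.
have [N [aE Nd]] : exists N, a = \sum_(j < N) component j a /\ (d - k < N)%N.
  exists (size (grading a) + (d - k).+1)%N; split; last lia.
  rewrite -(big_mkord xpredT (fun j => component j a)) (@big_cat_nat _ _ _ (size (grading a))) ?leq_addr//=.
  rewrite big_mkord -sum_components big_nat_cond big1 ?addr0// => j /andP[/andP[h _] _].
  by rewrite /component nth_default.
rewrite {1}aE mulr_sumr (additive_sum degD) (bigD1 (Ordinal Nd))//= big1 ?addr0// => j jd.
apply: (deg_homog degP) (homogM hp (homog_component _ _)).
apply: contraNneq jd => E; apply/eqP/val_inj => /=; lia.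
Qed.

(** The second legs of the Casimir element generate the ring, and the expansion shows that the
    pairing is faithful. Applying a functional to the expansion represents it by the first legs,
    weighted by its values on the second ones. *)
Theorem HPD_poincare : HPD D u d -> poincare_duality (cid D u) d.
Proof.
move=> [[Dle Dex] [deg degP dual]]; have [degD degI degx] := degP.
have [ks ksP] := dual _ D0; rewrite star0 xs0 in ksP.
have {}ksP p : ceq D u p (\sum_(ab <- ks) ab.2 *~ deg (p * ab.1)).
  by have := ksP p; under eq_bigr => ab _ do rewrite mul1r.
split.
- exists (size ks), (fun i => (nth (0, 0) ks i).2) => p.
  exists (fun i => deg (p * (nth (0, 0) ks i).1)).
  by have := ksP p; rewrite (big_nth (0, 0)) big_mkord.
- by move=> k kd p; apply: homog_cid => s /Dle sd; apply: contraTneq kd => <-; rewrite -leqNgt.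
have faithful k p : (k <= d)%N -> homog k p ->
    (forall q, homog (d - k) q -> deg (p * q) = 0) -> cid D u p.
  move=> kd hp h; apply: (ceq_cid (ksP p)); apply: cid_sum => ab _.
  by rewrite (deg_component _ degP kd hp) h ?mulr0z; [exact: cid0 | exact: homog_component].
exists deg; split=> //.
- have [t tD td] := Dex _ D0; move=> z; exists (xs t *~ z).
    by rewrite -td; apply/homogMz/homog_xs.
  by rewrite (additiveMz degD) degx// td eqxx intz.
- move=> p hp; split=> [p0|]; last exact: degI.
  apply: (faithful d p) => // q; rewrite subnn => -[c ->].
  rewrite mulr_sumr (additive_sum degD) big1// => t _.
  by rewrite tuple0 big_nil mulrzAr (additiveMz degD) mulr1 p0 mul0rz.
move=> k phi kd phiD phiI.
have phi0 : phi 0 = 0.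
  by apply: (addrI (phi 0)); rewrite -phiD ?addr0//; apply: homog0.
have phiMn q j : homog (d - k) q -> phi (q *+ j) = phi q *+ j.
  move=> hq; elim: j => [|j IH]; first by rewrite !mulr0n.
  by rewrite !mulrS phiD ?IH// pmulrn; apply: homogMz.
have phiN q : homog (d - k) q -> phi (- q) = - phi q.
  move=> hq; apply: (addrI (phi q)); rewrite -phiD ?subrr//.
  by rewrite -mulrN1z; apply: homogMz.
have phiMz q z : homog (d - k) q -> phi (q *~ z) = phi q *~ z.
  move=> hq; case: z => j; rewrite ?NegzE ?mulrNz ?phiN -?pmulrn ?phiMn//.
  by rewrite pmulrn; apply: homogMz.
have phi_sum (F : mpoly r * mpoly r -> mpoly r) : (forall ab, homog (d - k) (F ab)) ->
    phi (\sum_(ab <- ks) F ab) = \sum_(ab <- ks) phi (F ab).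
  move=> hF; elim: (ks) => [|ab l IH]; first by rewrite !big_nil.
  by rewrite !big_cons phiD ?IH//; apply: homog_sum.
exists (\sum_(ab <- ks) component k ab.1 *~ phi (component (d - k) ab.2)).
  by apply: homog_sum => ab _; apply/homogMz/homog_component.
(* The Casimir expansion of q is cut down to degree [d - k], the only degree in which additivity of
   [phi] is given. *)
move=> q hq; pose q' := \sum_(ab <- ks) component (d - k) ab.2 *~ deg (q * ab.1).
have hq' : homog (d - k) q' by apply: homog_sum => ab _; apply/homogMz/homog_component.
have Iq : cid D u (q - q').
  have := cid_component (d - k) (ksP q); rewrite componentB (component_homog _ hq) eqxx component_sum.
  by under eq_bigr => ab _ do rewrite componentMz.
have -> : phi q = phi q'.
  by have hB := homogB hq hq'; rewrite -{1}(subrK q' q) phiD// phiI// add0r.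
transitivity (\sum_(ab <- ks) phi (component (d - k) ab.2 *~ deg (q * ab.1))).
  by apply: phi_sum => ab; apply/homogMz/homog_component.
rewrite mulr_suml (additive_sum degD); apply: eq_bigr => ab _.
rewrite phiMz; last exact: homog_component.
have -> : deg (component k ab.1 *~ phi (component (d - k) ab.2) * q) =
    deg (component k ab.1 * q) *~ phi (component (d - k) ab.2).
  by rewrite mulrzAl (additiveMz degD).
rewrite !mulrzz mulrC; congr (_ * _).
have := deg_component ab.1 degP (leq_subr k d) hq.
by rewrite subKn// => ->; congr deg; apply: mulrC.
Qed.

End PoincareDuality.

(** Induction on the size of the union. If weak elimination yields W without f, some h of W is
    outside U. Eliminating h from V and W while keeping g gives X without h, so [U :|: X] is smaller
    and g can be eliminated from U and X while keeping f. *)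
Lemma circuit_elimination m (C : {set {set 'I_m}}) : is_loopfree_matroid C -> selim C.
Proof.
move=> [_ anti weak _] U V g f; have [k] := ubnP #|U :|: V|.
elim: k U V g f => // k IH U V g f Uk UC VC gU gV fU fV.
have UV : U != V by apply: contraNneq fV => <-.
have [|W WC WUV] := weak U V g UC VC UV; first by rewrite inE gU.
have subW x : x \in W -> x != g /\ (x \in U) || (x \in V).
  by move/(subsetP WUV); rewrite !inE => /andP[].
have [fW|fW] := boolP (f \in W); first by exists W.
have [h hW hU] : exists2 h, h \in W & h \notin U.
  by apply/subsetPn; apply: contra fW => WU; rewrite (anti W U WC UC WU).
have gW : g \notin W by apply/negP => /subW []; rewrite eqxx.
have hV : h \in V by have [_] := subW h hW; rewrite (negPf hU).
have small (A : {set 'I_m}) x : x \in U :|: V -> x \notin A -> A \subset U :|: V -> (#|A| < k)%N.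
  move=> xUV xA AUV; apply: leq_trans (proper_card _) Uk.
  by apply/properP; split=> //; exists x.
have VW : V :|: W \subset U :|: V.
  by apply/subsetP => x; rewrite !inE => /orP[->|/subW [_ ->]//]; rewrite orbT.
have [|X [XC gX XVW]] := IH V W h g _ VC WC hV hW gV gW.
  by apply: (small _ f) => //; rewrite inE ?fU// negb_or fV.
have hX : h \notin X by apply/negP => /(subsetP XVW); rewrite !inE eqxx.
have XUV : X \subset U :|: V by apply: subset_trans XVW (subset_trans (subsetDl _ _) VW).
have fX : f \notin X by apply/negP => /(subsetP XVW); rewrite !inE (negPf fV) (negPf fW) andbF.
have UXUV : U :|: X \subset U :|: V by rewrite subUset subsetUl.
have [|Y [YC fY YUX]] := IH U X g f _ UC XC gU gX fU fX.
  by apply: (small _ h) => //; rewrite inE ?hV ?orbT// negb_or hU.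
by exists Y; split=> //; apply: subset_trans YUX (setSD _ UXUV).
Qed.

(* Rows of the Smith basis of U have prescribed divisors, which those of V share. *)
Lemma row_divisors_factor r n m (U : 'M[int]_(r, n)) (V : 'M[int]_(r, m)) :
  (forall (a : 'rV_r) q, (exists y, a *m U = q *: y) -> exists y, a *m V = q *: y) ->
  exists X, V = U *m X.
Proof.
move=> UV; have [L uL [P uP [d _ UE]]] := int_Smith_normal_form U.
pose dd (i : 'I_r) := if (i < n)%N then d`_i else 0.
have rowU i : exists y, row i (invmx L) *m U = dd i *: y.
  have LK : row i (invmx L) *m L = delta_mx 0 i by rewrite -row_mul mulVmx// rowE mulmx1.
  rewrite UE !mulmxA LK /dd.
  case: (ltnP i n) => [ni|ni]; last first.
    exists 0; rewrite scaler0 -rowE (_ : row i _ = 0) ?mul0mx//.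
    by apply/rowP => j; rewrite !mxE; case: eqP (ltn_ord j) ni => [->|] //; lia.
  exists (row (Ordinal ni) P); rewrite -!rowE; apply/rowP => j; rewrite !mxE (bigD1 (Ordinal ni))//=.
  rewrite !mxE eqxx mulr1n big1 ?addr0// => l li; rewrite !mxE.
  by rewrite (_ : (_ == _) = false) ?mul0r//; apply/negbTE; rewrite eq_sym.
have /fin_all_exists [y yE] (i : 'I_r) : exists y, row i (invmx L) *m V = dd i *: y := UV _ _ (rowU i).
pose Y : 'M_(n, m) := \matrix_(j, k) (if insub (val j) is Some i then y i 0 k else 0).
exists (invmx P *m Y); rewrite mulmxA {1}UE mulmxK//.
have -> : V = L *m (invmx L *m V) by rewrite mulKVmx.
rewrite -mulmxA; congr (_ *m _); apply/row_matrixP => i; rewrite [LHS]row_mul yE.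
apply/rowP => k; rewrite !mxE /dd; case: (ltnP i n) => ni; last first.
  rewrite mul0r big1// => j _; rewrite !mxE (_ : (_ == _) = false) ?mul0r//.
  by apply/negbTE; have := ltn_ord j; lia.
rewrite (bigD1 (Ordinal ni))//= !mxE eqxx mulr1n insubT//= => ri.
rewrite (_ : (Sub (i : nat) ri : 'I_r) = i); last exact: val_inj.
rewrite big1 ?addr0// => l li; rewrite !mxE (_ : (_ == _) = false) ?mul0r//.
by apply/negbTE; rewrite eq_sym.
Qed.

Lemma pairing_mulmx n m (x : 'rV[int]_m) (v : 'rV[int]_n) X :
  pairing x (v *m X) = pairing (x *m X^T) v.
Proof.
have pE k (a b : 'rV[int]_k) : pairing a b = (a *m b^T) 0 0.
  by rewrite mxE; apply: eq_bigr => j _; rewrite mxE.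
by rewrite !pE trmx_mul mulmxA.
Qed.

Lemma cid_change r n n' (D : {set {set 'I_r}}) (u : 'I_r -> 'rV[int]_n) (u' : 'I_r -> 'rV[int]_n') p :
  (forall m, exists m', forall v, pairing m (u v) = pairing m' (u' v)) ->
  cid D u p -> cid D u' p.
Proof.
move=> uu'; elim=> [a K KD|a m|p1 p2 _ I1 _ I2]; [exact: cid_face | | exact: cid_add].
by have [m' mE] := uu' m; rewrite (pl_eq mE); apply: cid_lin.
Qed.

(** The case q = 0 makes the map from combinations of u to those of [u'] well defined, and q nonzero
    extends it to the saturation, a direct summand of the lattice. So it comes from an integral
    matrix, along which forms pull back. *)
Lemma pairing_transport r n m (u : 'I_r -> 'rV[int]_n) (u' : 'I_r -> 'rV[int]_m) :
  (forall (a : 'I_r -> int) q, (exists y, combz u a = y *~ q) -> exists y, combz u' a = y *~ q) ->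
  forall x', exists x, forall v, pairing x' (u' v) = pairing x (u v).
Proof.
move=> uu'; have mulE k (w : 'I_r -> 'rV[int]_k) (a : 'rV_r) : a *m (\matrix_i w i) = combz w (fun i => a 0 i).
  by rewrite mulmx_sum_row; apply: eq_bigr => i _; rewrite rowK -scaler_int intz.
have [|X XE] := @row_divisors_factor r n m (\matrix_i u i) (\matrix_i u' i).
  move=> a q [y]; rewrite !mulE => yE; have [|y' y'E] := uu' (fun i => a 0 i) q.
    by exists y; rewrite yE -scaler_int intz.
  by exists y'; rewrite y'E -scaler_int intz.
move=> x'; exists (x' *m X^T) => v; rewrite -pairing_mulmx; congr pairing.
by have := congr1 (row v) XE; rewrite row_mul !rowK.
Qed.

(** * Passage from real supports to lattice points *)

Lemma intRE z : intR z = z%:~R.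
Proof. by case: z => k; rewrite /intR ?NegzE ?mulrNz INRE. Qed.

Definition realv n (x : 'rV[int]_n) : rvec n := fun j => (x 0 j)%:~R.

Lemma realv_inj n : injective (@realv n).
Proof. by move=> x y E; apply/rowP => j; have /intr_inj := congr1 (@^~ j) E. Qed.

Lemma is_int_vecP n (x : rvec n) : is_int_vec x <-> exists z, x = realv z.
Proof.
split=> [[z zE]|[z ->]]; last by exists (fun j => z 0 j) => j; rewrite intRE.
exists (\row_j z j); apply: functional_extensionality => j.
by rewrite zE intRE /realv mxE.
Qed.

Section RealCombinations.
Variables (n r : nat) (u : 'I_r -> 'rV[int]_n).
Implicit Types (lam : 'I_r -> R) (S : {set 'I_r}).

Definition rcomb lam : rvec n := fun j => \sum_i lam i * (u i 0 j)%:~R.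

Lemma rcomb_int (c : 'I_r -> int) : rcomb (fun i => (c i)%:~R) = realv (combz u c).
Proof.
apply: functional_extensionality => j; rewrite /realv -pairing_delta pairing_combz rmorph_sum.
by apply: eq_bigr => i _; rewrite rmorphM pairing_delta mulrC.
Qed.

Lemma realv_ray i : realv (u i) = rcomb (fun k => (k == i)%:R).
Proof.
by rewrite -(combz_delta u i) -rcomb_int; congr rcomb; apply: functional_extensionality => k; case: eqP.
Qed.

Lemma rcombZ (a : R) lam : rcomb (fun i => a * lam i) = fun j => a * rcomb lam j.
Proof.
apply: functional_extensionality => j; rewrite /rcomb mulr_sumr.
by apply: eq_bigr => i _; rewrite mulrA.
Qed.

Lemma rcomb_pairing (m : 'rV[int]_n) lam :
  \sum_j (m 0 j)%:~R * rcomb lam j = \sum_i lam i * (pairing m (u i))%:~R.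
Proof.
under eq_bigr => j _ do rewrite mulr_sumr.
rewrite exchange_big; apply: eq_bigr => i _; rewrite /pairing rmorph_sum mulr_sumr.
by apply: eq_bigr => j _; rewrite rmorphM mulrCA.
Qed.

Lemma cone_ofP S x : cone_of u S x <->
  exists lam, [/\ forall i, 0 <= lam i, forall i, i \notin S -> lam i = 0 & x = rcomb lam].
Proof.
split=> -[lam [l0 lS xE]]; exists lam; split=> //.
- by move=> i; apply/RleP.
- by apply: functional_extensionality => j; rewrite xE; apply: eq_bigr => i _; rewrite intRE.
- by move=> i; apply/RleP.
by move=> j; rewrite xE; apply: eq_bigr => i _; rewrite intRE.
Qed.

Variable cones : {set {set 'I_r}}.
Hypothesis uni : unimodular cones u.

Lemma rcomb_interp S i : S \in cones -> i \in S -> exists m : 'rV[int]_n, forall lam,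
  (forall k, k \notin S -> lam k = 0) -> lam i = \sum_j (m 0 j)%:~R * rcomb lam j.
Proof.
move=> SC iS; have [m [mi ml]] := uni SC iS; exists m => lam lS.
rewrite rcomb_pairing (bigD1 i)//= mi mulr1 big1 ?addr0// => k ki.
have [kS|/lS ->] := boolP (k \in S); last by rewrite mul0r.
by rewrite ml// mulr0.
Qed.

Lemma rcomb_inj S lam lam' : S \in cones -> (forall k, k \notin S -> lam k = 0) ->
  (forall k, k \notin S -> lam' k = 0) -> rcomb lam = rcomb lam' -> lam =1 lam'.
Proof.
move=> SC lS lS' E i; have [iS|iS] := boolP (i \in S); last by rewrite lS ?lS'.
by have [m mE] := rcomb_interp SC iS; rewrite (mE _ lS) (mE _ lS') E.
Qed.

Lemma rcomb_integral S lam (x : 'rV[int]_n) : S \in cones -> (forall k, k \notin S -> lam k = 0) ->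
  rcomb lam = realv x -> exists c : 'I_r -> int, forall i, lam i = (c i)%:~R.
Proof.
move=> SC lS E; suff /fin_all_exists [c cE] (i : 'I_r) : exists z : int, lam i = z%:~R by exists c.
have [iS|iS] := boolP (i \in S); last by exists 0; rewrite lS.
have [m mE] := rcomb_interp SC iS; exists (pairing m x); rewrite (mE _ lS) E rmorph_sum.
by apply: eq_bigr => j _; rewrite rmorphM.
Qed.

End RealCombinations.

Lemma smooth_unimodular n r (u : 'I_r -> 'rV[int]_n) (cones : {set {set 'I_r}}) :
  is_smooth_fan u cones -> unimodular cones u.
Proof.
move=> [_ _ _ _ basis] s k sC ks; have [B [uB [g [gi gE]]]] := basis s sC.
have mE l : l \in s -> pairing (col (g k) (invmx B))^T (u l) = (g l == g k)%:Z.
  move=> ls; have -> : (g l == g k)%:Z = (u l *m invmx B) 0 (g k).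
    by rewrite -gE// -row_mul mulmxV// !mxE; case: eqP.
  by rewrite mxE; apply: eq_bigr => j _; rewrite !mxE mulrC.
exists (col (g k) (invmx B))^T; split=> [|l ls lk]; first by rewrite mE// eqxx.
by rewrite mE//; case: eqP => // /gi E; rewrite E ?eqxx// in lk.
Qed.

Section SmoothFan.
Variables (n r : nat) (u : 'I_r -> 'rV[int]_n) (cones : {set {set 'I_r}}).
Hypothesis smooth : is_smooth_fan u cones.
Let uni := smooth_unimodular smooth.

Lemma ray_in_cone S i : S \in cones -> cone_of u S (realv (u i)) -> i \in S.
Proof.
have [_ rays _ inter _] := smooth; move=> SC iS.
have ii : cone_of u [set i] (realv (u i)).
  apply/cone_ofP; exists (fun k => (k == i)%:R); split; last exact: realv_ray.
    by move=> k; rewrite ler0n.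
  by move=> k; rewrite inE => /negPf ->.
have /cone_ofP [lam [_ l0 lE]] := (inter _ _ (rays i) SC _).1 (conj ii iS).
apply: contraT => iS'; have : lam i = 0 by apply: l0; rewrite !inE negb_and iS' orbT.
have li k : k \notin [set i] -> lam k = 0 by move=> ki; apply: l0; rewrite inE negb_and ki.
have di k : k \notin [set i] -> (k == i)%:R = 0 :> R by rewrite inE => /negPf ->.
have <- := rcomb_inj uni (rays i) di li _ i; first by rewrite eqxx => /eqP; rewrite oner_eq0.
by rewrite -realv_ray.
Qed.

(** Every ray of a generating set K of a cone S is a ray of S, so K is a face. This reconciles the
    two descriptions of nonfaces. *)
Lemma spans_cone_in K : spans_cone u cones K -> K \in cones.
Proof.
have [_ rays dc _ _] := smooth; move=> [S SC KS]; apply: (dc S) => //; apply/subsetP => i iK.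
apply: ray_in_cone => //; apply/KS/cone_ofP; exists (fun k => (k == i)%:R); split.
- by move=> k; rewrite ler0n.
- by move=> k kK; case: eqP => // E; rewrite -E (negPf kK) in iK.
exact: realv_ray.
Qed.

Lemma chow_ideal_cid p : chow_ideal u cones p <-> cid cones u p.
Proof.
split=> [[a [s [aK ->]]]|].
  apply: cid_add.
    apply: cid_sum => K _; have [->|/aK nK] := eqVneq (a K) 0; first by rewrite mul0r; apply: cid0.
    apply: cid_face; apply/negP => KC; apply: nK; by exists K.
  by apply: cid_sum => mb _; apply: cid_lin.
elim=> [a K KC|a m|p1 p2 _ [a1 [s1 [h1 ->]]] _ [a2 [s2 [h2 ->]]]].
- exists (fun L => if L == K then a else 0), [::]; split.
    move=> L; case: (L =P K) => [-> _ /spans_cone_in KC'|_]; last by rewrite eqxx.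
    by rewrite KC' in KC.
  rewrite big_nil addr0 (bigD1 K)//= eqxx [X in _ = _ + X]big1 ?addr0// => L /negPf ->.
  by rewrite mul0r.
- exists (fun=> 0), [:: (m, a)]; split; first by move=> K; rewrite eqxx.
  by rewrite big_seq1 big1 ?add0r// => K _; rewrite mul0r.
exists (fun K => a1 K + a2 K), (s1 ++ s2); split.
  move=> K; have [E|/h1//] := eqVneq (a1 K) 0; rewrite E add0r; exact: h2.
rewrite big_cat /= addrACA; congr (_ + _); rewrite -big_split.
by apply: eq_bigr => K _; rewrite mulrDl.
Qed.

End SmoothFan.

Lemma Rlinear_rcomb n m (f : rvec n -> rvec m) r (u : 'I_r -> 'rV[int]_n) lam e :
  Rlinear f -> f (rcomb u lam) e = \sum_i lam i * f (realv (u i)) e.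
Proof.
move=> [fD fM].
suff h (s : seq 'I_r) : f (fun j => \sum_(i <- s) lam i * (u i 0 j)%:~R) e =
  \sum_(i <- s) lam i * f (realv (u i)) e.
  by rewrite -h.
elim: s => [|i s IH].
  rewrite big_nil -[RHS](mul0r (f (fun=> 0) e)) -[RHS]fM.
  by congr (f _ e); apply: functional_extensionality => j; rewrite big_nil; apply: esym (mul0r (0 : R)).
rewrite big_cons -IH -[lam i * _]fM -[RHS]fD.
by congr (f _ e); apply: functional_extensionality => j; rewrite big_cons.
Qed.

(** * Carrying the smooth fan to the coordinates of the matroid *)

Section Transport.
Variables (n r : nat) (u : 'I_r -> 'rV[int]_n) (cones : {set {set 'I_r}}).
Hypothesis smooth : is_smooth_fan u cones.
Let uni := smooth_unimodular smooth.
Local Notation T := (fan_support u cones).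

Lemma in_span_rcomb lam : in_span T (rcomb u lam).
Proof.
exists r, lam, (fun i => realv (u i)); split=> // i.
have [_ rays _ _ _] := smooth; exists [set i] => //; apply/cone_ofP.
exists (fun k => (k == i)%:R); split; last exact: realv_ray.
  by move=> k; rewrite ler0n.
by move=> k; rewrite inE => /negPf ->.
Qed.

Variables (m : nat) (C : {set {set 'I_m}}) (f : rvec n -> rvec m) (e0 : 'I_m).
Hypotheses (flin : Rlinear f).
Hypothesis finj : forall x y, in_span T x -> in_span T y -> eq_mod1 (f x) (f y) -> forall j, x j = y j.
Hypothesis fint : forall x, in_span T x -> (is_int_vec x <-> int_mod1 (f x)).
Hypothesis fsub : forall x, T x -> Ltilde C (f x).
Hypothesis fsurj : forall w, Ltilde C w -> exists2 x, T x & eq_mod1 (f x) w.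

Local Notation F x := (fun e => f x e - f x e0).

Lemma int_mod1P x : int_mod1 (f x) <-> exists z, F x = realv z.
Proof.
split=> [[z [c zE]]|[z zE]].
  exists (\row_e (z e - z e0)); apply: functional_extensionality => e.
  by rewrite /realv mxE !zE !intRE !RplusE rmorphB /= opprD addrACA subrr addr0.
exists (fun e => z 0 e), (f x e0) => e; have := congr1 (@^~ e) zE; rewrite /realv /= intRE RplusE => <-.
by rewrite subrK.
Qed.

Lemma transport_rays : exists u' : 'I_r -> 'rV[int]_m, forall v, F (realv (u v)) = realv (u' v).
Proof.
suff /fin_all_exists [c cE] (v : 'I_r) : exists z : 'rV[int]_m, F (realv (u v)) = realv z by exists c.
apply/int_mod1P; rewrite -fint; first by apply/is_int_vecP; exists (u v).
by rewrite realv_ray; apply: in_span_rcomb.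
Qed.

Variable u' : 'I_r -> 'rV[int]_m.
Hypothesis u'E : forall v, F (realv (u v)) = realv (u' v).

Lemma F_rcomb lam : F (rcomb u lam) = rcomb u' lam.
Proof.
apply: functional_extensionality => e; rewrite !Rlinear_rcomb// -sumrB.
by apply: eq_bigr => i _; rewrite -mulrBr; have := congr1 (@^~ e) (u'E i) => /= ->.
Qed.

Lemma rcomb_inj_transport lam lam' : rcomb u lam = rcomb u lam' <-> rcomb u' lam = rcomb u' lam'.
Proof.
split=> [E|]; first by rewrite -!F_rcomb E.
rewrite -!F_rcomb => E; apply: functional_extensionality; apply: finj; try exact: in_span_rcomb.
exists (f (rcomb u lam) e0 - f (rcomb u lam') e0) => e; have := congr1 (@^~ e) E => /=; rewrite RplusE.
by move/eqP; rewrite subr_eq => /eqP ->; rewrite -addrA; congr (_ + _); rewrite addrC.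
Qed.

Lemma rcomb_int_transport lam :
  (exists z, rcomb u lam = realv z) <-> (exists z, rcomb u' lam = realv z).
Proof. by rewrite -is_int_vecP fint ?int_mod1P ?F_rcomb//; apply: in_span_rcomb. Qed.

(** For nonzero q, divisibility is integrality of the real combination divided by q, which f
    preserves in both directions; for q = 0 it is a linear relation, preserved by injectivity. *)
Lemma divisible_transport (a : 'I_r -> int) q :
  (exists y, combz u a = y *~ q) <-> (exists y, combz u' a = y *~ q).
Proof.
have [->|q0] := eqVneq q 0.
  have h k (w : 'I_r -> 'rV[int]_k) : (exists y, combz w a = y *~ 0) <->
      rcomb w (fun i => (a i)%:~R) = rcomb w (fun i => 0%:~R).
    rewrite !rcomb_int; have -> : combz w (fun=> 0) = 0 by rewrite /combz big1.
    by split=> [[y ->]|/realv_inj ->]; [rewrite mulr0z | exists 0].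
  by rewrite !h rcomb_inj_transport.
have h k (w : 'I_r -> 'rV[int]_k) : (exists y, combz w a = y *~ q) <->
    exists z, rcomb w (fun i => (q%:~R)^-1 * (a i)%:~R) = realv z.
  have q1 : q%:~R != 0 :> R by rewrite intr_eq0.
  have yE (y : 'rV[int]_k) j : (y *~ q) 0 j = q * y 0 j.
    by rewrite -scaler_int mxE intz.
  rewrite rcombZ rcomb_int; split=> [[y ->]|[z zE]].
    exists y; apply: functional_extensionality => j.
    by rewrite /realv yE rmorphM mulKf.
  exists z; apply/rowP => j; rewrite yE; apply: (@intr_inj R); rewrite rmorphM.
  by have := congr1 (@^~ j) zE; rewrite /realv /= => <-; rewrite mulVKf.
by rewrite !h rcomb_int_transport.
Qed.
Lemma pairing_to_u x' : exists x, forall v, pairing x' (u' v) = pairing x (u v).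
Proof. by apply: pairing_transport => a q /divisible_transport. Qed.

Lemma pairing_to_u' x : exists x', forall v, pairing x (u v) = pairing x' (u' v).
Proof. by apply: pairing_transport => a q /divisible_transport. Qed.

Lemma Ltilde_realv (w : 'rV[int]_m) : Ltilde C (realv w) <-> forall U, U \in C -> mintwice w U.
Proof.
split=> h U UC.
  have [a [b [aU bU ab wab le]]] := h U UC; apply/mintwiceP; exists a, b; split=> //.
    exact: (@intr_inj R).
  by move=> y yU; have /RleP := le y yU; rewrite ler_int.
have /mintwiceP [a [b [aU bU ab wab le]]] := h U UC; exists a, b; split=> //.
  by rewrite /realv wab.
by move=> y yU; apply/RleP; rewrite ler_int le.
Qed.

Lemma Ltilde_mod1 (x y : rvec m) : eq_mod1 x y -> Ltilde C x -> Ltilde C y.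
Proof.
move=> [c xy] h U UC; have [a [b [aU bU ab xab le]]] := h U UC; exists a, b; split=> //.
  by move: xab; rewrite !xy !RplusE => /addIr.
by move=> e eU; have /RleP := le e eU; rewrite !xy !RplusE lerD2r => /RleP.
Qed.

Lemma F_mod1 x w : F x = realv w -> eq_mod1 (f x) (realv w).
Proof. by move=> <-; exists (f x e0) => e; rewrite RplusE subrK. Qed.

Lemma rcomb_nat (c : 'I_r -> nat) k (w : 'I_r -> 'rV[int]_k) :
  rcomb w (fun i => (c i)%:~R) = realv (comb w c).
Proof. by rewrite rcomb_int combzE. Qed.

Lemma supp_notin (c : 'I_r -> nat) i : i \notin supp c -> (c i)%:~R = 0 :> R.
Proof. by rewrite inE negbK => /eqP ->. Qed.

Lemma T_comb (c : 'I_r -> nat) : supp c \in cones -> T (rcomb u (fun i => (c i)%:~R)).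
Proof.
move=> cC; exists (supp c) => //; apply/cone_ofP; exists (fun i => (c i)%:~R).
by split=> //; apply: supp_notin.
Qed.

(** A lattice point of the target lifts to a real point of the support. This point is integral
    because f reflects integrality, and its cone coefficients are integral by unimodularity. *)
Lemma fan_transport : fan (TL e0 C setT) cones u'.
Proof.
have [_ _ dc inter _] := smooth; split.
- exact: dc.
- move=> s k sC ks; have [x [xk xl]] := uni sC ks; have [x' x'E] := pairing_to_u' x.
  by exists x'; split=> [|l ls lk]; rewrite -x'E ?xk ?xl.
- move=> c cC; have Fc := etrans (F_rcomb (fun i => (c i)%:~R)) (rcomb_nat c u').
  split=> [x||].
  + by rewrite inE.
  + by apply: (@intr_inj R); have := congr1 (@^~ e0) Fc; rewrite /realv /= subrr => <-.
  by apply/Ltilde_realv; apply: Ltilde_mod1 (F_mod1 Fc) (fsub (T_comb cC)).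
- move=> w [_ w0 wC]; have [x Tx xw] := fsurj ((Ltilde_realv w).2 wC).
  have Fx : F x = realv w.
    have [c cE] := xw; apply: functional_extensionality => e.
    by rewrite !cE !RplusE opprD addrACA subrr addr0 /realv w0 subr0.
  have [S SC /cone_ofP [lam [l0 lS xE]]] := Tx.
  have [z zE] : exists z, x = realv z.
    apply/is_int_vecP/fint; first by rewrite xE; apply: in_span_rcomb.
    by apply/int_mod1P; exists w.
  have [c cE] := rcomb_integral uni SC lS (etrans (esym xE) zE).
  have lE : lam = fun i => (absz (c i))%:~R.
    apply: functional_extensionality => i; rewrite cE gez0_abs//.
    by rewrite -(ler0z R) -cE.
  exists (fun i => absz (c i)).
    apply: (dc S) => //; apply/subsetP => i; rewrite inE; apply: contraNT => /lS.
    by rewrite cE => /eqP; rewrite intr_eq0 absz_eq0.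
  by apply: realv_inj; rewrite -rcomb_nat -F_rcomb -lE -xE.
move=> c c' cC cC' E i.
have E' : rcomb u (fun i => (c i)%:~R) = rcomb u (fun i => (c' i)%:~R).
  by apply/rcomb_inj_transport; rewrite !rcomb_nat E.
have cone (b : 'I_r -> nat) : cone_of u (supp b) (rcomb u (fun i => (b i)%:~R)).
  by apply/cone_ofP; exists (fun i => (b i)%:~R); split=> //; apply: supp_notin.
have := cone c'; rewrite -E' => c'x.
have /cone_ofP [lam [_ lS lE]] := (inter _ _ cC cC' _).1 (conj (cone c) c'x).
have lc : (fun i => (c i)%:~R) =1 lam.
  apply: (rcomb_inj uni cC _ _ lE); first exact: supp_notin.
  by move=> k kc; apply: lS; rewrite inE negb_and kc.
have lc' : (fun i => (c' i)%:~R) =1 lam.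
  apply: (rcomb_inj uni cC' _ _ (etrans (esym E') lE)); first exact: supp_notin.
  by move=> k kc; apply: lS; rewrite inE negb_and kc orbT.
by have /(@intr_inj R) [] := etrans (lc i) (esym (lc' i)).
Qed.

End Transport.

Lemma tropical_fan n r (u : 'I_r -> 'rV[int]_n) (cones : {set {set 'I_r}}) :
  is_smooth_fan u cones -> is_tropical_linear_space (fan_support u cones) ->
  exists m (e0 : 'I_m) (UU : {set {set 'I_m}}) (u' : 'I_r -> 'rV[int]_m),
  [/\ selim UU, fan (TL e0 UU setT) cones u',
      forall x, exists x', forall v, pairing x (u v) = pairing x' (u' v)
    & forall x', exists x, forall v, pairing x' (u' v) = pairing x (u v)].
Proof.
move=> smooth [m [C [f [matroid flin [_ finj _ fint [fsub fsurj]]]]]].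
case: m C f matroid flin finj fint fsub fsurj => [|m] C f matroid flin finj fint fsub fsurj.
  (* An empty ground set offers no [e0]. The space is then a point, so there are no rays, and a
     one-element ground set without circuits takes its place. *)
  have r0 : 'I_r -> False.
    move=> v; have [_ rays _ _ _] := smooth.
    have [x [xv _]] := smooth_unimodular smooth (rays v) (set11 v).
    have /realv_inj v0 : realv (u v) = realv 0.
      have z0 : realv (0 : 'rV[int]_n) = rcomb u (fun i => 0%:~R).
        by rewrite rcomb_int /combz big1.
      apply: functional_extensionality; apply: finj.
      - by rewrite realv_ray; apply: in_span_rcomb.
      - by rewrite z0; apply: in_span_rcomb.
      by exists R0 => -[].
    by rewrite v0 pairing0r in xv.
  exists 1%N, ord0, set0, (fun=> 0); split=> [U V g h||x|x].
  - by rewrite inE.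
  - have [c0 _ dc _ _] := smooth; split=> [|s k||x|c c' _ _ _ v]; last by case: (r0 v).
    + exact: dc.
    + by case: (r0 k).
    + move=> c _; split=> [v||U]; rewrite ?inE// /comb big1 ?mxE// => v; by case: (r0 v).
    move=> [_ x0 _]; exists (fun=> 0%N).
      by rewrite (_ : supp _ = set0)//; apply/setP => v; case: (r0 v).
    apply/rowP => j; rewrite ord1 x0 /comb big1 ?mxE// => v; by case: (r0 v).
  - by exists 0 => v; case: (r0 v).
  by exists 0 => v; case: (r0 v).
have [u' u'E] := transport_rays smooth ord0 fint.
exists m.+1, ord0, C, u'; split.
- exact: circuit_elimination.
- exact: (fan_transport smooth flin finj fint fsub fsurj u'E).
- exact: (pairing_to_u' smooth flin finj fint u'E).
exact: (pairing_to_u smooth flin finj fint u'E).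
Qed.

Theorem theorem3p8 (n r : nat) (u : 'I_r -> 'rV[int]_n)
  (cones : {set {set 'I_r}}) :
  is_smooth_fan u cones ->
  is_tropical_linear_space (fan_support u cones) ->
  poincare_duality (chow_ideal u cones) (fan_dim cones).
Proof.
move=> smooth trop; have [m [e0 [UU [u' [se F uu' u'u]]]]] := tropical_fan smooth trop.
have [||d [r1 [D1 [u1 [F1 H1]]]]] := TL_HPD se (E := setT) (e0 := e0); rewrite ?inE//.
have H : HPD cones u' d := HPD_indep F1 H1 F; have [c0 _ _ _ _] := smooth.
(* The rays u and [u'] live in different lattices but admit the same linear relations between
   variables, so the ideals coincide. *)
have -> : chow_ideal u cones = cid cones u'.
  apply: functional_extensionality => p; apply: propositional_extensionality.
  by rewrite chow_ideal_cid//; split; apply: cid_change.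
have -> : fan_dim cones = d.
  have [[le ex] _] := H; have [t tC td] := ex _ c0; apply/eqP; rewrite eqn_leq; apply/andP; split.
    by apply/bigmax_leqP => s /le.
  by rewrite -td /fan_dim; apply: (leq_bigmax_cond (F := fun s : {set 'I_r} => #|s|)).
exact: HPD_poincare c0 (fan_uni F) H.
Qed.
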